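(* The problem $1|jrp,s=const,p_j=p,r_j|\sum C_j+c_\mathcal{Q}$, in which each job requires exactly one resource, is solvable in polynomial time.
   Context: Problem $1|jrp,r_j|c_S+c_\mathcal{Q}$: a set $\mathcal{J}$ of $n$ jobs must be processed non-preemptively on a single machine that processes at most one job at a time. Job $j$ has processing time $p_j>0$ and release date $r_j\ge 0$. There are resources $\mathcal{R}=\{R_1,\dots,R_s\}$, and each job $j$ requires a nonempty subset $R(j)\subseteq\mathcal{R}$. There are nonnegative costs $K_0,K_1,\dots,K_s$. A solution is a pair $(S,\mathcal{Q})$, where $S$ assigns a start time $S_j$ to each job (completion time $C_j=S_j+p_j$), and $\mathcal{Q}=\{(\mathcal{R}_1,t_1),\dots,(\mathcal{R}_q,t_q)\}$ with $t_1<\dots<t_q$ and $\mathcal{R}_\ell\subseteq\mathcal{R}$ (the resources in $\mathcal{R}_\ell$ are replenished at time $t_\ell$). Job $j$ is ready to be started at time $t$ if $R(j)\subseteq\bigcup_{\ell:\,t_\ell\in[r_j,t]}\mathcal{R}_\ell$. The solution is feasible if no two jobs overlap and each job $j$ is ready to be started at $S_j$. The replenishment cost is $c_\mathcal{Q}=\sum_{\ell=1}^q(K_0+\sum_{R_i\in\mathcal{R}_\ell}K_i)$. In $1|jrp,s=const,p_j=p,r_j|\sum C_j+c_\mathcal{Q}$ the number $s$ of resources is a fixed constant (not part of the input), all jobs have the same processing time $p$, and the goal is to minimize $\sum_jC_j+c_\mathcal{Q}$. *)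

(* Defs.v *)
From HB Require Import structures.
From mathcomp Require Import all_boot all_order all_algebra.
Set Implicit Arguments.
Unset Strict Implicit.
Unset Printing Implicit Defensive.
Import Order.TTheory GRing.Theory Num.Theory.

(* Model of computation: the random access machine with arithmetic
   instructions under the logarithmic cost criterion (Aho, Hopcroft, Ullman,
   "The Design and Analysis of Computer Algorithms", Section 1.3), with
   structured control flow instead of jumps.  This model is polynomially
   related to Turing machines. *)

(* floor (log2 x) + 1, and 1 for x = 0 *)
Definition bitlen (x : nat) : nat := (trunc_log 2 x).+1.

Definition memory := nat -> nat.

Definition store (m : memory) (a v : nat) : memory :=
  fun b => if b == a then v else m b.

Inductive expr :=
  | Const of nat
  | Read of expr
  | Add of expr & expr
  | Sub of expr & expr   (* truncated subtraction *)
  | Mul of expr & expr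
  | Div of expr & expr.  (* Euclidean quotient *)

Inductive cmd :=
  | Skip
  | Write of expr & expr (* Write a e: the cell of address a receives e *)
  | Seq of cmd & cmd
  | If of expr & cmd & cmd
  | While of expr & cmd.

Fixpoint eval (m : memory) (e : expr) : nat :=
  match e with
  | Const k => k
  | Read a => m (eval m a)
  | Add e1 e2 => eval m e1 + eval m e2
  | Sub e1 e2 => eval m e1 - eval m e2
  | Mul e1 e2 => eval m e1 * eval m e2
  | Div e1 e2 => eval m e1 %/ eval m e2
  end.

Fixpoint ecost (m : memory) (e : expr) : nat :=
  match e with
  | Const k => bitlen k
  | Read a => ecost m a + bitlen (eval m a) + bitlen (m (eval m a))
  | Add e1 e2 | Sub e1 e2 | Mul e1 e2 | Div e1 e2 =>
      ecost m e1 + ecost m e2 + bitlen (eval m e1) + bitlen (eval m e2)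
  end.

(* exec c m m' t: c started in memory m halts in memory m' at total cost t *)
Inductive exec : cmd -> memory -> memory -> nat -> Prop :=
  | ExecSkip m : exec Skip m m 1
  | ExecWrite a e m :
      exec (Write a e) m (store m (eval m a) (eval m e))
        (ecost m a + ecost m e + bitlen (eval m a) + bitlen (eval m e))
  | ExecSeq c1 c2 m1 m2 m3 t1 t2 :
      exec c1 m1 m2 t1 -> exec c2 m2 m3 t2 -> exec (Seq c1 c2) m1 m3 (t1 + t2)
  | ExecIfTrue e c1 c2 m m' t :
      eval m e != 0 -> exec c1 m m' t ->
      exec (If e c1 c2) m m' (ecost m e + bitlen (eval m e) + t)
  | ExecIfFalse e c1 c2 m m' t :
      eval m e = 0 -> exec c2 m m' t ->
      exec (If e c1 c2) m m' (ecost m e + bitlen (eval m e) + t)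
  | ExecWhileTrue e c m1 m2 m3 t1 t2 :
      eval m1 e != 0 -> exec c m1 m2 t1 -> exec (While e c) m2 m3 t2 ->
      exec (While e c) m1 m3 (ecost m1 e + bitlen (eval m1 e) + t1 + t2)
  | ExecWhileFalse e c m :
      eval m e = 0 -> exec (While e c) m m (ecost m e + bitlen (eval m e)).

(* A word is a finite list of numbers written in binary.  It is passed to and
   returned by a program in cells 1, 2, ..., its length being in cell 0; all
   the other cells are initially 0. *)
Definition word := seq nat.

Definition wsize (w : word) : nat := \sum_(x <- w) bitlen x.

Definition input (w : word) : memory := nth 0 (size w :: w).

Definition output (m : memory) : word := mkseq (fun i => m i.+1) (m 0).

(* On every code of every instance of the class, the program halts and returns
   a code of a solution meeting the specification; as in the reference above,
   the output is charged for. *)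
Definition poly_time_solvable (X : Type) (Y : X -> Type) (class : X -> Prop)
    (encX : X -> word -> Prop) (encY : forall x, Y x -> word -> Prop)
    (spec : forall x, Y x -> Prop) : Prop :=
  exists (prog : cmd) (c k : nat), forall (x : X) (w : word),
    class x -> encX x w ->
    exists (m : memory) (t : nat) (y : Y x),
      [/\ exec prog (input w) m t,
          t + wsize (output m) <= c * wsize w ^ k + c,
          encY x y (output m) & spec x y].

Local Open Scope ring_scope.

(* 1|jrp, r_j|c_S + c_Q with s resources; jobs are numbered from 0, and
   rcost i is the cost K_(i+1) of the resource numbered i. *)
Record instance (R : realFieldType) (s : nat) := Instance {
  njobs : nat;
  ptime : 'I_njobs -> R;
  rdate : 'I_njobs -> R;
  req : 'I_njobs -> {set 'I_s};
  fixcost : R; (* K_0 *)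
  rcost : 'I_s -> R;
  ptime_gt0 : forall j, 0 < ptime j;
  rdate_ge0 : forall j, 0 <= rdate j;
  req_neq0 : forall j, req j != set0;
  fixcost_ge0 : 0 <= fixcost;
  rcost_ge0 : forall i, 0 <= rcost i }.

Record solution (R : realFieldType) (s : nat) (I : instance R s) := Solution {
  start : 'I_(njobs I) -> R;
  repl : seq ({set 'I_s} * R);
  repl_sorted : sorted <%R (unzip2 repl) }.

Section Problem.
Variables (R : realFieldType) (s : nat) (I : instance R s).
Implicit Type sol : solution I.

Definition completion sol (j : 'I_(njobs I)) : R := start sol j + ptime j.

Definition ready sol (j : 'I_(njobs I)) (t : R) : Prop :=
  req j \subset (\bigcup_(q <- repl sol | rdate j <= q.2 <= t) q.1)%SET.

Definition feasible sol : Prop :=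
  (forall j k, j != k ->
     completion sol j <= start sol k \/ completion sol k <= start sol j) /\
  (forall j, ready sol j (start sol j)).

Definition repl_cost sol : R :=
  \sum_(q <- repl sol) (fixcost I + \sum_(i in q.1) rcost I i).

Definition objective sol : R :=
  (\sum_j completion sol j) + repl_cost sol.

Definition optimal sol : Prop :=
  feasible sol /\ forall sol', feasible sol' -> objective sol <= objective sol'.

Definition equal_ptimes : Prop := exists p : R, forall j, @ptime R s I j = p.

Definition single_resource : Prop := forall j, #|@req R s I j| = 1%N.

(* Numbers are coded as fractions, not necessarily in lowest terms; the
   instances that have a code are those whose data are rational. *)
Definition frac_of (f : nat * nat) (x : R) : Prop :=
  f.2 != 0%N /\ x = f.1%:R / f.2%:R.

Definition frac_word (f : nat * nat) : word := [:: f.1; f.2].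

Definition set_word (A : {set 'I_s}) : word :=
  [seq nat_of_bool (i \in A) | i <- enum 'I_s].

Definition encodes_instance (w : word) : Prop :=
  exists (fK0 : nat * nat) (fK : 'I_s -> nat * nat)
         (fp fr : 'I_(njobs I) -> nat * nat),
    [/\ frac_of fK0 (fixcost I),
        forall i, frac_of (fK i) (rcost I i),
        forall j, frac_of (fp j) (ptime j),
        forall j, frac_of (fr j) (rdate j) &
        w = njobs I :: frac_word fK0
            ++ flatten [seq frac_word (fK i) | i <- enum 'I_s]
            ++ flatten [seq frac_word (fp j) ++ frac_word (fr j)
                              ++ set_word (req j) | j <- enum 'I_(njobs I)]].

Definition encodes_solution sol (w : word) : Prop :=
  exists (fS : 'I_(njobs I) -> nat * nat) (ft : seq (nat * nat)),
    [/\ forall j, frac_of (fS j) (start sol j),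
        size ft = size (repl sol),
        forall l, (l < size ft)%N ->
          frac_of (nth (0, 0)%N ft l) (nth 0 (unzip2 (repl sol)) l) &
        w = flatten [seq frac_word (fS j) | j <- enum 'I_(njobs I)]
            ++ size (repl sol)
            :: flatten [seq frac_word q.1 ++ set_word q.2
                       | q <- zip ft (unzip1 (repl sol))]].

End Problem.

(* Main.v *)
Require Import Defs.
From mathcomp Require Import all_boot all_order all_algebra.
From mathcomp Require Import zify ring lra.
Set Implicit Arguments.
Unset Strict Implicit.
Unset Printing Implicit Defensive.

(** Multiplying all data by the product of the denominators makes them integral.
    A replenishment can be moved back to the last release date preceding it, so
    only release dates matter ("layers").  Once the replenishments are fixed, a
    job becomes available at the first layer, from its release date on, at which
    its resource is replenished; since all jobs have length [p], it is optimal to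
    start the available jobs one after the other without idle time, and the cost
    depends only on the numbers of jobs that become available at each layer.

    Hence the past is summarized by the last replenishment of each resource and
    by the time at which the machine becomes idle, which has the form
    [release date + k p] with [k <= n].  This gives at most [(n + 1)^(s + 2)]
    states, with [2^s] decisions in each of them, and a backward dynamic program
    over the layers followed by a forward simulation yields an optimal solution.
    Release dates are shifted by one, so that 0 precedes all of them. *)

(** * Polynomial bounds and logarithmic costs *)

(** An arbitrary real-valued solution is never normalized: its replenishments are turned into
    decisions whose path cost is at most its scaled objective. Scaling replaces a time [x] by
    [x * D + 1], so an objective value [v] becomes [v * D + n], one unit for each completion time.
    Serving every pending job at the last layer removes infeasible decision sequences, so the tables
    need no infinite value; the lower bound survives because decisions extracted from a feasible
    solution never trigger this forced service. A layer pays only for resources of jobs that it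
    actually serves.

    The logarithmic cost is handled uniformly. If [B] bounds all stored values and [X] all loop
    lengths, a fixed program costs at most a polynomial in [X] times [bitlen B]. It is then enough
    that [X] is polynomial in the input size and that [B] has polynomially many bits; the latter
    rests on the product of the denominators being at most [2 ^ wsize w]. As [s] is fixed, it may
    occur in exponents and in the program text. *)

Definition polybounded (f : nat -> nat) :=
  exists c k, forall y, f y <= c * y ^ k + c.

Lemma polybounded_le f g : (forall y, f y <= g y) -> polybounded g -> polybounded f.
Proof. by move=> fg [c [k h]]; exists c, k => y; apply: leq_trans (fg y) (h y). Qed.

Lemma polybounded_const c : polybounded (fun=> c).
Proof. by exists c, 0 => y; rewrite leq_addl. Qed.

Lemma polybounded_id : polybounded id.
Proof. by exists 1, 1 => y; rewrite expn1 mul1n leq_addr. Qed.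

(** The [+ 1] covers [y = 0], where [0 ^ 0 = 1] may exceed [0 ^ k]. It serves to bring two bounds to
    a common exponent. *)
Lemma leq_expn_succ y j k : j <= k -> y ^ j <= y ^ k + 1.
Proof.
move=> jk; case: y => [|y]; last by rewrite (leq_trans (leq_pexp2l _ jk)) ?leq_addr.
by apply: leq_trans (leq_addl _ _); case: j {jk} => // j; rewrite exp0n.
Qed.

Lemma polybounded_add f g :
  polybounded f -> polybounded g -> polybounded (fun y => f y + g y).
Proof.
move=> [c [k hf]] [c' [k' hg]]; exists (2 * (c + c')), (maxn k k') => y.
have h1 := leq_expn_succ y (leq_maxl k k').
have h2 := leq_expn_succ y (leq_maxr k k').
move: (hf y) (hg y) h1 h2; set a := y ^ k; set b := y ^ k'; set e := y ^ _.
nia.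
Qed.

Lemma polybounded_mul f g :
  polybounded f -> polybounded g -> polybounded (fun y => f y * g y).
Proof.
move=> [c [k hf]] [c' [k' hg]]; exists (4 * (c * c')), (k + k') => y.
apply: leq_trans (leq_mul (hf y) (hg y)) _.
have h1 := leq_expn_succ y (leq_addr k' k).
have h2 := leq_expn_succ y (leq_addl k k').
move: h1 h2; rewrite {3}expnD.
have := expnD y k k'; set a := y ^ k; set b := y ^ k'; set e := y ^ _ => -> h1 h2.
have -> : (c * a + c) * (c' * b + c') = c * c' * (a * b + a + b + 1) by lia.
have -> : 4 * (c * c') * (a * b) + 4 * (c * c') = c * c' * (4 * (a * b) + 4) by lia.
by rewrite leq_mul2l; apply/orP; right; lia.
Qed.

Lemma polybounded_exp f k : polybounded f -> polybounded (fun y => f y ^ k).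
Proof.
move=> hf; elim: k => [|k IH].
  by apply: polybounded_le (polybounded_const 1) => y; rewrite expn0.
apply: polybounded_le (polybounded_mul hf IH) => y; by rewrite expnS.
Qed.

Lemma polybounded_comp f g :
  polybounded f -> polybounded g -> polybounded (fun y => f (g y)).
Proof.
move=> [c [k hf]] hg.
apply: polybounded_le (polybounded_add (polybounded_mul (polybounded_const c)
  (polybounded_exp k hg)) (polybounded_const c)) => y; exact: hf.
Qed.

Lemma ltn_bitlen x : x < 2 ^ bitlen x.
Proof. by rewrite /bitlen trunc_log_ltn. Qed.

Lemma bitlen_ltn x k : 0 < k -> x < 2 ^ k -> bitlen x <= k.
Proof.
case: k => // k _; case: x => [|x] h; first by rewrite /bitlen trunc_log0.
have h1 := @trunc_logP 2 x.+1 isT isT.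
have := leq_ltn_trans h1 h.
by rewrite /bitlen ltn_exp2l.
Qed.

Lemma leq_bitlen x y : x <= y -> bitlen x <= bitlen y.
Proof. by move=> xy; apply: bitlen_ltn => //; apply: leq_ltn_trans xy (ltn_bitlen y). Qed.

Lemma bitlen_exp x k : 0 < k -> bitlen (x ^ k) <= k * bitlen x.
Proof.
move=> k0; apply: bitlen_ltn; first by rewrite muln_gt0 k0.
by rewrite mulnC expnM ltn_exp2r // ltn_bitlen.
Qed.

Lemma bitlen_leS x : bitlen x <= x.+1.
Proof. by apply: bitlen_ltn => //; rewrite ltnW // ltn_expl. Qed.

(** * Logarithmic cost of instructions over bounded memory *)

Definition bounded (B : nat) (m : memory) := forall a, m a <= B.

(** An exponent [k] such that values are at most [B ^ k] for every [B > 1]. Sums add exponents just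
    as products do, because [x + y <= x * y] for [x, y >= 2]. Counting a constant in unary is
    enough, since [k < 2 ^ k] and the program text is fixed. *)
Fixpoint esize (e : expr) : nat :=
  match e with
  | Const k => k.+1
  | Read a => (esize a).+1
  | Add a b | Defs.Sub a b | Mul a b | Div a b => esize a + esize b
  end.

Lemma esize_gt0 e : 0 < esize e.
Proof. by elim: e => //= a ha b hb; rewrite addn_gt0 ha. Qed.

Lemma eval_bound B m e : 1 < B -> bounded B m -> eval m e <= B ^ esize e.
Proof.
move=> B1 bm; have X1 k : 0 < k -> 1 < B ^ k by move=> k0; rewrite -(exp1n k) ltn_exp2r.
elim: e => [k|a _|a ha b hb|a ha b hb|a ha b hb|a ha b hb] /=.
- by apply: ltnW; apply: leq_trans (ltn_expl k B1) _; rewrite leq_pexp2l // ltnW.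
- by apply: leq_trans (bm _) _; rewrite -{1}(expn1 B) leq_pexp2l // ltnW.
- rewrite expnD; apply: leq_trans (leq_add ha hb) _.
  by have := X1 _ (esize_gt0 a); have := X1 _ (esize_gt0 b); nia.
- apply: leq_trans (leq_subr _ _) _; apply: leq_trans ha _.
  by rewrite leq_pexp2l ?leq_addr // ltnW.
- by rewrite expnD leq_mul.
- apply: leq_trans (leq_div _ _) _; apply: leq_trans ha _.
  by rewrite leq_pexp2l ?leq_addr // ltnW.
Qed.

(** Addresses are values of expressions too, so this bound covers them and only memory contents need
    the hypothesis [bounded]. *)
Lemma bitlen_eval B m e : 1 < B -> bounded B m ->
  bitlen (eval m e) <= esize e * bitlen B.
Proof.
move=> B1 bm; apply: leq_trans (leq_bitlen (eval_bound e B1 bm)) _.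
exact: bitlen_exp (esize_gt0 e).
Qed.

Fixpoint eweight (e : expr) : nat :=
  match e with
  | Const k => k.+1
  | Read a => eweight a + esize a + 1
  | Add a b | Defs.Sub a b | Mul a b | Div a b =>
      eweight a + eweight b + esize a + esize b
  end.

Lemma ecost_bound B m e : 1 < B -> bounded B m ->
  ecost m e <= eweight e * bitlen B.
Proof.
move=> B1 bm; have be := bitlen_eval _ B1 bm.
elim: e => [k|a ha|a ha b hb|a ha b hb|a ha b hb|a ha b hb] /=;
  rewrite ?mulnDl ?mul1n; try by rewrite !leq_add ?be.
- by apply: leq_trans (bitlen_leS k) _; rewrite leq_pmulr.
- by rewrite !leq_add ?be // leq_bitlen.
Qed.

Definition wweight (a e : expr) := eweight a + eweight e + esize a + esize e.
Definition cweight (e : expr) := eweight e + esize e.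

Lemma wcost_bound B m a e : 1 < B -> bounded B m ->
  ecost m a + ecost m e + bitlen (eval m a) + bitlen (eval m e)
    <= wweight a e * bitlen B.
Proof. by move=> B1 bm; rewrite /wweight !mulnDl !leq_add ?ecost_bound ?bitlen_eval. Qed.

Lemma ccost_bound B m e : 1 < B -> bounded B m ->
  ecost m e + bitlen (eval m e) <= cweight e * bitlen B.
Proof. by move=> B1 bm; rewrite /cweight !mulnDl !leq_add ?ecost_bound ?bitlen_eval. Qed.

Lemma bounded_store B m a v : v <= B -> bounded B m -> bounded B (store m a v).
Proof. by move=> vB bm b; rewrite /store; case: eqP => _. Qed.

(** * Programs over arrays with counted loops *)

(* The flat memory is read as [width] interleaved arrays: entry [i] of array
   [a] is the cell [width * i + a]; a scalar variable is entry 0 of an array. *)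
Notation width := 40.

Definition arrays := nat -> nat -> nat.

Definition upd (m : arrays) (a i v : nat) : arrays :=
  fun b j => if (b == a) && (j == i) then v else m b j.

Inductive hexp :=
  | HC of nat
  | HV of nat & hexp
  | HAdd of hexp & hexp
  | HSub of hexp & hexp
  | HMul of hexp & hexp
  | HDiv of hexp & hexp.

Inductive hcmd :=
  | HSet of nat & hexp & hexp
  | HSeq of hcmd & hcmd
  | HIf of hexp & hcmd & hcmd
  | HFor of nat & hexp & hcmd.

Fixpoint heval (m : arrays) (e : hexp) : nat :=
  match e with
  | HC k => k
  | HV a i => m a (heval m i)
  | HAdd a b => heval m a + heval m b
  | HSub a b => heval m a - heval m b
  | HMul a b => heval m a * heval m b
  | HDiv a b => heval m a %/ heval m b
  end.

Fixpoint sem (c : hcmd) (m : arrays) : arrays :=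
  match c with
  | HSet a i e => upd m a (heval m i) (heval m e)
  | HSeq c1 c2 => sem c2 (sem c1 m)
  | HIf e c1 c2 => if heval m e == 0 then sem c2 m else sem c1 m
  | HFor v e c =>
      iteri (heval m e) (fun i m' => upd (sem c m') v 0 i.+1) (upd m v 0 0)
  end.

(* Values written are at most [B] and loops run at most [X] times. *)
Fixpoint safe (B X : nat) (c : hcmd) (m : arrays) : Prop :=
  match c with
  | HSet a i e => heval m e <= B
  | HSeq c1 c2 => safe B X c1 m /\ safe B X c2 (sem c1 m)
  | HIf e c1 c2 => if heval m e == 0 then safe B X c2 m else safe B X c1 m
  | HFor v e c => heval m e <= X /\ forall i, i < heval m e ->
      safe B X c (iteri i (fun i m' => upd (sem c m') v 0 i.+1) (upd m v 0 0))
  end.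

Fixpoint reads (e : hexp) : seq nat :=
  match e with
  | HC _ => [::]
  | HV a i => a :: reads i
  | HAdd a b | HSub a b | HMul a b | HDiv a b => reads a ++ reads b
  end.

Fixpoint writes (c : hcmd) : seq nat :=
  match c with
  | HSet a _ _ => [:: a]
  | HSeq c1 c2 | HIf _ c1 c2 => writes c1 ++ writes c2
  | HFor v _ c => v :: writes c
  end.

Definition eok (e : hexp) := all (fun a => a < width) (reads e).

(** A compiled loop evaluates its bound anew at each round; the conditions on [HFor] ensure that the
    bound keeps its initial value and that only the loop itself moves the counter. Array numbers
    below [width] make the interleaving injective. *)
Fixpoint wf (c : hcmd) : bool :=
  match c with
  | HSet a i e => [&& a < width, eok i & eok e]
  | HSeq c1 c2 => wf c1 && wf c2
  | HIf e c1 c2 => [&& eok e, wf c1 & wf c2]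
  | HFor v e c => [&& v < width, v \notin writes c, eok e, wf c &
                      all (fun a => a \notin v :: writes c) (reads e)]
  end.

Fixpoint cexp (e : hexp) : expr :=
  match e with
  | HC k => Const k
  | HV a i => Read (Add (Mul (Const width) (cexp i)) (Const a))
  | HAdd a b => Add (cexp a) (cexp b)
  | HSub a b => Defs.Sub (cexp a) (cexp b)
  | HMul a b => Mul (cexp a) (cexp b)
  | HDiv a b => Div (cexp a) (cexp b)
  end.

Definition cset (a : nat) (i e : hexp) : cmd :=
  Write (Add (Mul (Const width) (cexp i)) (Const a)) (cexp e).

Fixpoint compile (c : hcmd) : cmd :=
  match c with
  | HSet a i e => cset a i e
  | HSeq c1 c2 => Seq (compile c1) (compile c2)
  | HIf e c1 c2 => If (cexp e) (compile c1) (compile c2)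
  | HFor v e c =>
      Seq (cset v (HC 0) (HC 0))
        (While (cexp (HSub e (HV v (HC 0))))
           (Seq (compile c) (cset v (HC 0) (HAdd (HV v (HC 0)) (HC 1)))))
  end.

Definition sweight (a : nat) (i e : hexp) :=
  wweight (Add (Mul (Const width) (cexp i)) (Const a)) (cexp e).

(** Cost per bit of [B]. A loop is charged [X] rounds and one final failing test, so the degree in
    [X] is at most the nesting depth. *)
Fixpoint hweight (X : nat) (c : hcmd) : nat :=
  match c with
  | HSet a i e => sweight a i e
  | HSeq c1 c2 => hweight X c1 + hweight X c2
  | HIf e c1 c2 => cweight (cexp e) + (hweight X c1 + hweight X c2)
  | HFor v e c => sweight v (HC 0) (HC 0) +
      ((X * (cweight (cexp (HSub e (HV v (HC 0)))) + (hweight X c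
         + sweight v (HC 0) (HAdd (HV v (HC 0)) (HC 1)))))
       + cweight (cexp (HSub e (HV v (HC 0)))))
  end.

Lemma polybounded_hweight c : polybounded (fun X => hweight X c).
Proof.
elim: c => [a i e|c1 h1 c2 h2|e c1 h1 c2 h2|v e c h] /=.
- exact: polybounded_const.
- exact: polybounded_add.
- by do !apply: polybounded_add => //; apply: polybounded_const.
- do ?[exact: polybounded_const | exact: polybounded_id | apply: polybounded_add
      | apply: polybounded_mul | exact: h].
Qed.

Definition agree (m : memory) (h : arrays) :=
  forall a i, a < width -> m (width * i + a) = h a i.

Lemma agree_upd m h a i v : a < width -> agree m h ->
  agree (store m (width * i + a) v) (upd h a i v).
Proof.
move=> aw ag b j bw; rewrite /store /upd.
have -> : (width * j + b == width * i + a) = (b == a) && (j == i).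
  by apply/idP/idP => [/eqP h0|/andP[/eqP-> /eqP->] //]; apply/andP; split; apply/eqP; lia.
by case: ifP => // _; apply: ag.
Qed.

Lemma eval_cexp m h e : agree m h -> eok e -> eval m (cexp e) = heval h e.
Proof.
move=> ag; rewrite /eok; elim: e => [k|a i IH|a ha b hb|a ha b hb|a ha b hb|a ha b hb] //=;
  rewrite ?all_cat => /andP[h1 h2]; rewrite ?ha ?hb //.
by rewrite IH // ag.
Qed.

Definition same (ws : seq nat) (m m' : arrays) :=
  forall a, a \notin ws -> m' a =1 m a.

Lemma same_trans ws m1 m2 m3 : same ws m1 m2 -> same ws m2 m3 -> same ws m1 m3.
Proof. by move=> h1 h2 a ha i; rewrite h2 // h1. Qed.

Lemma same_sub ws ws' m m' : {subset ws <= ws'} -> same ws m m' -> same ws' m m'.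
Proof. by move=> sub h a ha; apply: h; apply: contra ha; apply: sub. Qed.

Lemma same_upd ws m a i v : a \in ws -> same ws m (upd m a i v).
Proof.
by move=> aw b bw j; rewrite /upd; case: eqP => // eb; rewrite eb aw in bw.
Qed.

Lemma sem_same c m : same (writes c) m (sem c m).
Proof.
elim: c m => [a i e|c1 h1 c2 h2|e c1 h1 c2 h2|v e c h] m /=.
- by apply: same_upd; rewrite inE.
- apply: (same_trans (m2 := sem c1 m)).
    by apply: same_sub (h1 m) => x; rewrite mem_cat => ->.
  by apply: same_sub (h2 _) => x; rewrite mem_cat orbC => ->.
- by case: ifP => _; [apply: same_sub (h2 _)|apply: same_sub (h1 _)] => x;
    rewrite mem_cat => ->; rewrite ?orbT.
- elim: (heval m e) => [|N IH] /=; first by apply: same_upd; rewrite inE eqxx.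
  apply: same_trans IH _; apply: (same_trans (m2 := sem c _)).
    by apply: same_sub (h _) => x; rewrite inE orbC => ->.
  by apply: same_upd; rewrite inE eqxx.
Qed.

Lemma heval_same ws e m m' : same ws m m' ->
  all (fun a => a \notin ws) (reads e) -> heval m' e = heval m e.
Proof.
move=> sm; elim: e => [k|a i IH|a ha b hb|a ha b hb|a ha b hb|a ha b hb] //=;
  rewrite ?all_cat => /andP[h1 h2]; rewrite ?ha ?hb //.
by rewrite IH // sm.
Qed.

(** * Correctness of compilation, and verification rules *)

Section Correctness.
Variables (B X : nat).
Hypotheses (B1 : 1 < B) (XB : X <= B).

Lemma exec_cset a i e m h : a < width -> eok i -> eok e -> agree m h ->
    bounded B m -> heval h e <= B ->
  exists m' t, [/\ exec (cset a i e) m m' t, t <= sweight a i e * bitlen B,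
    agree m' (upd h a (heval h i) (heval h e)) & bounded B m'].
Proof.
move=> aw iw ew ag bm eB; set ad := Add (Mul (Const width) (cexp i)) (Const a).
exists (store m (eval m ad) (eval m (cexp e))); eexists; split.
- exact: ExecWrite.
- exact: wcost_bound.
- rewrite /ad /= !(eval_cexp ag) //; exact: agree_upd.
- by apply: bounded_store bm; rewrite (eval_cexp ag).
Qed.

(** Induction on the program, [h] being the array view of the flat memory [m]. The hypothesis [safe]
    keeps every intermediate memory bounded, which the cost bounds of single instructions
    require. *)
Lemma exec_compile c m h : wf c -> agree m h -> bounded B m -> safe B X c h ->
  exists m' t, [/\ exec (compile c) m m' t, t <= hweight X c * bitlen B,
    agree m' (sem c h) & bounded B m'].
Proof.
elim: c m h => [a i e|c1 IH1 c2 IH2|e c1 IH1 c2 IH2|v e c IH] m h /=.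
- by case/and3P=> aw iw ew; apply: exec_cset.
- case/andP=> w1 w2 ag bm [s1 s2].
  have [m1 [t1 [x1 l1 a1 b1]]] := IH1 _ _ w1 ag bm s1.
  have [m2 [t2 [x2 l2 a2 b2]]] := IH2 _ _ w2 a1 b1 s2.
  exists m2, (t1 + t2); split=> //; first exact: ExecSeq x1 x2.
  by rewrite mulnDl leq_add.
- case/and3P=> we w1 w2 ag bm; have ev := eval_cexp ag we.
  have cb := ccost_bound (cexp e) B1 bm.
  case: ifPn => e0 sf.
    have [m2 [t2 [x2 l2 a2 b2]]] := IH2 _ _ w2 ag bm sf.
    exists m2; eexists; split=> [||//|//]; [by apply: (@ExecIfFalse _ _ _ _ _ _ _ x2); rewrite ev; apply/eqP|].
    by move: cb l2; rewrite !mulnDl; lia.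
  have [m2 [t2 [x2 l2 a2 b2]]] := IH1 _ _ w1 ag bm sf.
  exists m2; eexists; split=> [||//|//]; [by apply: (@ExecIfTrue _ _ _ _ _ _ _ x2); rewrite ev|].
  by move: cb l2; rewrite !mulnDl; lia.
case/and5P=> vw vc we wc ewr ag bm [NX sf].
have [m0 [t0 [x0 l0 a0 b0]]] :=
  @exec_cset v (HC 0) (HC 0) m h vw isT isT ag bm (leq0n _).
set N := heval h e in NX sf *.
pose st i := iteri i (fun i m' => upd (sem c m') v 0 i.+1) (upd h v 0 0).
have sameI i : same (v :: writes c) h (st i).
  elim: i => [|i IHi]; first by apply: same_upd; rewrite inE eqxx.
  apply: same_trans IHi _ => /=; apply: (same_trans (m2 := sem c (st i))).
    by apply: same_sub (@sem_same c _) => x; rewrite inE orbC => ->.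
  by apply: same_upd; rewrite inE eqxx.
have stv i : st i v 0 = i by case: i => [|i]; rewrite /st /= /upd !eqxx.
set wc1 := cweight _; set ws := sweight v _ (HAdd _ _).
suff [m' [t' [x' l' a' b']]] : exists m' t', [/\ exec (While (cexp (HSub e (HV v (HC 0))))
    (Seq (compile c) (cset v (HC 0) (HAdd (HV v (HC 0)) (HC 1))))) m0 m' t',
    t' <= (N * (wc1 + (hweight X c + ws)) + wc1) * bitlen B, agree m' (st N) & bounded B m'].
  exists m', (t0 + t'); split=> //; first exact: ExecSeq x0 x'.
  rewrite mulnDl leq_add //; apply: leq_trans l' _.
  by rewrite leq_mul2r leq_add2r leq_mul2r NX !orbT.
have wsub : eok (HSub e (HV v (HC 0))) by rewrite /eok /= all_cat /= vw -/(eok e) we.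
have evW i m1 : agree m1 (st i) -> eval m1 (cexp (HSub e (HV v (HC 0)))) = N - i.
  move=> ag1; rewrite (eval_cexp ag1) //= stv.
  by rewrite (heval_same (sameI i)).
(* Induction on the number [k] of rounds left; the cost claimed is that of [k] rounds and one
   failing test. *)
suff key : forall k i m1, i <= N -> bounded B m1 -> N - i = k -> agree m1 (st i) ->
    exists m' t', [/\ exec (While (cexp (HSub e (HV v (HC 0))))
    (Seq (compile c) (cset v (HC 0) (HAdd (HV v (HC 0)) (HC 1))))) m1 m' t',
    t' <= (k * (wc1 + (hweight X c + ws)) + wc1) * bitlen B, agree m' (st N) & bounded B m'].
  by apply: (key N 0) => //; rewrite subn0.
elim=> [|k IHk] i m1 iN b1 ek a1.
  have e0 := evW i m1 a1; rewrite ek in e0.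
  exists m1; eexists; split; first exact: (ExecWhileFalse _ e0).
  - by rewrite mul0n add0n; apply: ccost_bound.
  - by have -> : N = i by lia.
  - done.
have iN' : i < N by lia.
have [m2 [t2 [x2 l2 a2 b2]]] := IH _ _ wc a1 b1 (sf i iN').
have vs : sem c (st i) v 0 = i by rewrite (@sem_same c) // stv.
have [||m3 [t3 [x3 l3 a3 b3]]] := @exec_cset v (HC 0) (HAdd (HV v (HC 0)) (HC 1)) m2 _ vw isT _ a2 b2.
- by rewrite /eok /= vw.
(* The counter is stored as well, so loop lengths have to stay below [B]. *)
- by rewrite /= vs addn1; apply: leq_trans XB; apply: leq_trans NX.
rewrite /= vs addn1 in a3.
have [|m4 [t4 [x4 l4 a4 b4]]] := IHk i.+1 m3 iN' b3 _ a3; first by lia.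
exists m4; eexists; split.
- apply: (@ExecWhileTrue _ _ _ _ _ _ _ _ _ x4); first by have -> := evW i m1 a1; rewrite ek.
  exact: ExecSeq x2 x3.
- have cb := ccost_bound (cexp (HSub e (HV v (HC 0)))) B1 b1.
  apply: leq_trans (leq_add (leq_add cb (leq_add l2 l3)) l4) _.
  by rewrite -/wc1 -/ws mulSn !mulnDl; lia.
- exact: a4.
- exact: b4.
Qed.

(** Counted loops always terminate, so [sem] is a total function and the only obligations besides
    the postcondition are the size bounds in [safe]. *)
Definition wp (c : hcmd) (Q : arrays -> Prop) (m : arrays) : Prop :=
  safe B X c m /\ Q (sem c m).

Lemma wp_set a i e Q m :
  heval m e <= B -> Q (upd m a (heval m i) (heval m e)) -> wp (HSet a i e) Q m.
Proof. by []. Qed.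

Lemma wp_seq c1 c2 Q m : wp c1 (wp c2 Q) m -> wp (HSeq c1 c2) Q m.
Proof. by move=> [s1 [s2 q]]. Qed.

Lemma wp_if e c1 c2 Q m : (heval m e != 0 -> wp c1 Q m) ->
  (heval m e = 0 -> wp c2 Q m) -> wp (HIf e c1 c2) Q m.
Proof.
move=> h1 h2; rewrite /wp /=; case: ifPn => e0; last exact: h1.
by apply: h2; apply/eqP.
Qed.

(** The frame [same (v :: writes c) m m'] comes for free, so [Inv] need only speak of what the loop
    writes. *)
Lemma wp_for v e c m N (Inv : nat -> arrays -> Prop) (Q : arrays -> Prop) :
  v \notin writes c -> heval m e = N -> N <= X -> Inv 0 (upd m v 0 0) ->
  (forall i m', i < N -> same (v :: writes c) m m' -> m' v 0 = i -> Inv i m' ->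
     wp c (fun m'' => Inv i.+1 (upd m'' v 0 i.+1)) m') ->
  (forall m', same (v :: writes c) m m' -> Inv N m' -> Q m') ->
  wp (HFor v e c) Q m.
Proof.
move=> vc eN NX I0 IS IQ; rewrite /wp /= eN.
pose st i := iteri i (fun i m' => upd (sem c m') v 0 i.+1) (upd m v 0 0).
have sameI i : same (v :: writes c) m (st i).
  elim: i => [|i IHi]; first by apply: same_upd; rewrite inE eqxx.
  apply: same_trans IHi _ => /=; apply: (same_trans (m2 := sem c (st i))).
    by apply: same_sub (@sem_same c _) => x; rewrite inE orbC => ->.
  by apply: same_upd; rewrite inE eqxx.
have stv i : st i v 0 = i by case: i => [|i]; rewrite /st /= /upd !eqxx.
have key i : i <= N -> Inv i (st i).
  elim: i => [|i IHi] iN //=.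
  by have [_] := IS i (st i) iN (sameI i) (stv i) (IHi (ltnW iN)).
split; last by apply: IQ; [apply: sameI|apply: key].
split=> // i iN.
by have [] := IS i (st i) iN (sameI i) (stv i) (key i (ltnW iN)).
Qed.

End Correctness.

(** * Conversion between words and arrays *)

Notation oarr := 26 (only parsing).

(* Moves the input from the cells 1, 2, ... to array 0; cell 0, which holds the
   input length, serves as the loop counter and ends up null. *)
Definition load : cmd :=
  While (Read (Const 0))
    (Seq (Write (Mul (Const width) (Read (Const 0))) (Read (Read (Const 0))))
         (Write (Const 0) (Defs.Sub (Read (Const 0)) (Const 1)))).

(* The output is held in array [oarr] from entry 1 on, each number increased by
   one, and ended by an entry 0. *)
Definition emit : cmd :=
  While (Read (Add (Mul (Const width) (Add (Read (Const 0)) (Const 1))) (Const oarr)))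
    (Seq (Write (Const 0) (Add (Read (Const 0)) (Const 1)))
         (Write (Read (Const 0))
            (Defs.Sub (Read (Add (Mul (Const width) (Read (Const 0))) (Const oarr)))
                 (Const 1)))).

Definition load_weight :=
  cweight (Read (Const 0)) +
  (wweight (Mul (Const width) (Read (Const 0))) (Read (Read (Const 0))) +
   wweight (Const 0) (Defs.Sub (Read (Const 0)) (Const 1))).

Definition emit_weight :=
  cweight (Read (Add (Mul (Const width) (Add (Read (Const 0)) (Const 1))) (Const oarr))) +
  (wweight (Const 0) (Add (Read (Const 0)) (Const 1)) +
   wweight (Read (Const 0)) (Defs.Sub (Read (Add (Mul (Const width) (Read (Const 0))) (Const oarr))) (Const 1))).

(** Entries are moved from the last to the first: cell [width * k] lies above cell [k], so the write
    destroys no entry still to be moved. *)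
Lemma exec_load B w : 1 < B -> bounded B (input w) ->
  exists m t, [/\ exec load (input w) m t,
    t <= ((size w).+1 * load_weight) * bitlen B, bounded B m,
    m 0 = 0 & forall i, i < size w -> m (width * i.+1) = nth 0 w i].
Proof.
move=> B1.
pose inv k (m : memory) := [/\ m 0 = k, forall i, 0 < i <= k -> m i = nth 0 w i.-1
  & forall i, k < i <= size w -> m (width * i) = nth 0 w i.-1].
have : inv (size w) (input w).
  by split=> // i h; [case: i h|lia].
have : size w <= size w by [].
move: (input w); move: {1 3 4}(size w) => k.
elim: k => [|k IH] m kw [m0 m1 m2] bm.
  exists m; eexists; split; first exact: ExecWhileFalse.
  - rewrite mul1n; apply: leq_trans (ccost_bound (Read (Const 0)) B1 bm) _.
    by rewrite leq_mul2r leq_addr orbT.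
  - exact: bm.
  - exact: m0.
  - by move=> i iw; rewrite m2.
pose ad := Mul (Const width) (Read (Const 0)).
pose ma := store m (eval m ad) (eval m (Read (Read (Const 0)))).
pose mb := store ma 0 (eval ma (Defs.Sub (Read (Const 0)) (Const 1))).
have ma0 : ma 0 = k.+1 by rewrite /ma /store /= m0; case: eqP => //; lia.
have ba : bounded B ma by apply: bounded_store => //=.
have bb : bounded B mb.
  by apply: bounded_store => //=; apply: leq_trans (leq_subr _ _) (ba 0).
have ib : inv k mb.
  split; first by rewrite /mb /store /= ma0 subn1.
  - move=> i h; rewrite /mb /ma /store /= m0.
    do 2 (case: eqP => ?; first lia); apply: m1; lia.
  - move=> i h; rewrite /mb /ma /store /= m0.
    case: eqP => ?; first lia.
    case: eqP => [e|ne]; first by have -> : i = k.+1 by [lia]; rewrite m1 //; lia.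
    by apply: m2; lia.
have [m' [t [x l b' m0' mi]]] := IH mb (ltnW kw) ib bb.
exists m'; eexists; split.
- apply: (@ExecWhileTrue _ _ _ _ _ _ _ _ _ x); first by rewrite /= m0.
  by apply: ExecSeq; apply: ExecWrite.
- have cb := ccost_bound (Read (Const 0)) B1 bm.
  have w1 := wcost_bound ad (Read (Read (Const 0))) B1 bm.
  have w2 := wcost_bound (Const 0) (Defs.Sub (Read (Const 0)) (Const 1)) B1 ba.
  apply: leq_trans (leq_add (leq_add cb (leq_add w1 w2)) l) _.
  by rewrite -!mulnDl mulSn.
- exact: b'.
- exact: m0'.
- exact: mi.
Qed.

(** Entries are moved in increasing order: cell [j + 1] lies below the source of every entry still
    to be moved. The counter in cell 0 ends up as the length that [output] reads. *)
Lemma exec_emit B m o : 1 < B -> bounded B m -> m 0 = 0 -> size o <= B ->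
  (forall i, i < size o -> m (width * i.+1 + oarr) = (nth 0 o i).+1) ->
  m (width * (size o).+1 + oarr) = 0 ->
  exists m' t, [/\ exec emit m m' t,
    t <= ((size o).+1 * emit_weight) * bitlen B, output m' = o & bounded B m'].
Proof.
move=> B1 bm m0 oB mo mz.
pose inv k (m : memory) := [/\ m 0 = k, forall i, i < k -> m i.+1 = nth 0 o i,
   forall i, k <= i < size o -> m (width * i.+1 + oarr) = (nth 0 o i).+1
  & m (width * (size o).+1 + oarr) = 0].
have i0 : inv 0 m by split=> // i; case/andP=> _; apply: mo.
suff key : forall k m, bounded B m -> forall j, j + k = size o -> inv j m ->
    exists m' t, [/\ exec emit m m' t,
      t <= (k.+1 * emit_weight) * bitlen B, output m' = o & bounded B m'].
  exact: (key (size o) m bm 0 erefl i0).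
move=> {bm m0 mo mz i0 m} k.
elim: k => [|k IH] m bm j ej [m0 m1 m2 m3].
  rewrite addn0 in ej; rewrite ej in m0 m1.
  exists m; eexists; split.
  - by apply: ExecWhileFalse; rewrite /= m0 addn1.
  - rewrite mul1n; apply: leq_trans (ccost_bound _ B1 bm) _.
    by rewrite leq_mul2r leq_addr orbT.
  - apply: (@eq_from_nth _ 0); rewrite /output size_mkseq m0 // => i io.
    by rewrite nth_mkseq // m1.
  - exact: bm.
pose ma := store m 0 (eval m (Add (Read (Const 0)) (Const 1))).
pose mb := store ma (eval ma (Read (Const 0)))
  (eval ma (Defs.Sub (Read (Add (Mul (Const width) (Read (Const 0))) (Const oarr))) (Const 1))).
have ma0 : ma 0 = j.+1 by rewrite /ma /store /= m0 addn1.
have jo : j < size o by lia.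
have ba : bounded B ma by apply: bounded_store => //=; rewrite m0; lia.
have bb : bounded B mb.
  by apply: bounded_store => //=; apply: leq_trans (leq_subr _ _) (ba _).
have mo : ma (width * j.+1 + oarr) = (nth 0 o j).+1.
  by rewrite /ma /store; case: eqP => ?; [lia|apply: m2; lia].
have ib : inv j.+1 mb.
  split.
  - by rewrite /mb /store /= ma0.
  - move=> i h; rewrite /mb /store [eval ma (Read _)]/= ma0 eqSS.
    case: eqP => [->|ne]; first by rewrite /= ma0 mo subn1.
    rewrite /ma /store /=; apply: m1; lia.
  - move=> i h; rewrite /mb /ma /store /= m0.
    by do ?(case: eqP => ?; first lia); apply: m2; lia.
  - rewrite /mb /ma /store /= m0.
    by do ?(case: eqP => ?; first lia).
have [|m' [t [x l ho bm']]] := IH mb bb j.+1 _ ib; first by lia.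
exists m'; eexists; split.
- apply: (@ExecWhileTrue _ _ _ _ _ _ _ _ _ x); first by rewrite /= m0 addn1 m2 //; lia.
  by apply: ExecSeq; apply: ExecWrite.
- pose e := Read (Add (Mul (Const width) (Add (Read (Const 0)) (Const 1))) (Const oarr)).
  pose v := Defs.Sub (Read (Add (Mul (Const width) (Read (Const 0))) (Const oarr))) (Const 1).
  have cb := ccost_bound e B1 bm.
  have w1 := wcost_bound (Const 0) (Add (Read (Const 0)) (Const 1)) B1 bm.
  have w2 := wcost_bound (Read (Const 0)) v B1 ba.
  apply: leq_trans (leq_add (leq_add cb (leq_add w1 w2)) l) _.
  by rewrite -!mulnDl mulSn.
- exact: ho.
- exact: bm'.
Qed.

Definition run_weight (X : nat) (c : hcmd) :=
  X.+1 * load_weight + (hweight X c + X.+1 * emit_weight) + X.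

Lemma wsize_le B (o : word) : (forall x, x \in o -> x <= B) ->
  wsize o <= size o * bitlen B.
Proof.
rewrite /wsize; elim: o => [|x o IH] h; first by rewrite big_nil.
rewrite big_cons /= mulSn leq_add ?leq_bitlen ?h ?inE ?eqxx // IH // => y yo.
by rewrite h // inE yo orbT.
Qed.

(** After [load] the other arrays may contain leftovers of the input, hence the last hypothesis
    assumes nothing about them and the program has to initialize what it reads. Array 0 must not be
    written because its entry 0 is cell 0, the counter of [emit]. *)
Lemma exec_program c B X w (Q : word -> Prop) :
  wf c -> 0 \notin writes c -> 1 < B -> X <= B -> size w <= X ->
  (forall x, x \in w -> x <= B) ->
  (forall m, (forall i, i < size w -> m 0 i.+1 = nth 0 w i) ->
     wp B X c (fun m' => exists o, [/\ size o <= X,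
       forall i, i < size o -> m' oarr i.+1 = (nth 0 o i).+1,
       m' oarr (size o).+1 = 0 & Q o]) m) ->
  exists m t, [/\ exec (Seq load (Seq (compile c) emit)) (input w) m t,
    t + wsize (output m) <= run_weight X c * bitlen B & Q (output m)].
Proof.
move=> wc c0 B1 XB wX wB hc.
have bi : bounded B (input w).
  move=> [|i] /=; first exact: leq_trans wX XB.
  case: (ltnP i (size w)) => iw; first by apply: wB; apply: mem_nth.
  by rewrite /input /= nth_default.
have [m1 [t1 [x1 l1 b1 z1 n1]]] := exec_load B1 bi.
pose h1 : arrays := fun a i => m1 (width * i + a).
have [|sf [o [oX mo me qo]]] := hc h1.
  by move=> i iw; rewrite /h1 addn0 n1.
have [m2 [t2 [x2 l2 a2 b2]]] := @exec_compile B X B1 XB c m1 h1 wc (fun _ _ _ => erefl) b1 sf.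
have z2 : m2 0 = 0.
  by have := a2 0 0 isT; rewrite (sem_same h1 c0) /h1 muln0 addn0 => ->.
have [||m3 [t3 [x3 l3 eo b3]]] := @exec_emit B m2 o B1 b2 z2 (leq_trans oX XB).
- by move=> i io; rewrite a2 ?mo.
- by rewrite a2.
exists m3; eexists; split; first by apply: ExecSeq x1 (ExecSeq x2 x3).
  rewrite eo /run_weight !mulnDl !leq_add //.
  - by apply: leq_trans l1 _; rewrite !leq_mul2r ltnS wX !orbT.
  - by apply: leq_trans l3 _; rewrite !leq_mul2r ltnS oX !orbT.
  - apply: leq_trans (@wsize_le B o _) _; last by rewrite leq_mul2r oX orbT.
    by move=> x; rewrite -eo => /mapP[i _ ->]; apply: b3.
by rewrite eo.
Qed.

Lemma polybounded_run_weight c : polybounded (fun X => run_weight X c).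
Proof.
rewrite /run_weight; have hS : polybounded succn.
  by apply: polybounded_le (polybounded_add polybounded_id (polybounded_const 1)) => y /=; rewrite addn1.
do ?[exact: polybounded_const | exact: polybounded_id | apply: polybounded_add
      | apply: polybounded_mul | exact: polybounded_hweight | exact: hS].
Qed.

(** * The dynamic program *)

Definition digit (b x i : nat) : nat := x %/ b ^ i %% b.

Definition undigits (b k : nat) (g : nat -> nat) : nat := \sum_(i < k) g i * b ^ i.

Lemma undigits_lt b k g : (forall i, i < k -> g i < b) -> undigits b k g < b ^ k.
Proof.
rewrite /undigits; elim: k => [|k IH] h; first by rewrite big_ord0 expn0.
rewrite big_ord_recr /= expnS.
have {}IH : \sum_(i < k) g i * b ^ i < b ^ k by apply: IH => i ik; apply: h; lia.
have gk : g k < b by apply: h.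
by move: IH; set e := b ^ k; set a := \sum_(i < k) _; nia.
Qed.

Lemma digit_undigits b k g i : (forall i, i < k -> g i < b) -> i < k ->
  digit b (undigits b k g) i = g i.
Proof.
elim: k => // k IH h; rewrite ltnS leq_eqVlt => ik.
have b0 : 0 < b by apply: leq_ltn_trans (h k (leqnn _)).
have h' i' : i' < k -> g i' < b by move=> hi; apply: h; lia.
have lt := undigits_lt h'.
rewrite /undigits big_ord_recr /= -/(undigits b k g) /digit addnC.
case/orP: ik => [/eqP->|ik].
  by rewrite divnMDl ?expn_gt0 ?b0 // divn_small // addn0 modn_small // h.
have -> : g k * b ^ k = (g k * b ^ (k - i).-1 * b) * b ^ i.
  by rewrite -!mulnA -expnS -expnD; congr (_ * b ^ _); lia.
by rewrite divnMDl ?expn_gt0 ?b0 // modnMDl; apply: IH.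
Qed.

Lemma digit_lt b x i : 0 < b -> digit b x i < b.
Proof. by move=> b0; rewrite ltn_mod. Qed.

Lemma digit0 b i : digit b 0 i = 0.
Proof. by rewrite /digit div0n mod0n. Qed.

(** * States, costs and transitions *)

Section Model.
Variables (n s : nat) (rel res U : nat -> nat) (P K0 : nat) (K : nat -> nat).
Implicit Types (l d j i t x : nat) (g : nat -> nat).

(* In a state [g], the last layer at which resource [i] was replenished is
   [g i], and the machine becomes idle at time [U (g s) + g s.+1 * P]. *)
Definition avail g := U (g s) + g s.+1 * P.

Definition base l g := maxn (avail g) (U l).

(* Jobs started after the layer [l] with decision [d]; every pending job is
   served at the last layer, so all decision sequences are feasible. *)
Definition served l d g j :=
  [&& rel j <= U l, U (g (res j)) < rel j & (digit 2 d (res j) != 0) || (l == n)].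

(** For a served job [j], its rank in index order among the jobs of the layer; the job starts at
    [base l g + cnt l d g j * P]. *)
Definition cnt l d g j := \sum_(i < j) (served l d g i : nat).

Definition marked l d g j i := has (fun j' => served l d g j' && (res j' == i)) (iota 0 j).

Definition jobcost l d g j :=
  \sum_(i < j | served l d g i) (base l g + (cnt l d g i).+1 * P).

(** A decision may ask for useless replenishments at no cost: only resources of served jobs are paid
    for, and [K0] only if there is such a job. *)
Definition setcost l d g :=
  (0 < cnt l d g n) * K0 + \sum_(i < s | marked l d g n i) K i.

Definition lcost l d g := jobcost l d g n + setcost l d g.

(** The cap [minn n] keeps digits below [n.+1] in all states, reachable or not, so that codes stay
    in range; [availS] shows that it does not distort the idle time along a path from 0. *)
Definition step l d g i :=
  if i < s then if marked l d g n i then l else g i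
  else if i == s then if avail g < U l then l else g s
  else minn n ((if avail g < U l then 0 else g s.+1) + cnt l d g n).

Definition transit l d x := undigits n.+1 s.+2 (step l d (digit n.+1 x)).

Lemma servedE l d g j : served l d g j =
  [&& rel j <= U l, U (g (res j)) < rel j & (digit 2 d (res j) != 0) || (l == n)].
Proof. by []. Qed.

Lemma cnt0 l d g : cnt l d g 0 = 0.
Proof. by rewrite /cnt big_ord0. Qed.

Lemma jobcost0 l d g : jobcost l d g 0 = 0.
Proof. by rewrite /jobcost big_ord0. Qed.

Lemma cntS l d g j : cnt l d g j.+1 = cnt l d g j + served l d g j.
Proof. by rewrite /cnt big_ord_recr. Qed.

Lemma jobcostS l d g j : jobcost l d g j.+1 =
  jobcost l d g j + served l d g j * (base l g + (cnt l d g j).+1 * P).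
Proof.
rewrite /jobcost !(big_mkcond (fun i : 'I__ => served l d g i)) big_ord_recr /=.
by case: served; rewrite ?mul1n.
Qed.

Lemma markedS l d g j i : marked l d g j.+1 i =
  marked l d g j i || served l d g j && (res j == i).
Proof. by rewrite /marked -addn1 iotaD has_cat /= orbF. Qed.

Lemma markedP l d g i : reflect (exists j, [/\ j < n, served l d g j & res j = i])
  (marked l d g n i).
Proof.
apply: (iffP hasP) => [[j]|[j [jn sj rj]]].
  by rewrite mem_iota add0n => /andP[_ jn] /andP[sj /eqP rj]; exists j.
by exists j; rewrite ?mem_iota ?sj ?rj /=.
Qed.

Lemma cnt_le l d g j : cnt l d g j <= j.
Proof.
elim: j => [|j IH]; first by rewrite cnt0.
by rewrite cntS; case: served; lia.
Qed.

Lemma leq_cnt l d g j j' : j <= j' -> cnt l d g j <= cnt l d g j'.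
Proof.
by move=> /subnK <-; elim: (j' - j) => // k IH; rewrite addSn cntS; lia.
Qed.

(** Since processing times are equal, it does not matter which jobs are served, only how many. *)
Lemma jobcostE l d g j : jobcost l d g j = \sum_(k < cnt l d g j) (base l g + k.+1 * P).
Proof.
elim: j => [|j IH]; first by rewrite jobcost0 cnt0 big_ord0.
rewrite jobcostS cntS; case: served; last by rewrite mul0n !addn0.
by rewrite addn1 big_ord_recr /= IH mul1n.
Qed.

Lemma lcost_le Um l d g : (forall l, l <= n -> U l <= Um) -> l <= n -> g s <= n ->
  g s.+1 <= n -> lcost l d g <= n * (Um + (n + n) * P) + K0 + \sum_(i < s) K i.
Proof.
move=> hU ln gs gs1; rewrite /lcost /setcost -addnA; apply: leq_add; last first.
  apply: leq_add; first by case: (0 < _); rewrite ?mul1n.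
  by rewrite big_mkcond; apply: leq_sum => i _; case: ifP.
rewrite jobcostE.
apply: (@leq_trans (\sum_(k < cnt l d g n) (Um + (n + n) * P))); last first.
  by rewrite big_const_ord iter_addn_0 mulnC leq_mul2r cnt_le orbT.
apply: leq_sum => k _.
have kn : k.+1 <= n by apply: leq_trans (cnt_le l d g n).
rewrite mulnDl addnA leq_add ?leq_mul2r ?kn ?orbT //.
rewrite geq_max /avail leq_add ?leq_mul2r ?gs1 ?orbT ?hU //=.
by rewrite (leq_trans (hU _ ln)) ?leq_addr.
Qed.

Lemma step_le l d g i : l <= n -> (forall i, i < s.+2 -> g i <= n) -> i < s.+2 ->
  step l d g i < n.+1.
Proof.
move=> ln gn i2; rewrite ltnS /step; case: ifP => i1; first by case: ifP => // _; apply: gn.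
case: ifP => i3; first by case: ifP => // _; apply: gn.
by rewrite geq_minl.
Qed.

Lemma digit_transit l d x i : l <= n -> i < s.+2 ->
  digit n.+1 (transit l d x) i = step l d (digit n.+1 x) i.
Proof.
move=> ln i2; rewrite digit_undigits // => i' i2'; apply: step_le => // k _.
by rewrite -ltnS digit_lt.
Qed.

Lemma transit_lt l d x : l <= n -> transit l d x < n.+1 ^ s.+2.
Proof.
move=> ln; apply: undigits_lt => i i2; apply: step_le => // k _.
by rewrite -ltnS digit_lt.
Qed.

(** * Trajectories of decision sequences and their schedules *)

Section Path.
Variable ds : nat -> nat.

Fixpoint path_state t :=
  if t is t'.+1 then transit t'.+1 (ds t'.+1) (path_state t') else 0.

Notation st t := (digit n.+1 (path_state t)).

(** The set of pending jobs is not stored: a job counts as done once the last replenishment of its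
    resource is not before its release date. *)
Definition done_by t j := rel j <= U (st t (res j)).

Lemma done_byE t j : done_by t j = (rel j <= U (st t (res j))).
Proof. by []. Qed.

Definition ndone t := \sum_(j < n) (done_by t j : nat).

Hypotheses (U0 : U 0 = 0) (Ulast : forall l, l < n -> U l < U l.+1).
Hypotheses (rel_gt0 : forall j, j < n -> 0 < rel j)
  (rel_U : forall j, j < n -> exists2 l, l <= n & rel j = U l)
  (res_lt : forall j, j < n -> res j < s).

Lemma U_lt a b : a < b -> b <= n -> U a < U b.
Proof.
move=> ab; elim: b ab => // b IH; rewrite ltnS leq_eqVlt => /orP[/eqP->|ab] bn.
  exact: Ulast.
by apply: ltn_trans (IH ab (ltnW bn)) (Ulast bn).
Qed.

Lemma U_le a b : a <= b -> b <= n -> U a <= U b.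
Proof. by rewrite leq_eqVlt => /orP[/eqP->|ab] // bn; apply/ltnW/U_lt. Qed.

Lemma path_state_lt t : t <= n -> path_state t < n.+1 ^ s.+2.
Proof. by case: t => [|t] tn /=; [rewrite expn_gt0|apply: transit_lt]. Qed.

Lemma stS t i : t < n -> i < s.+2 -> st t.+1 i = step t.+1 (ds t.+1) (st t) i.
Proof. by move=> tn i2; rewrite /= digit_transit. Qed.

Lemma st_le t i : t <= n -> i <= s -> st t i <= t.
Proof.
elim: t => [|t IH] tn i1; first by rewrite digit0.
have := IH (ltnW tn) i1 => h.
rewrite stS // /step; last exact: leqW.
case: ifP => i2; first by case: ifP => // _; apply: leqW.
have ei : i = s by lia.
by rewrite ei eqxx in h *; case: ifP => // _; apply: leqW.
Qed.

Lemma served_done t j : t < n -> served t.+1 (ds t.+1) (st t) j -> ~~ done_by t j.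
Proof. by move=> tn /and3P[_ h _]; rewrite /done_by -ltnNge. Qed.

(** If the resource of [j] is marked because of another job [j'], the decision condition holds for
    this resource, so [j] is served too if it is released and pending. An unmarked resource serves
    nobody. *)
Lemma doneS t j : t < n -> j < n ->
  done_by t.+1 j = done_by t j || served t.+1 (ds t.+1) (st t) j.
Proof.
move=> tn jn; have rj := res_lt jn; rewrite /done_by stS //; last by lia.
have lt : U (st t (res j)) < U t.+1.
  by apply: U_lt => //; rewrite ltnS; apply: st_le; lia.
rewrite /step rj; case: ifPn => [/markedP[j' [jn' sj' ej]]|nm].
  have /and3P[_ _ b] := sj'; rewrite ej in b.
  rewrite /served b andbT.
  by case: (leqP (rel j) (U t.+1)); case: leqP => //=; lia.
case: (boolP (served _ _ _ _)) => sj; last by rewrite orbF.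
by case/negP: nm; apply/markedP; exists j.
Qed.

(** Service is forced at layer [n], which by [rel_U] is not before any release date. *)
Lemma done_n j : j < n -> done_by n j.
Proof.
move=> jn; have e : n.-1.+1 = n by lia.
have [l ln el] := rel_U jn.
have := @doneS n.-1 j; rewrite e => -> //.
rewrite /done_by /served eqxx orbT andbT el (U_le ln (leqnn n)) /=.
by case: leqP.
Qed.

Lemma done0 j : j < n -> done_by 0 j = false.
Proof.
by move=> jn; rewrite /done_by digit0 U0 leqn0; apply/negbTE; rewrite -lt0n rel_gt0.
Qed.

Lemma ndone0 : ndone 0 = 0.
Proof. by rewrite /ndone big1 // => j _; rewrite done0. Qed.

Lemma ndone_n : ndone n = n.
Proof.
rewrite /ndone (eq_bigr (fun=> 1)) ?sum1_card ?card_ord // => j _.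
by rewrite done_n.
Qed.

Lemma ndoneS t : t < n ->
  ndone t.+1 = ndone t + cnt t.+1 (ds t.+1) (st t) n.
Proof.
move=> tn; rewrite /ndone /cnt -big_split; apply: eq_bigr => j _ /=.
rewrite doneS //; case: (boolP (served _ _ _ _)) => sj; last by rewrite orbF addn0.
by rewrite (negbTE (served_done tn sj)).
Qed.

Lemma ndone_le t : ndone t <= n.
Proof.
rewrite /ndone -[X in _ <= X](card_ord n) -sum1_card.
by apply: leq_sum => j _; case: done_by.
Qed.

(** The jobs counted by the last digit are among those already done. In [availS] this keeps the
    count within the cap of [step]. *)
Lemma stk_le t : t <= n -> st t s.+1 <= ndone t.
Proof.
elim: t => [|t IH] tn; first by rewrite digit0.
rewrite stS // ndoneS // /step ltnNge leqnSn /=.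
have -> : (s.+1 == s) = false by lia.
apply: leq_trans (geq_minr _ _) _; rewrite leq_add2r.
by case: ifP => // _; apply: IH; apply: ltnW.
Qed.

Lemma avail0 : avail (st 0) = 0.
Proof. by rewrite /avail !digit0 U0. Qed.

Lemma availS t : t < n ->
  avail (st t.+1) = base t.+1 (st t) + cnt t.+1 (ds t.+1) (st t) n * P.
Proof.
move=> tn; rewrite {1}/avail !stS // /step ltnn eqxx.
have -> : (s.+1 < s) = false by lia.
have -> : (s.+1 == s) = false by lia.
have h : st t s.+1 + cnt t.+1 (ds t.+1) (st t) n <= n.
  apply: leq_trans (ndone_le t.+1); rewrite ndoneS // leq_add2r stk_le //.
  exact: ltnW.
rewrite (minn_idPr _); last by case: ifP => _ //; rewrite add0n cnt_le.
rewrite /base /maxn; case: ifP => lt; first by rewrite add0n.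
by rewrite mulnDl addnA.
Qed.

(** Invariant of the forward simulation, constraining [S] only on jobs already done; times are
    scaled and shifted. The last clause provides the replenishment between release and start that
    feasibility asks for. *)
Definition sched t (S : nat -> nat) :=
  [/\ forall j, j < n -> done_by t j -> S j + P <= avail (st t),
      forall j k, j < n -> k < n -> j != k -> done_by t j -> done_by t k ->
        S j + P <= S k \/ S k + P <= S j,
      \sum_(j < n | done_by t j) (S j + P) =
        \sum_(t' < t) jobcost t'.+1 (ds t'.+1) (st t') n
    & forall j, j < n -> done_by t j -> exists t', [/\ t' < t,
        marked t'.+1 (ds t'.+1) (st t') n (res j), rel j <= U t'.+1
        & U t'.+1 <= S j]].

Lemma sched0 S : sched 0 S.
Proof.
split; first by move=> j jn; rewrite done0.
- by move=> j k jn _ _; rewrite done0.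
- by rewrite big_ord0 big1 // => j; rewrite done0.
- by move=> j jn; rewrite done0.
Qed.

(** New jobs start at [base] or later, hence after all old ones, and different ranks place them at
    least [P] apart. *)
Lemma schedS t S S' : t < n -> sched t S ->
  (forall j, j < n -> S' j = if served t.+1 (ds t.+1) (st t) j
     then base t.+1 (st t) + cnt t.+1 (ds t.+1) (st t) j * P else S j) ->
  sched t.+1 S'.
Proof.
move=> tn [h1 h2 h3 h4] hS.
set sv := served t.+1 (ds t.+1) (st t) in hS *.
set c := cnt t.+1 (ds t.+1) (st t) in hS *.
have old j : j < n -> done_by t j -> S' j = S j.
  move=> jn dj; rewrite hS //; case: ifPn => // sj.
  by have := served_done tn sj; rewrite dj.
have new j : sv j -> j < n -> S' j = base t.+1 (st t) + c j * P.
  by move=> sj jn; rewrite hS // sj.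
have cS j k : j < k -> sv j -> c j < c k.
  by move=> jk sj; apply: leq_trans (leq_cnt _ _ _ jk); rewrite cntS -/sv sj addn1.
have lo j : j < n -> done_by t j -> S' j + P <= base t.+1 (st t).
  by move=> jn dj; rewrite old // (leq_trans (h1 j jn dj)) // leq_maxl.
split.
- move=> j jn; rewrite doneS // availS // => /orP[dj|sj].
    by rewrite (leq_trans (lo j jn dj)) // leq_addr.
  by rewrite new // -addnA leq_add2l addnC -mulSn leq_mul2r cS ?orbT.
- move=> j k jn kn jk; rewrite !doneS // => /orP[dj|sj] /orP[dk|sk].
  + by rewrite !old //; apply: h2.
  + left; apply: leq_trans (lo j jn dj) _; by rewrite new // leq_addr.
  + right; apply: leq_trans (lo k kn dk) _; by rewrite new // leq_addr.
  + rewrite !new // -!addnA !leq_add2l !(addnC _ P) -!mulSn !leq_mul2r.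
    case: (ltngtP j k) jk => // jk _; [left|right]; by rewrite cS ?orbT.
- rewrite big_ord_recr /= -h3.
  rewrite (eq_bigl (fun j : 'I_n => done_by t j || sv j)); last by move=> j; rewrite doneS.
  rewrite (bigID (fun j : 'I_n => done_by t j)) /=; congr (_ + _).
    rewrite (eq_bigl (fun j : 'I_n => done_by t j)); last by move=> j; case: done_by; rewrite ?andbF.
    by apply: eq_bigr => j dj; rewrite old.
  rewrite /jobcost; apply: congr_big => // [j|j /andP[/orP[->//|sj] _]].
    rewrite -[served _ _ _ _]/(sv j); case: (boolP (sv j)) => sj; last by rewrite orbF; case: done_by.
    by rewrite orbT (served_done tn sj).
  by rewrite new // -addnA mulSn (addnC P) //.
- move=> j jn; rewrite doneS // => /orP[dj|sj].
    have [t' [a1 a2 a3 a4]] := h4 j jn dj; exists t'; rewrite old //.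
    by split=> //; apply: leqW.
  exists t; split=> //; first by apply/markedP; exists j.
    by case/and3P: sj.
  by rewrite new // (leq_trans _ (leq_addr _ _)) // leq_maxr.
Qed.

(** * Completion times of an arbitrary schedule, bounded below *)

Section LowerBound.
Import Order.TTheory GRing.Theory Num.Theory.
Local Open Scope ring_scope.
Variables (F : realFieldType) (sig : 'I_n -> F).
Hypotheses (P_gt0 : (0 < P)%N)
  (sig_disjoint : forall j k : 'I_n, j != k ->
     sig j + P%:R <= sig k \/ sig k + P%:R <= sig j)
  (sig_early : forall t (j : 'I_n), (t < n)%N -> sig j < (U t.+1)%:R -> done_by t j).

(* Sorting the starting times, the job in position [ndone t + k] starts at or
   after [base t.+1 + k * P]. *)
Lemma jobcost_lower :
  (\sum_(t < n) jobcost t.+1 (ds t.+1) (st t) n)%N%:R <= \sum_j (sig j + P%:R).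
Proof.
case: (posnP n) => [n0|n0].
  rewrite [X in X%:R <= _]big1 ?mulr0n; last by case=> t tn; exfalso; lia.
  by rewrite big1 //; case=> j jn; exfalso; lia.
have PF : 0 < P%:R :> F by rewrite ltr0n.
pose j0 := Ordinal n0.
pose js := sort (relpre sig <=%R) (enum 'I_n).
have sz : size js = n by rewrite size_sort size_enum_ord.
have pe : perm_eq js (enum 'I_n) by rewrite perm_sort.
have uj : uniq js by rewrite (perm_uniq pe) enum_uniq.
have srt : sorted (relpre sig <=%R) js by apply: sort_sorted => x y; apply: le_total.
pose f m := sig (nth j0 js m).
have fle a b : (a <= b)%N -> (b < n)%N -> f a <= f b.
  move=> ab bn; apply: (sorted_leq_nth _ _ j0 srt) => //; rewrite ?inE ?sz //.
  - by move=> x y z; apply: le_trans.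
  - by move=> x /=.
  - exact: leq_ltn_trans ab bn.
have fgap m : (m.+1 < n)%N -> f m + P%:R <= f m.+1.
  move=> mn; have ne : nth j0 js m != nth j0 js m.+1.
    by rewrite nth_uniq ?sz //; [rewrite neq_ltn ltnSn|apply: ltnW].
  case: (sig_disjoint ne) => // h; have := fle _ _ (leqnSn m) mn.
  by move=> h2; have := le_trans h h2; rewrite gerDl leNgt PF.
(* Otherwise the first [ndone t + 1] jobs in starting order would all start before layer [t.+1] and
   so be done by [t]: one too many. *)
have fU t : (t < n)%N -> (ndone t < n)%N -> (U t.+1)%:R <= f (ndone t).
  move=> tn cn; rewrite leNgt; apply/negP => lt.
  have : (ndone t < ndone t)%N; last by rewrite ltnn.
  rewrite {2}/ndone -big_mkcond /= sum1_card.
  have ut : uniq (take (ndone t).+1 js) by rewrite take_uniq.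
  have <- : size (take (ndone t).+1 js) = (ndone t).+1 by rewrite size_takel // sz.
  rewrite -(card_uniqP ut); apply: subset_leq_card; apply/subsetP => j.
  case/(nthP j0) => m; rewrite size_takel ?sz // => mc <-.
  rewrite unfold_in; apply: sig_early => //; rewrite nth_take //.
  by apply: le_lt_trans lt; apply: fle.
(* The second claim carries the induction: it bounds the next start by the idle time, [fU] bounds it
   by the layer, and [base] is the larger of the two. *)
have key t : (t <= n)%N ->
    (\sum_(t' < t) jobcost t'.+1 (ds t'.+1) (st t') n)%N%:R
      <= \sum_(m < ndone t) (f m + P%:R)
    /\ ((ndone t < n)%N -> (avail (st t))%:R <= f (ndone t)).
  elim: t => [|t IH] tn.
    rewrite ndone0 !big_ord0; split=> // _; rewrite avail0 mulr0n.
    by have := fU 0%N n0; rewrite ndone0 => /(_ n0); apply: le_trans; rewrite ler0n.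
  have [A1 A2] := IH (ltnW tn).
  set q := cnt t.+1 (ds t.+1) (st t) n.
  have fk k : (ndone t + k < n)%N -> (base t.+1 (st t) + k * P)%N%:R <= f (ndone t + k)%N.
    elim: k => [|k IHk] kn.
      rewrite addn0 in kn; rewrite addn0 mul0n addn0 /base.
      by case: (leqP (avail _) _) => _; [apply: fU|apply: A2].
    rewrite addnS; apply: le_trans (fgap _ _); last by rewrite -addnS.
    rewrite mulSn addnCA addnC natrD lerD2r; apply: IHk; lia.
  rewrite ndoneS // -/q; split; last first.
    by move=> cq; rewrite availS //; apply: fk.
  rewrite big_ord_recr /= natrD big_split_ord /=; apply: lerD => //.
  rewrite jobcostE -/q natr_sum; apply: ler_sum => k _.
  rewrite mulSn addnCA addnC natrD lerD2r; apply: fk.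
  by apply: leq_trans (ndone_le t.+1); rewrite ndoneS // ltn_add2l.
have [h _] := key n (leqnn n); apply: le_trans h _.
have -> : \sum_j (sig j + P%:R) = \sum_(j <- js) (sig j + P%:R).
  by rewrite (perm_big _ pe) big_enum.
by rewrite ndone_n [X in _ <= X](big_nth j0) sz big_mkord.
Qed.

End LowerBound.

End Path.

(** * Bellman equations *)

Section Bellman.
Variables (T G : nat -> nat -> nat).
Notation N := (n.+1 ^ s.+2).
Hypotheses (T_last : forall x, x < N -> T n.+1 x = 0)
  (T_opt : forall t x, t < n -> x < N ->
     T t.+1 x = lcost t.+1 (G t.+1 x) (digit n.+1 x) + T t.+2 (transit t.+1 (G t.+1 x) x))
  (T_le : forall t x d, t < n -> x < N -> d < 2 ^ s ->
     T t.+1 x <= lcost t.+1 d (digit n.+1 x) + T t.+2 (transit t.+1 d x)).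

Definition path_cost ds t :=
  \sum_(t' < t) lcost t'.+1 (ds t'.+1) (digit n.+1 (path_state ds t')).

Fixpoint greedy_state t :=
  if t is t'.+1 then transit t'.+1 (G t'.+1 (greedy_state t')) (greedy_state t') else 0.

(** The choices of the table along its own trajectory, as a plain decision sequence to which the
    results on paths apply. The decision of layer [t] is taken in the state left by layer [t.-1]. *)
Definition greedy t := G t (greedy_state t.-1).

Lemma path_state_greedy t : path_state greedy t = greedy_state t.
Proof. by elim: t => //= t ->. Qed.

Lemma bellman_le ds : (forall t, ds t < 2 ^ s) -> T 1 0 <= path_cost ds n.
Proof.
move=> hd; suff h t : t <= n -> T 1 0 <= path_cost ds t + T t.+1 (path_state ds t).
  by have := h n (leqnn n); rewrite T_last ?addn0 ?path_state_lt.
elim: t => [|t IH] tn; first by rewrite /path_cost big_ord0.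
apply: leq_trans (IH (ltnW tn)) _; rewrite /path_cost big_ord_recr /= -addnA leq_add2l.
by apply: T_le => //; apply: path_state_lt; apply: ltnW.
Qed.

Lemma bellman_greedy : T 1 0 = path_cost greedy n.
Proof.
suff h t : t <= n -> T 1 0 = path_cost greedy t + T t.+1 (path_state greedy t).
  by have := h n (leqnn n); rewrite T_last ?addn0 ?path_state_lt.
elim: t => [|t IH] tn; first by rewrite /path_cost big_ord0.
rewrite (IH (ltnW tn)) /path_cost big_ord_recr /= -addnA; congr (_ + _).
have -> : greedy t.+1 = G t.+1 (path_state greedy t) by rewrite /greedy path_state_greedy.
by rewrite -T_opt //; apply: path_state_lt; apply: ltnW.
Qed.

End Bellman.
End Model.

(** * The program *)

(* [vN]: number of jobs; [vD]: common denominator; [vK0], [vK], [vP], [vR], [vQ]: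
   scaled costs, processing time and release dates, and the resource of each job;
   [vU]: layers; [vB]: number of states; [vT], [vG]: optimal costs and decisions;
   [vg], [vF], [vc], [vq], [vmark], [vbit], [vS]: state, idle time, cost, whether
   a job was served, replenished resources, decision and starting times during
   the simulation of the layer [vl] from the state [vx] to the state [vy] under
   the decision [vd]; [vnq]: number of replenishments output so far. *)
Notation vW := 0 (only parsing).
Notation vN := 1 (only parsing).
Notation vD := 2 (only parsing).
Notation vK0 := 3 (only parsing).
Notation vK := 4 (only parsing).
Notation vP := 5 (only parsing).
Notation vR := 6 (only parsing).
Notation vQ := 7 (only parsing).
Notation vU := 8 (only parsing).
Notation vH := 9 (only parsing).
Notation vB := 10 (only parsing).
Notation vT := 11 (only parsing).
Notation vG := 12 (only parsing).
Notation vg := 13 (only parsing).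
Notation vmark := 14 (only parsing).
Notation vbit := 15 (only parsing).
Notation vF := 16 (only parsing).
Notation vc := 17 (only parsing).
Notation vq := 18 (only parsing).
Notation vS := 19 (only parsing).
Notation vl := 20 (only parsing).
Notation vd := 21 (only parsing).
Notation vx := 22 (only parsing).
Notation vy := 23 (only parsing).
Notation vbest := 24 (only parsing).
Notation vbd := 25 (only parsing).
Notation vnq := 27 (only parsing).
Notation vi := 28 (only parsing).
Notation vj := 29 (only parsing).
Notation vt := 30 (only parsing).
Notation vtmp := 31 (only parsing).
Notation vv := 32 (only parsing).
Notation vpw := 33 (only parsing).

Declare Scope hexp_scope.
Delimit Scope hexp_scope with H.
Bind Scope hexp_scope with hexp.
Coercion HC : nat >-> hexp.
Notation "a + b" := (HAdd a b) : hexp_scope.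
Notation "a - b" := (HSub a b) : hexp_scope.
Notation "a * b" := (HMul a b) : hexp_scope.
Notation "a / b" := (HDiv a b) : hexp_scope.
Notation "$ a" := (HV a (HC 0)) (at level 2, a at level 1, format "$ a") : hexp_scope.
Notation "a @[ e ]" := (HV a e%H) (at level 2, e at level 200) : hexp_scope.
Notation "a <<-[ i ] e" := (HSet a i%H e%H) (at level 70, i at level 200, e at level 69).
Notation "a <<- e" := (HSet a (HC 0) e%H) (at level 70, e at level 69).
Notation "c1 ;; c2" := (HSeq c1 c2) (at level 75, right associativity).

Definition hskip : hcmd := vtmp <<- 0.

Definition decode (b k src : hexp) (dst : nat) : hcmd :=
  vtmp <<- src ;;
  HFor vi k
    (dst <<-[$vi] $vtmp - ($vtmp / b) * b ;;
     vtmp <<- $vtmp / b).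

(** Conditions are numbers: with truncated subtraction, [1 - (a - b)] is nonzero iff [a <= b] and
    [a - b] iff [b < a]; products are conjunctions, sums disjunctions. The final assignment to [vg]
    is an increment that stops at [n], as in [step]. Resources are only marked here, because [vg]
    must keep their old layers while the remaining jobs are tested. *)
Definition serve_jobs (s : nat) : hcmd :=
  HFor vj ($vN)%H
    (HIf ((1 - (vR@[$vj] - vU@[$vl])) * (vR@[$vj] - vU@[vg@[vQ@[$vj]]])
          * (vbit@[vQ@[$vj]] + (1 - ($vN - $vl))))%H
       (vS <<-[$vj] $vF ;;
        vF <<- $vF + $vP ;;
        vc <<- $vc + $vF ;;
        vmark <<-[vQ@[$vj]] 1 ;;
        vq <<- 1 ;;
        vg <<-[s.+1] vg@[s.+1] + (1 - (1 - ($vN - vg@[s.+1]))))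
       hskip).

Definition charge_sets (s : nat) : hcmd :=
  HIf ($vq)%H (vc <<- $vc + $vK0) hskip ;;
  HFor vi s
    (HIf (vmark@[$vi])%H
       (vc <<- $vc + vK@[$vi] ;; vg <<-[$vi] $vl)
       hskip).

Definition encode (s : nat) : hcmd :=
  vy <<- 0 ;;
  vpw <<- 1 ;;
  HFor vi s.+2
    (vy <<- $vy + vg@[$vi] * $vpw ;;
     vpw <<- $vpw * ($vN + 1)).

Definition start_layer (s : nat) : hcmd :=
  vF <<- vU@[vg@[s]] + vg@[s.+1] * $vP ;;
  HIf (vU@[$vl] - $vF)%H
    (vg <<-[s] $vl ;; vg <<-[s.+1] 0 ;; vF <<- vU@[$vl])
    hskip ;;
  vc <<- 0 ;;
  vq <<- 0 ;;
  HFor vi s (vmark <<-[$vi] 0).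

(** One routine for both passes: the backward pass reads the cost and the next state, the forward
    pass the next state, the starting times and the marks. *)
Definition run_layer (s : nat) : hcmd :=
  decode 2 s ($vd)%H vbit ;;
  decode ($vN + 1)%H s.+2 ($vx)%H vg ;;
  start_layer s ;;
  serve_jobs s ;;
  charge_sets s ;;
  encode s.

Lemma updE m a i v : upd m a i v a i = v.
Proof. by rewrite /upd !eqxx. Qed.

Lemma upd_arr m a i v b j : b != a -> upd m a i v b j = m b j.
Proof. by rewrite /upd => /negbTE->. Qed.

Lemma upd_idx m a i v j : j != i -> upd m a i v a j = m a j.
Proof. by rewrite /upd eqxx => /negbTE->. Qed.

(** * Verification of the simulation of one layer *)

Section Program.
Variables (B X n s : nat) (rel res U : nat -> nat) (P K0 : nat) (K : nat -> nat).
Variables (D Um : nat).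
Notation N := (n.+1 ^ s.+2).
(** Bounds the cost of one layer in any state, reachable or not; summing over the layers gives the
    bound on table entries behind [CB]. *)
Definition layer_bound := n * (Um + (n + n) * P) + K0 + \sum_(i < s) K i.
Hypotheses (B_gt0 : 0 < B) (XB : X <= B) (nX : n <= X) (s2X : s.+2 <= X)
  (NX : N <= X) (decX : 2 ^ s <= X)
  (U_le_Um : forall l, l <= n -> U l <= Um)
  (FB : Um + (n + n) * P <= B) (CB : n.+1 * layer_bound <= B)
  (res_lt : forall j, j < n -> res j < s).

Notation wp := (wp B X).

Record env (m : arrays) : Prop := Env {
  envN : m vN 0 = n;
  envD : m vD 0 = D;
  envK0 : m vK0 0 = K0;
  envK : forall i, i < s -> m vK i = K i;
  envP : m vP 0 = P;
  envR : forall j, j < n -> m vR j = rel j;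
  envQ : forall j, j < n -> m vQ j = res j;
  envU : forall l, l <= n -> m vU l = U l;
  envB : m vB 0 = N }.

Definition env_ids := [:: vN; vD; vK0; vK; vP; vR; vQ; vU; vB].

Lemma env_same ws m m' : same ws m m' -> all (fun a => a \notin ws) env_ids ->
  env m -> env m'.
Proof.
move=> sm /= /and5P[h1 h2 h3 h4 /and5P[h5 h6 h7 h8 /andP[h9 _]]] e.
split; rewrite ?(sm _ h1) ?(sm _ h2) ?(sm _ h3) ?(sm _ h5) ?(sm _ h9); try by case: e.
- by move=> i hi; rewrite (sm _ h4) (envK e).
- by move=> i hi; rewrite (sm _ h6) (envR e).
- by move=> i hi; rewrite (sm _ h7) (envQ e).
- by move=> i hi; rewrite (sm _ h8) (envU e).
Qed.

Lemma env_upd m a i v : a \notin env_ids -> env m -> env (upd m a i v).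
Proof.
move=> ha; apply: (@env_same [:: a]); first by apply: same_upd; rewrite inE.
by apply/allP => b hb; rewrite inE; apply: contraNneq ha => <-.
Qed.

Lemma wp_skip (Q : arrays -> Prop) m : Q (upd m vtmp 0 0) -> wp hskip Q m.
Proof. by move=> q; apply: wp_set. Qed.

(** The base is evaluated anew in every round, hence the conditions on what it reads; the source is
    read once. *)
Lemma wp_decode b k src dst m bv kv x (Q : arrays -> Prop) :
  dst != vtmp -> dst != vi -> all (fun a => a \notin [:: vtmp; vi; dst]) (reads b) ->
  all (fun a => a != vtmp) (reads k) ->
  heval m b = bv -> 0 < bv -> bv <= B -> heval m k = kv -> kv <= X -> heval m src = x -> x <= B ->
  (forall m', same [:: vtmp; vi; dst] m m' -> (forall i, i < kv -> m' dst i = digit bv x i) ->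
     Q m') -> wp (decode b k src dst) Q m.
Proof.
move=> dt di rb rk eb b0 bB ek kX ex xB hQ; rewrite /decode.
apply: wp_seq; apply: wp_set => /=; first by rewrite ex.
rewrite ex; set m1 := upd m vtmp 0 x.
have s1 : same [:: vtmp] m m1 by apply: same_upd.
apply: (@wp_for _ _ _ _ _ _ kv (fun i m' => m' vtmp 0 = x %/ bv ^ i /\
   forall i', i' < i -> m' dst i' = digit bv x i')) => //.
- by rewrite /= !inE /= eq_sym (negbTE di).
- by rewrite -ek; apply: heval_same s1 _; apply: sub_all rk => a; rewrite inE.
- by split=> //; rewrite /upd /= expn0 divn1.
- move=> i m' ik sm vi' [ht hd].
  have s2 : same [:: vtmp; vi; dst] m m'.
    apply: same_trans (same_sub _ s1) (same_sub _ sm) => y; rewrite !inE.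
      by move=> ->.
    by case/or3P=> ->; rewrite ?orbT.
  have eb' : heval m' b = bv by rewrite -eb; apply: heval_same s2 _.
  have q1 : heval m' ($vtmp - $vtmp / b * b)%H = digit bv x i.
    by rewrite /= eb' ht /digit {1}(divn_eq (x %/ bv ^ i) bv) addKn.
  apply: wp_seq; apply: wp_set; first by rewrite q1 (leq_trans _ bB) // ltnW // digit_lt.
  rewrite q1 /= vi'; set m2 := upd m' dst i _.
  have eb2 : heval m2 b = bv.
    by rewrite -eb'; apply: (@heval_same [:: dst]); [apply: same_upd; rewrite inE|
      apply: sub_all rb => a; rewrite !inE !negb_or => /and3P[]].
  have t2 : m2 vtmp 0 = x %/ bv ^ i by rewrite /m2 upd_arr ?ht // eq_sym.
  apply: wp_set; first by rewrite /= t2 eb2 (leq_trans (leq_div _ _)) // (leq_trans (leq_div _ _)).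
  rewrite /= t2 eb2; split; first by rewrite /upd /= -divnMA expnSr.
  move=> i' h; rewrite upd_arr // upd_arr // /m2.
  have [->|ne] := eqVneq i' i; first by rewrite updE.
  by rewrite upd_idx // hd //; lia.
- move=> m' sm [_ hd]; apply: hQ => //.
  apply: same_trans (same_sub _ s1) (same_sub _ sm) => y; rewrite !inE.
    by move=> ->.
  by case/or3P=> ->; rewrite ?orbT.
Qed.

Lemma wp_encode m h (Q : arrays -> Prop) :
  m vN 0 = n -> (forall i, i < s.+2 -> m vg i = h i) -> (forall i, i < s.+2 -> h i < n.+1) ->
  (forall m', same [:: vy; vpw; vi] m m' -> m' vy 0 = undigits n.+1 s.+2 h -> Q m') ->
  wp (encode s) Q m.
Proof.
move=> mN mg hg hQ; rewrite /encode.
have NB : N <= B := leq_trans NX XB.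
apply: wp_seq; apply: wp_set => //=; apply: wp_seq; apply: wp_set => //=.
apply: (@wp_for _ _ _ _ _ _ s.+2 (fun k m' => m' vy 0 = undigits n.+1 k h /\
     m' vpw 0 = n.+1 ^ k)) => //.
- by rewrite /upd /= /undigits big_ord0 expn0.
- move=> i m' ilt sm mi [hy hp].
  have uS : undigits n.+1 i.+1 h = undigits n.+1 i h + h i * n.+1 ^ i.
    by rewrite /undigits big_ord_recr.
  have lt : n.+1 ^ i.+1 <= B by apply: leq_trans NB; rewrite leq_pexp2l.
  have uB : undigits n.+1 i.+1 h <= B.
    by apply: ltnW; apply: leq_trans lt; apply: undigits_lt => k hk; apply: hg; lia.
  apply: wp_seq; apply: wp_set; rewrite /= mi hy hp sm // /upd /= mg // -uS //.
  apply: wp_set; rewrite /upd /= hp sm // /upd /= mN addn1 -expnSr //.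
- move=> m' sm [hy _]; apply: hQ => //.
  apply: same_trans (same_sub _ sm); last by apply/allP.
  by apply: same_trans (same_upd _ _ _ _) (same_upd _ _ _ _).
Qed.

Section Layer.
Variables (l d : nat) (g : nat -> nat).
Hypotheses (l_le : l <= n) (g_le : forall i, i < s.+2 -> g i <= n).

Lemma base_le : base s U P l g <= Um + n * P.
Proof.
rewrite geq_max (leq_trans (U_le_Um l_le)) ?leq_addr // andbT /avail.
by rewrite leq_add ?U_le_Um ?g_le // leq_mul2r g_le ?orbT.
Qed.

Lemma lcost_le_bound : lcost n s rel res U P K0 K l d g <= layer_bound.
Proof. by apply: lcost_le; rewrite ?g_le. Qed.

Lemma layer_bound_le : layer_bound <= B.
Proof. by apply: leq_trans CB; rewrite leq_pmull. Qed.

Notation served := (served n rel res U l d g).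
Notation cnt := (cnt n rel res U l d g).
Notation jobcost := (jobcost n s rel res U P l d g).
Notation marked := (marked n rel res U l d g).
Notation base := (base s U P l g).

Definition decided m :=
  [/\ env m, m vl 0 = l & forall i, i < s -> m vbit i = digit 2 d i].

Lemma wp_serve_jobs m k0 (Q : arrays -> Prop) :
  decided m -> (forall i, i < s -> m vg i = g i) -> m vg s.+1 = k0 -> k0 <= n ->
  m vF 0 = base -> m vc 0 = 0 -> m vq 0 = 0 -> (forall i, i < s -> m vmark i = 0) ->
  (forall m', same [:: vj; vS; vF; vc; vmark; vq; vg; vtmp] m m' ->
    m' vc 0 = jobcost n -> m' vq 0 = (0 < cnt n) ->
    (forall i, i < s -> m' vmark i = marked n i) ->
    (forall i, i < s.+1 -> m' vg i = m vg i) -> m' vg s.+1 = minn n (k0 + cnt n) ->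
    (forall j, j < n -> m' vS j = if served j then base + cnt j * P else m vS j) ->
    Q m') ->
  wp (serve_jobs s) Q m.
Proof.
move=> [em ml mb] mg mk kn mF mc mq mm hQ.
pose Inv j (m' : arrays) := [/\ m' vF 0 = base + cnt j * P, m' vc 0 = jobcost j,
  m' vq 0 = (0 < cnt j), (forall i, i < s -> m' vmark i = marked j i) &
  [/\ forall i, i < s.+1 -> m' vg i = m vg i, m' vg s.+1 = minn n (k0 + cnt j) &
   forall j', m' vS j' = if (j' < j) && served j' then base + cnt j' * P else m vS j']].
apply: (@wp_for _ _ _ _ _ _ n Inv) => //.
- by rewrite /= (envN em).
- rewrite /Inv /upd /= cnt0 jobcost0; split=> //.
  + by rewrite mF mul0n addn0.
  + by split=> //; rewrite mk addn0; apply/esym/minn_idPr.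
- move=> j m' jn sm mj [iF ic iq im [ig ik iS]].
  have em' : env m' by apply: (env_same sm).
  have ml' : m' vl 0 = l by rewrite sm.
  have rj := res_lt jn.
  have mb' : m' vbit (res j) = digit 2 d (res j) by rewrite sm // mb.
  have gj : m' vg (res j) = g (res j) by rewrite ig ?mg //; lia.
  have grn : g (res j) <= n by apply: g_le; lia.
  have ec : (heval m' ((1 - (vR@[$vj] - vU@[$vl])) * (vR@[$vj] - vU@[vg@[vQ@[$vj]]])
          * (vbit@[vQ@[$vj]] + (1 - ($vN - $vl))))%H != 0) = served j.
    rewrite /= mj (envR em') // ml' (envU em') // (envQ em') // gj (envU em') // mb' (envN em').
    rewrite !muln_eq0 servedE; set b := digit 2 d (res j).
    by apply/idP/idP; lia.
  have fb : base + (cnt j).+1 * P <= B.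
    apply: leq_trans FB; rewrite mulnDl addnA leq_add ?base_le // leq_mul2r.
    by rewrite (leq_ltn_trans (cnt_le _ _ _ _ _ _ _ _) jn) orbT.
  have jb : jobcost j.+1 <= B.
    apply: leq_trans layer_bound_le; rewrite /layer_bound -addnA; apply: leq_trans (leq_addr _ _).
    rewrite jobcostE.
    apply: (@leq_trans (\sum_(k < cnt j.+1) (Um + (n + n) * P))); last first.
      by rewrite big_const_ord iter_addn_0 mulnC leq_mul2r (leq_trans (cnt_le _ _ _ _ _ _ _ _)) ?orbT.
    apply: leq_sum => k _; rewrite mulnDl addnA leq_add ?base_le // leq_mul2r.
    by rewrite (leq_trans (ltn_ord k)) ?orbT // (leq_trans (cnt_le _ _ _ _ _ _ _ _)).
  rewrite jobcostS in jb.
  apply: wp_if; rewrite ?ec => sj; last first.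
    have {}sj : served j = false by rewrite -ec sj.
    apply: wp_skip; rewrite /Inv /upd /=.
    rewrite cntS jobcostS sj mul0n !addn0; split=> //.
      by move=> i hi; rewrite markedS sj orbF im.
    split=> // j'; rewrite iS ltnS (leq_eqVlt j' j).
    by case: eqP => [->|] //; rewrite sj ltnn.
  rewrite sj mul1n in jb.
  apply: wp_seq; apply: wp_set; rewrite /= ?mj ?iF; first by apply: leq_trans fb; lia.
  apply: wp_seq; apply: wp_set; rewrite /upd /= ?mj ?iF ?(envP em').
    by apply: leq_trans fb; rewrite mulSn; lia.
  apply: wp_seq; apply: wp_set; rewrite /upd /= ?ic.
    by rewrite -addnA -mulSnr.
  apply: wp_seq; apply: wp_set; rewrite /upd /= ?mj ?(envQ em') //.
  apply: wp_seq; apply: wp_set; rewrite /upd //=.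
  apply: wp_set; rewrite /upd /= ?eqxx ik (envN em').
    by apply: leq_trans (leq_trans nX XB); lia.
  rewrite /Inv /= cntS jobcostS sj mul1n; split=> //.
  + by rewrite addn1 mulSnr addnA.
  + by rewrite -addnA -mulSnr.
  + by rewrite addn1.
  + move=> i hi; rewrite markedS sj eq_sym; case: eqP => _; rewrite ?orbT //= orbF; exact: im.
  + split.
    * by move=> i hi; rewrite ltn_eqF // ig.
    * by rewrite eqxx; lia.
    * move=> j'; rewrite ltnS (leq_eqVlt j' j); case: eqP => [->|_] /=; first by rewrite sj.
      exact: iS.
- move=> m' sm [iF ic iq im [ig ik iS]]; apply: hQ => // j jn.
  by rewrite iS jn.
Qed.

Lemma wp_start_layer m (Q : arrays -> Prop) :
  env m -> m vl 0 = l -> (forall i, i < s.+2 -> m vg i = g i) ->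
  (forall m', same [:: vF; vg; vtmp; vc; vq; vi; vmark] m m' ->
    m' vF 0 = base -> m' vc 0 = 0 -> m' vq 0 = 0 ->
    (forall i, i < s -> m' vmark i = 0) -> (forall i, i < s -> m' vg i = g i) ->
    m' vg s = (if avail s U P g < U l then l else g s) ->
    m' vg s.+1 = (if avail s U P g < U l then 0 else g s.+1) -> Q m') ->
  wp (start_layer s) Q m.
Proof.
move=> em ml mg hQ; rewrite /start_layer.
have gs : g s <= n by apply: g_le.
have gs1 : g s.+1 <= n by apply: g_le.
have lB : l <= B by apply: leq_trans l_le (leq_trans nX XB).
have aB : avail s U P g <= B.
  apply: leq_trans FB; rewrite /avail leq_add ?U_le_Um // leq_mul2r.
  by rewrite (leq_trans gs1) ?leq_addr ?orbT.
have UB : U l <= B by apply: leq_trans FB; apply: leq_trans (U_le_Um l_le) (leq_addr _ _).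
apply: wp_seq; apply: wp_set; rewrite /= !mg // (envU em) // (envP em) //.
rewrite -/(avail s U P g); set m1 := upd m vF 0 _.
have em1 : env m1 by apply: env_upd.
apply: wp_seq.
pose st m' := [/\ env m', m' vl 0 = l, m' vF 0 = base &
  [/\ forall i, i < s -> m' vg i = g i,
    m' vg s = (if avail s U P g < U l then l else g s) &
    m' vg s.+1 = (if avail s U P g < U l then 0 else g s.+1)]].
(* The code after the conditional is verified once, for both branches. *)
have hst : forall m2, same [:: vF; vg; vtmp; vc; vq; vi; vmark] m m2 -> st m2 ->
    wp (vc <<- 0 ;; vq <<- 0 ;; HFor vi s (vmark <<-[$vi] 0)) Q m2.
  move=> m2 s2 [e2 l2 F2 [g2 gs2 gk2]].
  apply: wp_seq; apply: wp_set => //; apply: wp_seq; apply: wp_set => //=.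
  apply: (@wp_for _ _ _ _ _ _ s (fun i m' => forall i', i' < i -> m' vmark i' = 0)) => //.
  - by apply: leq_trans s2X; lia.
  - move=> i m' ilt sm' mi hm; apply: wp_set => //= i' h.
    by rewrite /upd /= mi; case: eqP => // ne; apply: hm; lia.
  - move=> m' sm hm; apply: hQ => //.
    + apply: same_trans s2 _.
      apply: same_trans (same_sub _ sm); last by apply/allP.
      by apply: same_trans (same_upd _ _ _ _) (same_upd _ _ _ _).
    + by rewrite sm // /upd /= F2.
    + by rewrite sm // /upd /=.
    + by rewrite sm // /upd /=.
    + by move=> i hi; rewrite sm // /upd /= g2.
    + by rewrite sm // /upd /= gs2.
    + by rewrite sm // /upd /= gk2.
have s1 : same [:: vF; vg; vtmp; vc; vq; vi; vmark] m m1 by apply: same_upd.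
have ec : heval m1 (vU@[$vl] - $vF)%H = U l - avail s U P g.
  by rewrite /= /m1 /upd /= ml (envU em).
apply: wp_if; rewrite ec => lt.
  rewrite subn_eq0 -ltnNge in lt.
  apply: wp_seq; apply: wp_set; rewrite /= /m1 /upd /= ml //.
  apply: wp_seq; apply: wp_set => //=.
  apply: wp_set; rewrite /= /upd /= ml (envU em) //.
  apply: hst.
    do 3 (apply: same_trans; last by apply: same_upd).
    by apply: same_upd.
  split.
  - by do 3 apply: env_upd => //.
  - by rewrite /upd /=.
  - by rewrite /upd /= /base /maxn lt.
  - rewrite lt; split.
    + by move=> i hi; rewrite /upd /= !ltn_eqF ?mg //; lia.
    + by rewrite /upd /= eqxx ltn_eqF.
    + by rewrite /upd /= eqxx.
have {}lt : (avail s U P g < U l) = false.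
  by apply/negbTE; rewrite -leqNgt -subn_eq0; apply/eqP.
apply: wp_skip; apply: hst; first by apply: same_trans s1 _; apply: same_upd.
split.
- exact: env_upd.
- by rewrite /m1 /upd /=.
- by rewrite /m1 /upd /= /base /maxn lt.
- by rewrite lt /m1 /upd /=; split=> *; rewrite mg //; lia.
Qed.

Lemma wp_charge_sets m (Q : arrays -> Prop) :
  env m -> m vl 0 = l -> m vc 0 = jobcost n -> m vq 0 = (0 < cnt n) ->
  (forall i, i < s -> m vmark i = marked n i) ->
  (forall m', same [:: vc; vi; vg; vtmp] m m' ->
    m' vc 0 = lcost n s rel res U P K0 K l d g ->
    (forall i, i < s.+2 -> m' vg i = if (i < s) && marked n i then l else m vg i) -> Q m') ->
  wp (charge_sets s) Q m.
Proof.
move=> em ml mc mq mm hQ; rewrite /charge_sets.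
have lB : l <= B by apply: leq_trans l_le (leq_trans nX XB).
(* The layer cost with only the first [i] resources charged; each partial sum inherits the bound on
   the whole. *)
pose cst i := jobcost n + (0 < cnt n) * K0 + \sum_(i' < i | marked n i') K i'.
have cstB i : i <= s -> cst i <= B.
  move=> si; apply: leq_trans layer_bound_le; apply: leq_trans lcost_le_bound.
  rewrite /lcost /setcost addnA leq_add2l -(subnKC si) big_split_ord /=; exact: leq_addr.
have cs : lcost n s rel res U P K0 K l d g = cst s by rewrite /cst /lcost /setcost addnA.
have c0 : cst 0 = jobcost n + (0 < cnt n) * K0 by rewrite /cst big_ord0 addn0.
have hst : forall m1, same [:: vc; vi; vg; vtmp] m m1 -> m1 vg =1 m vg -> m1 vc 0 = cst 0 ->
    wp (HFor vi s (HIf (vmark@[$vi])%H (vc <<- $vc + vK@[$vi] ;; vg <<-[$vi] $vl) hskip)) Q m1.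
  move=> m1 s1 g1 c1.
  apply: (@wp_for _ _ _ _ _ _ s (fun k m' => m' vc 0 = cst k /\
     forall i, i < s.+2 -> m' vg i = if (i < k) && marked n i then l else m vg i)) => //.
  - by apply: leq_trans s2X; lia.
  - by split=> // i _; rewrite /upd /= g1.
  - move=> i m' ilt sm mi [hc hg].
    have sm' : same [:: vc; vi; vg; vtmp] m m' by apply: same_trans s1 (same_sub _ sm); apply/allP.
    have cS : cst i.+1 = cst i + marked n i * K i.
      rewrite /cst [in LHS]big_mkcond big_ord_recr /= -big_mkcond /= addnA.
      by case: ifP; rewrite ?mul1n ?mul0n.
    have cB := cstB _ ilt; rewrite cS in cB.
    apply: wp_if; rewrite /= mi sm' // mm // => mk.
      have {}mk : marked n i by case: (marked n i) mk.
      rewrite mk mul1n in cS cB.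
      apply: wp_seq; apply: wp_set; rewrite /= mi hc (sm' vK) // (envK em) //.
      apply: wp_set; rewrite /upd /= ?mi (sm' vl) // ml //.
      split=> // i' h; case: eqP => [->|ne]; first by rewrite ltnSn mk.
      by rewrite hg // ltnS (leq_eqVlt i'); move/eqP/negbTE: ne => ->.
    have {}mk : marked n i = false by case: (marked n i) mk.
    rewrite mk mul0n addn0 in cS; apply: wp_skip; rewrite /upd /= cS; split=> // i' h.
    rewrite hg // ltnS (leq_eqVlt i'); case: eqP => [->|ne] //=.
    by rewrite mk andbF.
  - move=> m' sm [hc hg]; apply: hQ => //; last by rewrite cs.
    by apply: same_trans s1 (same_sub _ sm); apply/allP.
have cB := cstB 0 (leq0n s); rewrite c0 in cB hst.
apply: wp_seq; apply: wp_if; rewrite /= mq => q0.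
  have {}q0 : (0 < cnt n) = true by case: (0 < _) q0.
  rewrite q0 mul1n in cB hst.
  apply: wp_set; rewrite /= mc (envK0 em) //.
  by apply: hst => //; apply: same_upd.
have {}q0 : (0 < cnt n) = false by case: (0 < _) q0.
rewrite q0 mul0n addn0 in hst.
by apply: wp_skip; apply: hst => //; apply: same_upd.
Qed.

End Layer.

Definition layer_ids :=
  [:: vbit; vtmp; vi; vg; vF; vc; vq; vmark; vj; vS; vy; vpw].

Lemma wp_run_layer m l d x (Q : arrays -> Prop) : env m -> l <= n -> x <= B -> d <= B ->
  m vl 0 = l -> m vd 0 = d -> m vx 0 = x ->
  let g := digit n.+1 x in
  (forall m', same layer_ids m m' ->
     m' vc 0 = lcost n s rel res U P K0 K l d g ->
     m' vy 0 = transit n s rel res U P l d x ->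
     m' vq 0 = (0 < cnt n rel res U l d g n) ->
     (forall i, i < s -> m' vmark i = marked n rel res U l d g n i) ->
     (forall j, j < n -> m' vS j = if served n rel res U l d g j
        then base s U P l g + cnt n rel res U l d g j * P else m vS j) -> Q m') ->
  wp (run_layer s) Q m.
Proof.
move=> em ln xB dB ml md mx g hQ; rewrite /run_layer.
have g_le i : i < s.+2 -> g i <= n by move=> _; rewrite -ltnS digit_lt.
have n1B : n.+1 <= B.
  apply: leq_trans (leq_trans NX XB); rewrite -{1}(expn1 n.+1) leq_pexp2l //.
have B2 : 2 <= B by apply: leq_trans (leq_trans s2X XB).
apply: wp_seq; apply: (@wp_decode _ _ _ _ _ 2 s d) => //.
  by apply: leq_trans s2X; lia.
move=> m1 s1 b1; apply: wp_seq.
apply: (@wp_decode _ _ _ _ _ n.+1 s.+2 x) => //.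
- by rewrite /= s1 // (envN em) addn1.
- by rewrite /= s1.
move=> m2 s2 g2; apply: wp_seq.
have e2 : env m2 by apply: (env_same s2) => //; apply: (env_same s1).
apply: (@wp_start_layer l g) => //; first by rewrite s2 // s1.
move=> m3 s3 F3 c3 q3 mk3 g3 gs3 gk3; apply: wp_seq.
have e3 : env m3 by apply: (env_same s3).
have l3 : m3 vl 0 = l by rewrite s3 // s2 // s1.
apply: (@wp_serve_jobs l d g ln g_le m3 _ _ _ g3 gk3) => //.
- split=> // i hi; by rewrite s3 // s2 // b1.
- by case: ifP => // _; apply: g_le.
move=> m4 s4 c4 q4 mk4 g4 gk4 S4; apply: wp_seq.
have e4 : env m4 by apply: (env_same s4).
have l4 : m4 vl 0 = l by rewrite s4.
apply: (@wp_charge_sets l d g) => //.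
move=> m5 s5 c5 g5.
have e5 : env m5 by apply: (env_same s5).
apply: (@wp_encode m5 (step n s rel res U P l d g)).
- exact: envN e5.
- move=> i hi; rewrite g5 // /step; case: ltnP => hs /=.
    by case: ifP => // _; rewrite g4 ?g3 //; lia.
  have [->|ne] := eqVneq i s; first by rewrite g4.
  by have -> : i = s.+1 by lia.
- by move=> i hi; apply: step_le.
move=> m6 s6 y6; apply: hQ => //.
- apply: same_trans (same_sub _ s1) (same_trans (same_sub _ s2) (same_trans
    (same_sub _ s3) (same_trans (same_sub _ s4) (same_trans (same_sub _ s5)
    (same_sub _ s6))))); by apply/allP.
- by rewrite s6.
- by rewrite s6 // s5.
- by move=> i hi; rewrite s6 // s5 // mk4.
- by move=> j jn; rewrite s6 // s5 // S4 // s3 // s2 // s1.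
Qed.

(** * Backward recursion *)

Definition entry_ok (m : arrays) l x :=
  let T l x := m vT (l * N + x) in
  let cand d := lcost n s rel res U P K0 K l d (digit n.+1 x)
                + T l.+1 (transit n s rel res U P l d x) in
  [/\ m vG (l * N + x) < 2 ^ s, T l x = cand (m vG (l * N + x)),
      forall d, d < 2 ^ s -> T l x <= cand d
    & T l x <= (n.+1 - l) * layer_bound].

(** The null row [n.+1] starts the recursion, and the rows above [k] are complete. *)
Definition table_ok (m : arrays) k :=
  (forall x, x < N -> m vT (n.+1 * N + x) = 0) /\
  forall l x, k < l <= n -> x < N -> entry_ok m l x.

Lemma table_index_inj l x l' x' : x < N -> x' < N ->
  l * N + x = l' * N + x' -> l = l' /\ x = x'.
Proof.
move=> xN xN' e; have e1 : l = l'.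
  by have := congr1 (divn^~ N) e; rewrite !divnMDl ?divn_small ?addn0 ?expn_gt0.
by split=> //; move: e; rewrite e1 => /addnI.
Qed.

Lemma table_entry_bound m k l x : table_ok m k -> k < l <= n.+1 -> x < N ->
  m vT (l * N + x) <= (n.+1 - l) * layer_bound.
Proof.
move=> [t0 t1] h xN; have [->|ne] := eqVneq l n.+1; first by rewrite t0.
by have [] := t1 l x _ xN; last by []; lia.
Qed.

(** The summand [1 - $vd] is nonzero only for decision 0, which is thus always accepted and
    initializes [vbest]; later decisions must be strictly better. *)
Definition try_decision : hcmd :=
  run_layer s ;;
  vtmp <<- $vc + vT@[($vl + 1) * $vB + $vy] ;;
  HIf ((1 - $vd) + ($vbest - $vtmp))%H (vbest <<- $vtmp ;; vbd <<- $vd) hskip.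

Definition fill_entry : hcmd :=
  HFor vd (2 ^ s) try_decision ;;
  vT <<-[$vl * $vB + $vx] $vbest ;;
  vG <<-[$vl * $vB + $vx] $vbd.

Definition fill_table : hcmd :=
  HFor vx ($vB)%H (vT <<-[($vN + 1) * $vB + $vx] 0) ;;
  HFor vt ($vN)%H
    (vl <<- $vN - $vt ;;
     HFor vx ($vB)%H fill_entry).

Definition decision_ids := [:: vtmp; vbest; vbd] ++ layer_ids.

Lemma wp_try_decisions m l x (Q : arrays -> Prop) : env m -> 0 < l <= n -> x < N ->
  m vl 0 = l -> m vx 0 = x -> table_ok m l ->
  let cand d := lcost n s rel res U P K0 K l d (digit n.+1 x)
                + m vT (l.+1 * N + transit n s rel res U P l d x) in
  (forall m', same (vd :: decision_ids) m m' -> m' vbd 0 < 2 ^ s ->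
     m' vbest 0 = cand (m' vbd 0) -> (forall d, d < 2 ^ s -> m' vbest 0 <= cand d) ->
     m' vbest 0 <= (n.+1 - l) * layer_bound -> Q m') ->
  wp (HFor vd (2 ^ s) try_decision) Q m.
Proof.
move=> em /andP[l0 ln] xN ml mx tok cand hQ.
have candB d : cand d <= (n.+1 - l) * layer_bound.
  have -> : n.+1 - l = (n.+1 - l.+1).+1 by lia.
  rewrite mulSn leq_add //; last by apply: (table_entry_bound tok); [lia|apply: transit_lt].
  by apply: lcost_le_bound => // i _; rewrite -ltnS digit_lt.
have lbB k : k <= n.+1 -> k * layer_bound <= B.
  by move=> kn; apply: leq_trans CB; rewrite leq_mul2r kn orbT.
(* The guard [0 < k] is there because [vbest] holds an arbitrary value before decision 0 has been
   tried. *)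
apply: (@wp_for _ _ _ _ _ _ (2 ^ s) (fun k m' => 0 < k -> [/\ m' vbd 0 < k,
  m' vbest 0 = cand (m' vbd 0) & forall d, d < k -> m' vbest 0 <= cand d])) => //.
- move=> d m' dlt sm md inv.
  have em' : env m' by apply: (env_same sm).
  rewrite /try_decision; apply: wp_seq; apply: (@wp_run_layer m' l d x) => //.
  - by apply: ltnW; apply: leq_trans xN (leq_trans NX XB).
  - by apply: ltnW; apply: leq_trans dlt (leq_trans decX XB).
  - by rewrite sm.
  - by rewrite sm.
  move=> m2 s2 c2 y2 _ _ _.
  have e2 : env m2 by apply: (env_same s2).
  have tr : heval m2 ($vc + vT@[($vl + 1) * $vB + $vy])%H = cand d.
    by rewrite /= c2 y2 (s2 vl) // (sm vl) // ml addn1 (envB e2) (s2 vT) // (sm vT).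
  apply: wp_seq; apply: wp_set; rewrite tr; first by apply: leq_trans (candB d) (lbB _ _); lia.
  have d2 : m2 vd 0 = d by rewrite s2.
  have best2 : m2 vbest 0 = m' vbest 0 by rewrite s2.
  have bd2 : m2 vbd 0 = m' vbd 0 by rewrite s2.
  apply: wp_if; rewrite /upd /= d2 best2 => cond.
    apply: wp_seq; apply: wp_set; rewrite /=; first by apply: leq_trans (candB d) (lbB _ _); lia.
    apply: wp_set; rewrite /= /upd /= ?d2.
      by apply: ltnW; apply: leq_trans dlt (leq_trans decX XB).
    move=> _; split=> // d'; rewrite ltnS leq_eqVlt => /orP[/eqP->//|dd].
    have [|_ _ /(_ d' dd)] := inv; lia.
  apply: wp_skip; rewrite /upd /= best2 bd2 => _.
  have [|i1 i2 i3] := inv; first by lia.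
  split=> //; first by apply: leqW.
  by move=> d'; rewrite ltnS leq_eqVlt => /orP[/eqP->|dd]; [lia|apply: i3].
- move=> m' sm inv; have [|i1 i2 i3] := inv; first by rewrite expn_gt0.
  apply: hQ => //; last by rewrite i2 candB.
  by apply: same_sub sm; apply/allP.
Qed.

Lemma entry_ok_eq m m' l x :
  m' vG (l * N + x) = m vG (l * N + x) ->
  m' vT (l * N + x) = m vT (l * N + x) ->
  (forall y, y < N -> m' vT (l.+1 * N + y) = m vT (l.+1 * N + y)) -> l <= n ->
  entry_ok m l x -> entry_ok m' l x.
Proof.
move=> eG eT eT' ln [h1 h2 h3 h4]; split; rewrite ?eG ?eT //.
- by rewrite eT' ?transit_lt.
- by move=> d dl; rewrite eT' ?transit_lt //; apply: h3.
Qed.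

Lemma wp_fill_entry m l x (Q : arrays -> Prop) : env m -> 0 < l <= n -> x < N ->
  m vl 0 = l -> m vx 0 = x -> table_ok m l ->
  (forall m', same (vd :: vT :: vG :: decision_ids) m m' -> entry_ok m' l x ->
     (forall i, i != l * N + x -> m' vT i = m vT i /\ m' vG i = m vG i) -> Q m') ->
  wp fill_entry Q m.
Proof.
move=> em ln xN ml mx tok hQ; rewrite /fill_entry.
apply: wp_seq; apply: (wp_try_decisions em ln xN ml mx tok) => m1 s1 b1 b2 b3 b4.
have e1 : env m1 by apply: (env_same s1).
have l1 : m1 vl 0 = l by rewrite s1.
have x1 : m1 vx 0 = x by rewrite s1.
apply: wp_seq; apply: wp_set; rewrite /= ?l1 ?x1 ?(envB e1).
  apply: leq_trans b4 (leq_trans _ CB); rewrite leq_mul2r; apply/orP; right; lia.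
apply: wp_set; rewrite /upd /= ?l1 ?x1 ?(envB e1).
  by apply: ltnW; apply: leq_trans b1 (leq_trans decX XB).
apply: hQ.
- move=> a ha i; rewrite /= !inE !negb_or in ha; case/and4P: ha => h1 h2 h3 h4.
  rewrite (negbTE h3) (negbTE h2) /= s1 // inE negb_or h1 /=.
  by rewrite !inE !negb_or.
(* Candidates read row [l.+1], so writing in row [l] does not change them. *)
- have ne d : (l.+1 * N + transit n s rel res U P l d x == l * N + x) = false.
    apply/eqP => /(table_index_inj (transit_lt _ _ _ _ _ _ _ _) xN) => h.
    by have [] := h; lia.
  rewrite /entry_ok /= !eqxx; split=> //.
  + by rewrite ne (s1 vT).
  + by move=> d dl; rewrite ne (s1 vT) //; apply: b3.
- by move=> i /negbTE-> /=; rewrite (s1 vT) // (s1 vG).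
Qed.

Lemma wp_fill_table m (Q : arrays -> Prop) : env m ->
  (forall m', same (vd :: vT :: vG :: vt :: vl :: vx :: decision_ids) m m' ->
     table_ok m' 0 -> Q m') ->
  wp fill_table Q m.
Proof.
move=> em hQ; rewrite /fill_table; apply: wp_seq.
apply: (@wp_for _ _ _ _ _ _ N (fun k m' => forall x, x < k -> m' vT (n.+1 * N + x) = 0)) => //.
- by rewrite /= (envB em).
- move=> x m' xN sm mx hT; have em' : env m' by apply: (env_same sm).
  apply: wp_set => //= x' hx; rewrite (envN em') (envB em') mx /upd /= addn1 eqn_add2l.
  by case: eqP => // ne; apply: hT; lia.
move=> m1 s1 T1; have e1 : env m1 by apply: (env_same s1).
apply: (@wp_for _ _ _ _ _ _ n (fun t m' => table_ok m' (n - t))) => //.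
- by rewrite /= (envN e1).
- by split=> // l x h; exfalso; lia.
- move=> t m2 tn s2 mt tok2; have e2 : env m2 by apply: (env_same s2).
  apply: wp_seq; apply: wp_set; rewrite /= (envN e2) mt.
    by apply: leq_trans (leq_subr _ _) (leq_trans nX XB).
  set l := n - t; set m3 := upd m2 vl 0 l.
  have ln : 0 < l <= n by lia.
  have e3 : env m3 by apply: env_upd.
  have tok3 : table_ok m3 l by case: tok2 => t0 t1; split.
  apply: (@wp_for _ _ _ _ _ _ N (fun k m' => table_ok m' l /\
     forall x, x < k -> entry_ok m' l x)) => //.
  + by rewrite /= (envB e3).
  + move=> x m4 xN s4 mx [tok4 en4]; have e4 : env m4 by apply: (env_same s4).
    apply: (wp_fill_entry e4 ln xN _ mx tok4); first by rewrite s4 // /m3 /upd /=.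
    move=> m5 s5 en5 fr5.
    have ni l' y : y < N -> (l' != l) || (y != x) -> l' * N + y != l * N + x.
      move=> yN ne; apply/eqP => /(table_index_inj yN xN)[e1' e2'].
      by rewrite e1' e2' !eqxx in ne.
    case: tok4 => t0 t1; split; first split.
    * move=> y yN; rewrite /upd /=; have [|-> _] := fr5 (n.+1 * N + y); last exact: t0.
      by apply: ni => //; lia.
    * move=> l' y hl yN; apply: entry_ok_eq (t1 l' y hl yN); rewrite /upd /=.
      - by have [|_ ->] := fr5 (l' * N + y); first by apply: ni => //; lia.
      - by have [|-> _] := fr5 (l' * N + y); first by apply: ni => //; lia.
      - by move=> z zN; have [|-> _] := fr5 (l'.+1 * N + z); first by apply: ni => //; lia.
      - by lia.
    * move=> y; rewrite ltnS leq_eqVlt => /orP[/eqP->|yx]; first exact: en5.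
      apply: entry_ok_eq (en4 y yx); rewrite /upd /=.
      - by have [|_ ->] := fr5 (l * N + y); first by apply: ni; lia.
      - by have [|-> _] := fr5 (l * N + y); first by apply: ni; lia.
      - by move=> z zN; have [|-> _] := fr5 (l.+1 * N + z); first by apply: ni => //; lia.
      - by lia.
  + move=> m4 s4 [[t0 t1] en4]; split=> // l' x hl xN.
    have [->|ne] := eqVneq l' l; first exact: en4.
    by apply: t1 => //; lia.
- move=> m2 s2; rewrite subnn => tok; apply: hQ => //.
  by apply: same_trans (same_sub _ s1) (same_sub _ s2); apply/allP.
Qed.

(** * Forward simulation and output *)

Section Forward.
Variable G : nat -> nat -> nat.
Hypotheses (U0 : U 0 = 0) (Ulast : forall l, l < n -> U l < U l.+1)
  (rel_gt0 : forall j, j < n -> 0 < rel j)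
  (rel_U : forall j, j < n -> exists2 l, l <= n & rel j = U l)
  (DB : D.+1 <= B) (outX : 2 * n + 2 + n * (s + 2) <= X)
  (G_lt : forall l x, 0 < l <= n -> x < N -> G l x < 2 ^ s).

Notation ds := (greedy n s rel res U P G).
Notation gst t := (path_state n s rel res U P ds t).
Notation st t := (digit n.+1 (gst t)).
Notation sched t S := (sched n s rel res U P ds t S).

Definition layer_marks t i := marked n rel res U t.+1 (ds t.+1) (st t) n i.
Definition active t := 0 < cnt n rel res U t.+1 (ds t.+1) (st t) n.
Lemma activeE t : active t = (0 < cnt n rel res U t.+1 (ds t.+1) (st t) n).
Proof. by []. Qed.

Definition active_layers t := [seq t' <- iota 0 t | active t'].
(** Output entries are stored plus one. For a time this increment cancels the shift of the release
    dates, so [U t.+1] is stored as it is. *)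
Definition block t := [:: U t.+1; D.+1] ++ mkseq (fun i => (layer_marks t i).+1) s.
Definition blocks t := flatten [seq block t' | t' <- active_layers t].

Lemma size_blocks t : size (blocks t) = size (active_layers t) * (s + 2).
Proof.
rewrite /blocks size_flatten /shape; elim: (active_layers t) => //= a r ->.
by rewrite size_mkseq mulSn addn2.
Qed.

Lemma active_layersS t : active_layers t.+1 =
  active_layers t ++ (if active t then [:: t] else [::]).
Proof. by rewrite /active_layers -addn1 iotaD filter_cat /=; case: active. Qed.

Lemma size_active_layers t : size (active_layers t) <= t.
Proof. by rewrite size_filter (leq_trans (count_size _ _)) ?size_iota. Qed.

(** Output entries 1 to [2 * n] are reserved for the starting times and entry [2 * n + 1] for the
    number of replenishments; hence the offset [2 * n + 2]. *)
Definition record_layer : hcmd :=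
  vpw <<- 2 * $vN + 2 + $vnq * (s + 2) ;;
  oarr <<-[$vpw] vU@[$vl] ;;
  oarr <<-[$vpw + 1] $vD + 1 ;;
  HFor vi s (oarr <<-[$vpw + 2 + $vi] vmark@[$vi] + 1) ;;
  vnq <<- $vnq + 1.

Definition forward : hcmd :=
  vx <<- 0 ;;
  vnq <<- 0 ;;
  HFor vt ($vN)%H
    (vl <<- $vt + 1 ;;
     vd <<- vG@[$vl * $vB + $vx] ;;
     run_layer s ;;
     vx <<- $vy ;;
     HIf ($vq)%H record_layer hskip).

Lemma wp_record_layer m t k (Q : arrays -> Prop) : env m -> t < n -> k < n ->
  m vl 0 = t.+1 -> m vnq 0 = k ->
  (forall i, i < s -> m vmark i = layer_marks t i) ->
  (forall m', same [:: vpw; oarr; vi; vnq] m m' -> m' vnq 0 = k.+1 ->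
    (forall i, m' oarr (2 * n + 2 + i) = if (k * (s + 2) <= i < k.+1 * (s + 2))
       then nth 0 (block t) (i - k * (s + 2)) else m oarr (2 * n + 2 + i)) -> Q m') ->
  wp record_layer Q m.
Proof.
move=> em tn kn ml mk mm hQ; rewrite /record_layer.
set p := 2 * n + 2 + k * (s + 2).
have pX : p <= X.
  apply: leq_trans outX; rewrite leq_add2l leq_mul2r; apply/orP; right; lia.
apply: wp_seq; apply: wp_set; rewrite /= (envN em) mk -/p; first exact: leq_trans pX XB.
apply: wp_seq; apply: wp_set; rewrite /upd /= ml (envU em) //.
  by apply: leq_trans (U_le_Um tn) (leq_trans (leq_addr _ _) FB).
apply: wp_seq; apply: wp_set; rewrite /upd /= (envD em) addn1 //.
apply: wp_seq.
have B2 : 2 <= B by apply: leq_trans (leq_trans s2X XB).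
set m1 := fun b j => _.
have m1o i : m1 oarr i = if i == p.+1 then D.+1 else if i == p then U t.+1 else m oarr i.
  by rewrite /m1 /= addn1.
have s1 : same [:: vpw; oarr] m m1.
  move=> a; rewrite !inE negb_or => /andP[h1 h2] i; rewrite /m1.
  by rewrite (negbTE h1) (negbTE h2).
apply: (@wp_for _ _ _ _ _ _ s (fun c m' => forall i, m' oarr i =
   if p + 2 <= i < p + 2 + c then (layer_marks t (i - (p + 2))).+1 else m1 oarr i)) => //.
- by apply: leq_trans s2X; lia.
- by move=> i; rewrite /upd /=; case: ifP => //; lia.
- move=> c m' cs sm mc inv; apply: wp_set; rewrite /= mc (sm vmark) // (s1 vmark) // mm // addn1.
    by apply: leq_trans B2; case: layer_marks.
  have pw : m' vpw 0 = p by rewrite sm.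
  move=> i; rewrite /upd /= pw.
  case: eqP => [->|ne].
    have -> : p + 2 <= p + 2 + c < p + 2 + c.+1 by lia.
    by rewrite addKn.
  rewrite inv.
  by have -> : (p + 2 <= i < p + 2 + c.+1) = (p + 2 <= i < p + 2 + c) by lia.
move=> m2 s2 o2.
have nq2 : m2 vnq 0 = k by rewrite s2 // s1.
apply: wp_set; rewrite /= nq2 addn1; first by apply: leq_trans kn (leq_trans nX XB).
apply: hQ.
- apply: same_trans (same_sub _ s1) (same_trans (same_sub _ s2) _); try by apply/allP.
  exact: same_upd.
- by [].
- move=> i; rewrite /upd /= o2 m1o /p.
  have -> : (2 * n + 2 + k * (s + 2) + 2 <= 2 * n + 2 + i < 2 * n + 2 + k * (s + 2) + 2 + s)
     = (k * (s + 2) + 2 <= i < k.+1 * (s + 2)) by lia.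
  have -> : (2 * n + 2 + i == (2 * n + 2 + k * (s + 2)).+1) = (i == (k * (s + 2)).+1) by lia.
  have -> : (2 * n + 2 + i == 2 * n + 2 + k * (s + 2)) = (i == k * (s + 2)) by lia.
  rewrite mulSn; move: (k * (s + 2)) => e.
  case: ifP => h1.
    have -> : e <= i < s + 2 + e by lia.
    have -> : i - e = (2 * n + 2 + i - (2 * n + 2 + e + 2)).+2 by lia.
    by rewrite /block /= nth_mkseq //; lia.
  case: eqP => [->|n1].
    have -> : e <= e.+1 < s + 2 + e by lia.
    by rewrite subSnn.
  case: eqP => [->|n2].
    have -> : e <= e < s + 2 + e by lia.
    by rewrite subnn.
  by have -> : (e <= i < s + 2 + e) = false by lia.
Qed.

Definition forward_ids :=
  vx :: vnq :: vt :: vl :: vd :: oarr :: layer_ids.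

Lemma wp_forward m (Q : arrays -> Prop) : env m ->
  (forall l x, 0 < l <= n -> x < N -> m vG (l * N + x) = G l x) ->
  (forall m', same forward_ids m m' -> sched n (m' vS) ->
    m' vnq 0 = size (active_layers n) ->
    (forall i, i < size (blocks n) -> m' oarr (2 * n + 2 + i) = nth 0 (blocks n) i) -> Q m') ->
  wp forward Q m.
Proof.
move=> em mG hQ; rewrite /forward.
apply: wp_seq; apply: wp_set => //; apply: wp_seq; apply: wp_set => //=.
have em1 : env (upd (upd m vx 0 0) vnq 0 0) by do 2 apply: env_upd => //.
apply: (@wp_for _ _ _ _ _ _ n (fun t m' => [/\ m' vx 0 = gst t, sched t (m' vS),
  m' vnq 0 = size (active_layers t) &
  forall i, i < size (blocks t) -> m' oarr (2 * n + 2 + i) = nth 0 (blocks t) i])) => //.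
- by rewrite /= (envN em1).
- by split=> //; apply: sched0.
- move=> t m' tn sm mt [ix iS inq io].
  have em' : env m' by apply: (env_same sm).
  have nB := leq_trans nX XB; have NB := leq_trans NX XB.
  have xN : gst t < N by apply: path_state_lt; apply: ltnW.
  have et : ds t.+1 = G t.+1 (gst t) by rewrite /greedy path_state_greedy.
  apply: wp_seq; apply: wp_set; rewrite /= mt addn1; first exact: leq_trans tn nB.
  have mG' : m' vG (t.+1 * N + gst t) = ds t.+1.
    by rewrite sm // /upd /= mG // et.
  have dB : ds t.+1 <= B.
    by apply: ltnW; rewrite et; apply: leq_trans (G_lt _ xN) (leq_trans decX XB); lia.
  apply: wp_seq; apply: wp_set; rewrite /upd /= (envB em') ix mG' //.
  apply: wp_seq; apply: (@wp_run_layer _ t.+1 (ds t.+1) (gst t)) => //.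
  + apply: (@env_same [:: vd; vl] m') => // a; rewrite !inE negb_or => /andP[h1 h2] i.
    by rewrite (negbTE h1) (negbTE h2).
  + by apply: ltnW; apply: leq_trans xN NB.
  move=> m2 s2 c2 y2 q2 mk2 S2.
  have e2 : env m2.
    apply: (env_same s2) => //.
    apply: (@env_same [:: vd; vl] m') => // a; rewrite !inE negb_or => /andP[h1 h2] i.
    by rewrite (negbTE h1) (negbTE h2).
  have sc2 : sched t.+1 (m2 vS).
    by apply: schedS (iS) S2 => //.
  have nq2 : m2 vnq 0 = size (active_layers t) by rewrite s2 //= inq.
  have l2 : m2 vl 0 = t.+1 by rewrite s2.
  have o2 i : m2 oarr i = m' oarr i by rewrite s2.
  apply: wp_seq; apply: wp_set; rewrite /= y2.
    by apply: ltnW; apply: leq_trans NB; apply: transit_lt.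
  have bS : blocks t.+1 = blocks t ++ (if active t then block t else [::]).
    by rewrite /blocks active_layersS map_cat flatten_cat; case: active; rewrite //= cats0.
  have sb : size (block t) = s + 2 by rewrite /= size_mkseq addn2.
  apply: wp_if; rewrite /upd /= q2 => ac.
    have {}ac : active t by rewrite /active; case: (0 < _) ac.
    apply: (@wp_record_layer _ t (size (active_layers t))) => //.
    - exact: (env_upd 0 _ _ e2).
    - by apply: leq_ltn_trans (size_active_layers t) tn.
    move=> m3 s3 nq3 o3; split.
    - by rewrite /upd /= s3.
    - have eS : forall j, m3 vS j = m2 vS j by move=> j; rewrite s3.
      case: sc2 => a1 a2 a3 a4; split; rewrite /upd /=.
      + by move=> j jn; rewrite eS; apply: a1.
      + by move=> j k jn kn jk; rewrite !eS; apply: a2.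
      + by rewrite -a3; apply: eq_bigr => j _; rewrite eS.
      + by move=> j jn; rewrite eS; apply: a4.
    - by rewrite /upd /= nq3 active_layersS ac size_cat addn1.
    - rewrite bS ac size_cat sb size_blocks => i hi; rewrite /upd /= o3 nth_cat size_blocks.
      case: (ltnP i (size (active_layers t) * (s + 2))) => h /=.
        by rewrite o2; apply: io; rewrite size_blocks.
      by rewrite mulSn addnC hi.
  have {}ac : active t = false by rewrite /active; case: (0 < _) ac.
  apply: wp_skip; rewrite /upd /=; split=> //.
  - by rewrite nq2 active_layersS ac cats0.
  - by rewrite bS ac cats0 => i hi; rewrite o2 io.
- move=> m' sm [_ iS inq io]; apply: hQ => //.
  apply: same_trans (same_sub _ sm); last by apply/allP.
  by apply: same_trans (same_upd _ _ _ _) (same_upd _ _ _ _).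
Qed.

Definition output_solution : hcmd :=
  HFor vj ($vN)%H
    (oarr <<-[2 * $vj + 1] vS@[$vj] ;; oarr <<-[2 * $vj + 2] $vD + 1) ;;
  oarr <<-[2 * $vN + 1] $vnq + 1 ;;
  oarr <<-[2 * $vN + 2 + $vnq * (s + 2)] 0.

Definition solution_word (S : nat -> nat) : word :=
  flatten [seq [:: (S j).-1; D] | j <- iota 0 n] ++ size (active_layers n) ::
  flatten [seq [:: (U t.+1).-1; D] ++ mkseq (fun i => layer_marks t i : nat) s
          | t <- active_layers n].

Lemma blocksE : map predn (blocks n) =
  flatten [seq [:: (U t.+1).-1; D] ++ mkseq (fun i => layer_marks t i : nat) s
          | t <- active_layers n].
Proof.
rewrite /blocks map_flatten -map_comp; congr flatten; apply: eq_map => t /=.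
by congr (_ :: _ :: _); rewrite /mkseq -map_comp; apply: eq_map.
Qed.

(** A job starts no earlier than its release date, which is positive after the shift. This makes
    [(S j).-1] an exact undoing of the shift. *)
Lemma sched_start_gt0 S j : sched n S -> j < n -> 0 < S j.
Proof.
move=> [_ _ _ h4] jn; have [|t [_ _ h h']] := h4 j jn; first exact: done_n.
by have := rel_gt0 jn; lia.
Qed.

Lemma sched_le S j : sched n S -> j < n -> S j <= Um + n * P.
Proof.
move=> [h1 _ _ _] jn; apply: leq_trans (leq_addr P _) _.
apply: leq_trans (h1 j jn _) _; first exact: done_n.
have h i : st n i <= n by rewrite -ltnS digit_lt.
by rewrite /avail leq_add ?U_le_Um // leq_mul2r h orbT.
Qed.

Lemma blocks_gt0 x : x \in blocks n -> 0 < x.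
Proof.
case/flatten_mapP => t; rewrite mem_filter mem_iota add0n => /and3P[_ _ tn].
rewrite !inE => /or3P[/eqP->|/eqP->|/mapP[i _ ->]] //.
by apply: leq_ltn_trans (Ulast tn).
Qed.

Lemma size_starts (S : nat -> nat) k :
  size (flatten [seq [:: (S j).-1; D] | j <- iota 0 k]) = 2 * k.
Proof.
rewrite size_flatten /shape -[in RHS](size_iota 0 k).
by elim: (iota 0 k) => //= a r ->; rewrite mulnS.
Qed.

Lemma size_solution_word S :
  size (solution_word S) = 2 * n + 1 + size (active_layers n) * (s + 2).
Proof. by rewrite size_cat size_starts /= -blocksE size_map size_blocks addn1 addSnnS. Qed.

Lemma wp_output_solution m (Q : arrays -> Prop) : env m -> sched n (m vS) ->
  m vnq 0 = size (active_layers n) ->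
  (forall i, i < size (blocks n) -> m oarr (2 * n + 2 + i) = nth 0 (blocks n) i) ->
  (forall m', let o := solution_word (m vS) in
    (forall i, i < size o -> m' oarr i.+1 = (nth 0 o i).+1) ->
    m' oarr (size o).+1 = 0 -> Q m') ->
  wp output_solution Q m.
Proof.
move=> em sc mq mo hQ; rewrite /output_solution; apply: wp_seq.
pose A k := flatten [seq [:: (m vS j).-1; D] | j <- iota 0 k].
have sA k : size (A k) = 2 * k by apply: size_starts.
apply: (@wp_for _ _ _ _ _ _ n (fun k m' =>
  (forall i, i < 2 * k -> m' oarr i.+1 = (nth 0 (A k) i).+1) /\
  (forall i, 2 * k < i -> m' oarr i = m oarr i))) => //.
- by rewrite /= (envN em).
- move=> j m' jn sm mj [h1 h2]; have em' : env m' by apply: (env_same sm).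
  have Sj := sched_start_gt0 sc jn.
  apply: wp_seq; apply: wp_set; rewrite /= mj (sm vS) //.
    apply: leq_trans (sched_le sc jn) (leq_trans _ FB).
    by rewrite leq_add2l leq_mul2r leq_addr orbT.
  apply: wp_set; rewrite /upd /= ?(envD em') addn1 //; rewrite mj.
  have AS : A j.+1 = A j ++ [:: (m vS j).-1; D].
    by rewrite /A -[j.+1]addn1 iotaD map_cat flatten_cat.
  split=> i hi.
    rewrite AS nth_cat sA.
    have [lt|ge] := ltnP i (2 * j).
      by do 2 (case: eqP => ?; first lia); apply: h1.
    have [->|->] : i = 2 * j \/ i = (2 * j).+1 by lia.
      case: eqP => ?; first lia.
      by rewrite subnn /= addn1 eqxx prednK.
    by rewrite subSnn /= addn2 eqxx.
  by do 2 (case: eqP => ?; first lia); apply: h2; lia.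
move=> m1 s1 [h1 h2]; have e1 : env m1 by apply: (env_same s1).
have q1 : m1 vnq 0 = size (active_layers n) by rewrite s1.
have qn := size_active_layers n.
apply: wp_seq; apply: wp_set; rewrite /= ?(envN e1) q1 addn1.
  apply: leq_trans (leq_trans outX XB); lia.
apply: wp_set => //; rewrite /upd /= (envN e1) q1.
apply: hQ.
  rewrite size_solution_word => i hi; rewrite /= /solution_word -/(A n).
  case: eqP => ?; first lia.
  rewrite nth_cat sA; have [lt|ge] := ltnP i (2 * n).
    by case: eqP => ?; [lia|apply: h1].
  have [->|gt] := eqVneq i (2 * n); first by rewrite addn1 eqxx subnn.
  case: eqP => ?; first lia.
  have -> : i - 2 * n = (i - (2 * n).+1).+1 by lia.
  have bi : i - (2 * n).+1 < size (blocks n) by rewrite size_blocks; lia.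
  rewrite /= -blocksE (nth_map 0) // prednK; last by apply: blocks_gt0; apply: mem_nth.
  rewrite h2; last by lia.
  by rewrite -mo //; congr (m _ _); lia.
by rewrite size_solution_word /=; case: eqP => //; lia.
Qed.

End Forward.
End Program.

(** * Reading the instance *)

Section Times.
Variables (n : nat) (rel : nat -> nat).
Hypothesis rel_gt0 : forall j, j < n -> 0 < rel j.

Definition horizon := 1 + \sum_(j < n) rel j.

(** The default [u + horizon] exceeds every release date, so any date after [u] replaces it. *)
Fixpoint scan_time u k :=
  if k is k'.+1 then
    if (u < rel k') && (rel k' < scan_time u k') then rel k' else scan_time u k'
  else u + horizon.

(* [times] enumerates 0 and the distinct values of [rel] in increasing order,
   continued by steps of length [horizon]. *)
Definition times l := iter l (fun u => scan_time u n) 0.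

Lemma rel_lt_horizon j : j < n -> rel j < horizon.
Proof.
by move=> jn; rewrite /horizon add1n ltnS (bigD1 (Ordinal jn)) //= leq_addr.
Qed.

Lemma scan_time_bounds u k : u < scan_time u k <= u + horizon.
Proof.
elim: k => [|k IH] /=; first by rewrite -{1}(addn0 u) ltn_add2l leqnn.
by case: ifP => // /andP[h1 h2]; lia.
Qed.

Lemma scan_time_le u k j : k <= n -> j < k -> u < rel j -> scan_time u k <= rel j.
Proof.
elim: k => // k IH kn jk uj /=.
case: (eqVneq j k) uj => [->|ne] uj.
  by rewrite uj /=; case: ltnP.
have := IH (ltnW kn) _ uj; case: ifP => //; lia.
Qed.

Lemma scan_time_rel u k : scan_time u k = u + horizon \/
  exists j, [/\ j < k, u < rel j & scan_time u k = rel j].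
Proof.
elim: k => [|k IH] /=; first by left.
case: ifP => [/andP[h1 h2]|_]; first by right; exists k.
by case: IH => [->|[j [jk uj e]]]; [left|right; exists j; split=> //; apply: leqW].
Qed.

Lemma times_lt l : times l < times l.+1.
Proof. by have /andP[] := scan_time_bounds (times l) n. Qed.

Lemma times_le l : times l <= l * horizon.
Proof.
elim: l => // l IH; have /andP[_ h] := scan_time_bounds (times l) n.
by rewrite /= mulSn addnC (leq_trans h) // leq_add2r.
Qed.

(** Each step captures at least one more job as long as some release date lies ahead; afterwards all
    [n] jobs are counted. Hence [n] steps list all dates, however many coincide. *)
Lemma count_times l : l <= n -> l <= \sum_(j < n) (rel j <= times l).
Proof.
elim: l => // l IH ln; have {}IH := IH (ltnW ln).
have lt := times_lt l.
have mono (j : 'I_n) : (rel j <= times l) <= (rel j <= times l.+1).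
  by case: (leqP (rel j) (times l)) => // h; rewrite (leq_trans h (ltnW lt)).
case: (boolP [forall j : 'I_n, rel j <= times l]) => [/forallP al|].
  apply: leq_trans ln _; rewrite -[X in X <= _]card_ord -sum1_card.
  by apply: leq_sum => j _; rewrite (leq_trans (al j) (ltnW lt)).
rewrite negb_forall => /existsP[j]; rewrite -ltnNge => hj.
have le := scan_time_le (leqnn n) (ltn_ord j) hj.
have [e|[j' [jn' uj' e]]] := scan_time_rel (times l) n.
  by have := rel_lt_horizon (ltn_ord j); rewrite e in le; lia.
apply: leq_ltn_trans IH _.
rewrite (bigD1 (Ordinal jn')) //= [X in _ < X](bigD1 (Ordinal jn')) //=.
have f1 : (rel j' <= times l) = false by rewrite leqNgt uj'.
have f2 : rel j' <= times l.+1 by rewrite /= e.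
rewrite f1 f2 add0n add1n ltnS.
by apply: leq_sum => i _; apply: mono.
Qed.

Lemma rel_times j : j < n -> exists2 l, l <= n & rel j = times l.
Proof.
move=> jn; have all_le : rel j <= times n.
  rewrite leqNgt; apply/negP => lt; have := count_times (leqnn n).
  have f : (rel j <= times n) = false by rewrite leqNgt lt.
  rewrite (bigD1 (Ordinal jn)) //= f add0n => h.
  have : \sum_(i < n | i != Ordinal jn) (rel i <= times n) <= \sum_(i < n | i != Ordinal jn) 1.
    by apply: leq_sum => i _; exact: leq_b1.
  rewrite sum1_card => h2; have := leq_trans h h2.
  by rewrite cardC1 card_ord; lia.
(* This least [l] is positive, so [rel j] lies after [times l.-1], and the scan from there cannot
   overshoot it. *)
have [|l hl hmin] := @ex_minnP (fun l => rel j <= times l); first by exists n.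
exists l; first exact: hmin.
apply/eqP; rewrite eqn_leq hl /=; case: l hl hmin => [|l] hl hmin.
  by have := leq_trans (rel_gt0 jn) hl.
apply: scan_time_le => //; rewrite ltnNge; apply/negP => /hmin.
by rewrite ltnn.
Qed.

End Times.

(** Entries 1 to 3 hold [n] and the fraction of [K_0], the next [2 * s] the other costs; each job
    takes four entries for its two fractions and [s] for its resource vector. *)
Definition block_start (s : nat) : hexp := (4 + 2 * s + $vj * (4 + s))%H.

Definition common_denominator (s : nat) : hcmd :=
  vD <<- vW@[3] ;;
  HFor vi s (vD <<- $vD * vW@[5 + 2 * $vi]) ;;
  HFor vj ($vN)%H
    (vv <<- block_start s ;;
     vD <<- $vD * (vW@[$vv + 1] * vW@[$vv + 3])).

Definition scale_costs (s : nat) : hcmd :=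
  vK0 <<- vW@[2] * ($vD / vW@[3]) ;;
  HFor vi s (vK <<-[$vi] vW@[4 + 2 * $vi] * ($vD / vW@[5 + 2 * $vi])).

Definition scale_jobs (s : nat) : hcmd :=
  vH <<- 1 ;;
  vP <<- 0 ;;
  HFor vj ($vN)%H
    (vv <<- block_start s ;;
     vP <<- vW@[$vv] * ($vD / vW@[$vv + 1]) ;;
     vR <<-[$vj] vW@[$vv + 2] * ($vD / vW@[$vv + 3]) + 1 ;;
     vH <<- $vH + vR@[$vj] ;;
     HFor vi s (HIf (vW@[$vv + 4 + $vi])%H (vQ <<-[$vj] $vi) hskip)).

Definition list_times : hcmd :=
  vU <<-[0] 0 ;;
  HFor vt ($vN)%H
    (vv <<- vU@[$vt] + $vH ;;
     HFor vj ($vN)%H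
       (HIf ((vR@[$vj] - vU@[$vt]) * ($vv - vR@[$vj]))%H (vv <<- vR@[$vj]) hskip) ;;
     vU <<-[$vt + 1] $vv).

Definition table_width (s : nat) : hcmd :=
  vB <<- 1 ;;
  HFor vi s.+2 (vB <<- $vB * ($vN + 1)).

Definition prepare (s : nat) : hcmd :=
  vN <<- vW@[1] ;;
  common_denominator s ;;
  scale_costs s ;;
  scale_jobs s ;;
  list_times ;;
  table_width s.

Lemma leq_prod_prefix (F : nat -> nat) k n : (forall i, i < n -> 0 < F i) -> k <= n ->
  \prod_(i < k) F i <= \prod_(i < n) F i.
Proof.
move=> F0 kn; rewrite -(subnKC kn) big_split_ord /= leq_pmulr //.
by rewrite prodn_cond_gt0 // => i _; apply: F0; have := ltn_ord i; lia.
Qed.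

(** * Verification of the preprocessing *)

Section Prepare.
Variables (B X n s : nat) (k0n k0d : nat) (kn kd pn pd rn rd res : nat -> nat) (P : nat).
Hypotheses (k0d_gt0 : 0 < k0d) (kd_gt0 : forall i, i < s -> 0 < kd i)
  (pd_gt0 : forall j, j < n -> 0 < pd j) (rd_gt0 : forall j, j < n -> 0 < rd j).

(** The plain product rather than a least common multiple: no gcd is computed, and [prod_wsize]
    still keeps its length linear in that of the input. *)
Definition denom := k0d * \prod_(i < s) kd i * \prod_(j < n) (pd j * rd j).
Definition scaled_K0 := k0n * (denom %/ k0d).
Definition scaled_K i := kn i * (denom %/ kd i).
Definition scaled_rel j := rn j * (denom %/ rd j) + 1.

Hypotheses (P_def : forall j, j < n -> pn j * (denom %/ pd j) = P) (P0 : n = 0 -> P = 0)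
  (res_lt : forall j, j < n -> res j < s).
Notation rel := scaled_rel.
Notation H := (horizon n rel).
Notation N := (n.+1 ^ s.+2).
Hypotheses (XB : X <= B) (nX : n <= X) (s2X : s.+2 <= X) (NX : N <= X)
  (wX : 4 + 2 * s + n * (4 + s) <= X)
  (denomB : denom <= B) (K0B : scaled_K0 <= B) (KB : forall i, i < s -> scaled_K i <= B)
  (PB : P <= B) (HB : n.+1 * H <= B).

Notation bs j := (4 + 2 * s + j * (4 + s)).

Record input_ok (m : arrays) : Prop := InputOk {
  inN : m vW 1 = n; inK0n : m vW 2 = k0n; inK0d : m vW 3 = k0d;
  inKn : forall i, i < s -> m vW (4 + 2 * i) = kn i;
  inKd : forall i, i < s -> m vW (5 + 2 * i) = kd i;
  inPn : forall j, j < n -> m vW (bs j) = pn j;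
  inPd : forall j, j < n -> m vW (bs j + 1) = pd j;
  inRn : forall j, j < n -> m vW (bs j + 2) = rn j;
  inRd : forall j, j < n -> m vW (bs j + 3) = rd j;
  inQ : forall j i, j < n -> i < s -> m vW (bs j + 4 + i) = (i == res j) }.

Lemma input_ok_same ws m m' : same ws m m' -> vW \notin ws -> input_ok m -> input_ok m'.
Proof. by move=> sm h [*]; split=> *; rewrite (sm _ h); auto. Qed.

Notation wp := (wp B X).

Lemma block_start_le j : j < n -> bs j <= B.
Proof.
move=> jn; apply: leq_trans (leq_trans wX XB); rewrite leq_add2l leq_mul2r.
by rewrite (ltnW jn) orbT.
Qed.

Lemma wp_common_denominator m (Q : arrays -> Prop) : input_ok m -> m vN 0 = n ->
  (forall m', same [:: vD; vi; vj; vv] m m' -> m' vD 0 = denom -> Q m') ->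
  wp (common_denominator s) Q m.
Proof.
move=> im mN hQ; rewrite /common_denominator.
have p2 : 0 < \prod_(j < n) (pd j * rd j).
  by rewrite prodn_cond_gt0 // => j _; rewrite muln_gt0 pd_gt0 ?rd_gt0.
have p1 : 0 < \prod_(i < s) kd i by rewrite prodn_cond_gt0 // => i _; apply: kd_gt0.
have b1 k : k <= s -> k0d * \prod_(i < k) kd i <= B.
  move=> ks; apply: leq_trans denomB; apply: leq_trans (leq_pmulr _ p2).
  by rewrite leq_mul2l leq_prod_prefix ?orbT.
apply: wp_seq; apply: wp_set; rewrite /= (inK0d im).
  by have := b1 0 (leq0n _); rewrite big_ord0 muln1.
apply: wp_seq.
apply: (@wp_for _ _ _ _ _ _ s (fun k m' => m' vD 0 = k0d * \prod_(i < k) kd i)) => //.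
- by apply: leq_trans s2X; lia.
- by rewrite /upd /= big_ord0 muln1.
- move=> i m' ilt sm mi hD.
  have e : heval m' ($vD * vW@[5 + 2 * $vi])%H = k0d * \prod_(i < i.+1) kd i.
    by rewrite /= hD mi (sm vW) // /upd /= (inKd im) // big_ord_recr /= mulnA.
  by apply: wp_set; rewrite e ?b1.
move=> m1 s1 D1.
have i1 : input_ok m1.
  by apply: (input_ok_same s1) => //; apply: (@input_ok_same [:: vD] m) => //; apply: same_upd.
apply: (@wp_for _ _ _ _ _ _ n (fun k m' => m' vD 0 =
  k0d * \prod_(i < s) kd i * \prod_(j < k) (pd j * rd j))) => //.
- by rewrite /= s1.
- by rewrite /upd /= big_ord0 muln1.
- move=> j m' jn sm mj hD; have i2 : input_ok m' by apply: (input_ok_same sm).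
  apply: wp_seq; apply: wp_set; rewrite /= mj; first exact: block_start_le.
  apply: wp_set; rewrite /upd /= hD (inPd i2) // (inRd i2) // -mulnA;
    have -> : (\prod_(j0 < j) (pd j0 * rd j0)) * (pd j * rd j) =
       \prod_(j0 < j.+1) (pd j0 * rd j0) by rewrite big_ord_recr.
    apply: leq_trans denomB; rewrite leq_mul2l.
    by rewrite (@leq_prod_prefix (fun j => pd j * rd j)) ?orbT // => i hi; rewrite muln_gt0 pd_gt0 ?rd_gt0.
  by [].
move=> m2 s2 D2; apply: hQ => //.
apply: same_trans (same_sub _ s2); last by apply/allP.
apply: same_trans (same_sub _ s1); last by apply/allP.
exact: same_upd.
Qed.

Lemma wp_scale_costs m (Q : arrays -> Prop) : input_ok m -> m vD 0 = denom ->
  (forall m', same [:: vK0; vK; vi] m m' -> m' vK0 0 = scaled_K0 ->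
     (forall i, i < s -> m' vK i = scaled_K i) -> Q m') ->
  wp (scale_costs s) Q m.
Proof.
move=> im mD hQ; rewrite /scale_costs; apply: wp_seq.
apply: wp_set; rewrite /= (inK0n im) (inK0d im) mD //.
apply: (@wp_for _ _ _ _ _ _ s (fun k m' => forall i, i < k -> m' vK i = scaled_K i)) => //.
- by apply: leq_trans s2X; lia.
- move=> i m' ilt sm mi hK.
  have e : heval m' (vW@[4 + 2 * $vi] * ($vD / vW@[5 + 2 * $vi]))%H = scaled_K i.
    by rewrite /= mi !sm // /upd /= (inKn im) // (inKd im) // mD.
  apply: wp_set; rewrite e ?KB //= => i' hi; rewrite /upd /= mi.
  by case: eqP => [->|ne] //; apply: hK; lia.
move=> m1 s1 K1; apply: hQ => //.
- by apply: same_trans (same_sub _ s1); [apply: same_upd|apply/allP].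
- by rewrite s1 // /upd.
Qed.

Definition partial_horizon k := 1 + \sum_(j < k) rel j.

Lemma horizon_le : H <= B.
Proof. by apply: leq_trans HB; rewrite leq_pmull. Qed.

Lemma partial_horizon_le k : k <= n -> partial_horizon k <= B.
Proof.
move=> kle; apply: leq_trans horizon_le; rewrite leq_add2l -(subnKC kle) big_split_ord /=.
exact: leq_addr.
Qed.

Lemma rel_le j : j < n -> rel j <= B.
Proof. by move=> jn; apply: leq_trans horizon_le; apply/ltnW/rel_lt_horizon. Qed.

Lemma wp_scale_jobs m (Q : arrays -> Prop) : input_ok m -> m vD 0 = denom -> m vN 0 = n ->
  (forall m', same [:: vH; vP; vj; vv; vR; vi; vQ; vtmp] m m' -> m' vH 0 = H ->
     m' vP 0 = P -> (forall j, j < n -> m' vR j = rel j) ->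
     (forall j, j < n -> m' vQ j = res j) -> Q m') ->
  wp (scale_jobs s) Q m.
Proof.
move=> im mD mN hQ; rewrite /scale_jobs.
have B1 : 1 <= B by apply: leq_trans horizon_le.
apply: wp_seq; apply: wp_set => //; apply: wp_seq; apply: wp_set => //=.
(* Every job overwrites [vP] with the same value; for [n = 0] it keeps its initial 0, in accordance
   with [P0]. *)
apply: (@wp_for _ _ _ _ _ _ n (fun k m' => [/\ m' vH 0 = partial_horizon k,
  0 < k -> m' vP 0 = P, k = 0 -> m' vP 0 = 0, forall j, j < k -> m' vR j = rel j &
  forall j, j < k -> m' vQ j = res j])) => //.
- by rewrite /upd /=; split=> //; rewrite /partial_horizon big_ord0.
- move=> j m' jn sm mj [hH hP _ hR hq].
  have i1 : input_ok m'.
    by apply: (input_ok_same sm) => //; apply: (@input_ok_same [:: vH; vP] m) => //;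
       apply: same_trans (same_upd _ _ _ _) (same_upd _ _ _ _).
  have D1 : m' vD 0 = denom by rewrite sm.
  have hS : partial_horizon j + rel j = partial_horizon j.+1.
    by rewrite /partial_horizon big_ord_recr /= addnA.
  apply: wp_seq; apply: wp_set; rewrite /= mj; first exact: block_start_le.
  apply: wp_seq; apply: wp_set; rewrite /upd /= (inPn i1) // (inPd i1) // D1 P_def //.
  apply: wp_seq; apply: wp_set; rewrite /upd /= (inRn i1) // (inRd i1) // D1 -/(rel j).
    exact: rel_le.
  apply: wp_seq; apply: wp_set; rewrite /upd /= mj eqxx hH hS; first exact: partial_horizon_le.
  lazymatch goal with |- wp _ _ ?mm => set m1 := mm end.
  have s1 : same [:: vv; vP; vR; vH] m' m1.
    move=> a; rewrite !inE !negb_or => /and4P[h1 h2 h3 h4] i; rewrite /m1.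
    by rewrite (negbTE h1) (negbTE h2) (negbTE h3) (negbTE h4).
  apply: (@wp_for _ _ _ _ _ _ s (fun k m' =>
    (forall j', j' < j -> m' vQ j' = res j') /\ (res j < k -> m' vQ j = res j))) => //.
  + by apply: leq_trans s2X; lia.
  + move=> i m2 ilt s2 mi [h1 h2].
    have e : heval m2 (vW@[$vv + 4 + $vi])%H = (i == res j).
      by rewrite /= mi !s2 // s1 //= (inQ i1).
    have j2 : m2 vj 0 = j by rewrite s2 // s1.
    apply: wp_if; rewrite e => c.
      have {c} c : i = res j by case: (i =P res j) c.
      apply: wp_set; rewrite /= mi; first by apply: leq_trans (ltnW ilt) _; lia.
      rewrite j2; split=> [j' hj|_]; rewrite /upd /= ?eqxx //.
      by rewrite ltn_eqF // h1.
    have {}c : i <> res j by move=> ei; rewrite ei eqxx in c.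
    apply: wp_skip.
    by rewrite /upd /=; split=> // hh; apply: h2; lia.
  + move=> m2 s2 [h1 h2]; rewrite /upd /=; split=> //.
    * by rewrite s2.
    * by rewrite s2.
    * move=> j'; rewrite ltnS leq_eqVlt => hj; rewrite s2 // /m1 /=.
      by case: eqP hj => [->|ne] //= hj; apply: hR.
    * move=> j'; rewrite ltnS leq_eqVlt => /orP[/eqP->|hj]; last exact: h1.
      by apply: h2; apply: res_lt.
move=> m1 s1 [hH hP hP0 hR hq]; apply: hQ => //.
- by apply: same_trans (same_sub _ s1); [apply: same_trans (same_upd _ _ _ _) (same_upd _ _ _ _)|apply/allP].
- by case: (posnP n) => [n0|]; [rewrite P0 // hP0|apply: hP].
Qed.

Lemma wp_list_times m (Q : arrays -> Prop) : m vN 0 = n -> m vH 0 = H ->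
  (forall j, j < n -> m vR j = rel j) ->
  (forall m', same [:: vU; vt; vv; vj; vtmp] m m' ->
     (forall l, l <= n -> m' vU l = times n rel l) -> Q m') ->
  wp list_times Q m.
Proof.
move=> mN mH mR hQ; rewrite /list_times; apply: wp_seq; apply: wp_set => //=.
apply: (@wp_for _ _ _ _ _ _ n (fun k m' => forall l, l <= k -> m' vU l = times n rel l)) => //.
- by move=> l; rewrite leqn0 => /eqP->; rewrite /upd.
- move=> t m' tn sm mt hU.
  have uB : times n rel t + H <= B.
    apply: leq_trans HB; rewrite mulSn addnC leq_add2l.
    by apply: leq_trans (times_le _ _ _) _; rewrite leq_mul2r (ltnW tn) orbT.
  have H1 : m' vH 0 = H by rewrite sm.
  apply: wp_seq; apply: wp_set; rewrite /= mt hU // H1 //.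
  set m1 := upd m' vv 0 _.
  have s1 : same [:: vv] m' m1 by apply: same_upd.
  apply: wp_seq; apply: (@wp_for _ _ _ _ _ _ n (fun k m' => m' vv 0 =
    scan_time n rel (times n rel t) k)) => //.
  + by rewrite /= s1 // sm.
  + move=> j m2 jn s2 mj hv.
    have R2 : m2 vR j = rel j by rewrite s2 // s1 // sm // /upd /= mR.
    have U2 : m2 vU (m2 vt 0) = times n rel t by rewrite !s2 // !s1 // mt hU.
    have ec : (heval m2 ((vR@[$vj] - vU@[$vt]) * ($vv - vR@[$vj]))%H != 0) =
      (times n rel t < rel j) && (rel j < scan_time n rel (times n rel t) j).
      by rewrite /= mj R2 U2 hv muln_eq0 negb_or !subn_eq0 -!ltnNge.
    apply: wp_if; rewrite ?ec => c.
      apply: wp_set; rewrite /= mj R2; first exact: rel_le.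
      by rewrite /upd /= c.
    have {}c : (times n rel t < rel j) && (rel j < scan_time n rel (times n rel t) j) = false.
      by rewrite -ec c.
    apply: wp_skip.
    by rewrite /upd /= c.
  + move=> m2 s2 hv.
    have t2 : m2 vt 0 = t by rewrite s2 // s1.
    apply: wp_set; rewrite /= hv.
      by have /andP[_ h] := scan_time_bounds n rel (times n rel t) n; apply: leq_trans h uB.
    rewrite t2 addn1 => l; rewrite /upd /= leq_eqVlt => hl.
    case: eqP hl => [->|ne] //= hl.
    by rewrite s2 // s1 // hU.
move=> m1 s1 hU; apply: hQ => //.
by apply: same_trans (same_sub _ s1); [apply: same_upd|apply/allP].
Qed.

Lemma wp_prepare m (Q : arrays -> Prop) : input_ok m ->
  (forall m', env n s rel res (times n rel) P scaled_K0 scaled_K denom m' -> Q m') ->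
  wp (prepare s) Q m.
Proof.
move=> im hQ; rewrite /prepare.
have nB := leq_trans nX XB.
apply: wp_seq; apply: wp_set; rewrite /= (inN im) //; set m1 := upd m _ _ _.
have s1 : same [:: vN] m m1 by apply: same_upd.
have i1 : input_ok m1 by apply: (input_ok_same s1).
apply: wp_seq; apply: wp_common_denominator => // m2 s2 D2.
have i2 : input_ok m2 by apply: (input_ok_same s2).
apply: wp_seq; apply: wp_scale_costs => // m3 s3 K03 K3.
have i3 : input_ok m3 by apply: (input_ok_same s3).
have N3 : m3 vN 0 = n by rewrite s3 // s2.
apply: wp_seq; apply: wp_scale_jobs => //; first by rewrite s3.
move=> m4 s4 H4 P4 R4 Q4.
apply: wp_seq; apply: wp_list_times => //; first by rewrite s4.
move=> m5 s5 U5; rewrite /table_width.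
have B1 : 1 <= B by apply: leq_trans horizon_le.
apply: wp_seq; apply: wp_set => //=.
apply: (@wp_for _ _ _ _ _ _ s.+2 (fun k m' => m' vB 0 = n.+1 ^ k)) => //.
- move=> i m' ilt sm mi hB.
  have N' : m' vN 0 = n by rewrite sm // /upd /= s5 // s4.
  apply: wp_set; rewrite /= hB N' addn1 -expnSr //.
  by apply: leq_trans (leq_trans NX XB); rewrite leq_pexp2l.
move=> m6 s6 B6; apply: hQ; split; rewrite // ?s6 // /upd /=.
- by rewrite s5 // s4.
- by rewrite s5 // s4 // s3.
- by rewrite s5 // s4.
- by move=> i hi; rewrite s6 // /upd /= s5 // s4 // K3.
- by rewrite s5.
- by move=> j jn; rewrite s6 // /upd /= s5 // R4.
- by move=> j jn; rewrite s6 // /upd /= s5 // Q4.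
- by move=> l ln; rewrite s6 // /upd /= U5.
Qed.

End Prepare.

Import Order.TTheory GRing.Theory Num.Theory.

(** * Optimality *)

Definition extend (A : Type) (n : nat) (f : 'I_n -> A) (d : A) (j : nat) : A :=
  if insub j is Some j' then f j' else d.

Lemma extendE (A : Type) n (f : 'I_n -> A) d (j : 'I_n) : extend f d j = f j.
Proof. by rewrite /extend valK. Qed.

Lemma extend_lt (A : Type) n (f : 'I_n -> A) d j (jn : (j < n)%N) :
  extend f d j = f (Ordinal jn).
Proof. by rewrite -(extendE f d). Qed.

Lemma in_bigcup_seq (T : finType) (A : eqType) (r : seq A) (p : pred A) (F : A -> {set T}) x :
  (x \in \bigcup_(q <- r | p q) F q)%SET = has (fun q => p q && (x \in F q)) r.
Proof.
elim: r => [|q r IH]; first by rewrite big_nil in_set0.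
by rewrite big_cons /=; case: (p q) => //=; rewrite in_setU IH.
Qed.

Lemma natr_ord_sum (R : pzSemiRingType) n : (n%:R = \sum_(j < n) 1 :> R)%R.
Proof. by rewrite sumr_const card_ord. Qed.

Section Optimality.
Local Open Scope ring_scope.
Variables (R : realFieldType) (s : nat) (I : instance R s).
Notation n := (njobs I).
Variables (D P K0 : nat) (K rel res U : nat -> nat) (r : 'I_n -> 'I_s).
Hypotheses (D_gt0 : (0 < D)%N) (req_r : forall j, req j = [set r j]%SET)
  (res_r : forall j : 'I_n, res j = r j)
  (rel_def : forall j : 'I_n, (rel j)%:R = rdate j * D%:R + 1)
  (P_def : forall j : 'I_n, P%:R = @ptime R s I j * D%:R)
  (K0_def : K0%:R = fixcost I * D%:R)
  (K_def : forall i : 'I_s, (K i)%:R = rcost I i * D%:R)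
  (U0 : U 0%N = 0%N) (Ulast : forall l, (U l < U l.+1)%N)
  (rel_U : forall j, (j < n)%N -> exists2 l, (l <= n)%N & rel j = U l).

Let DR : 0 < D%:R :> R. Proof. by rewrite ltr0n. Qed.

Let Ulast' l : (l < n)%N -> (U l < U l.+1)%N. Proof. by []. Qed.

Lemma res_lt j : (j < n)%N -> (res j < s)%N.
Proof. by move=> jn; rewrite -[j]/(val (Ordinal jn)) res_r. Qed.

Lemma rel_gt0 j : (j < n)%N -> (0 < rel j)%N.
Proof.
move=> jn; rewrite -(ltr_nat R) -[j]/(val (Ordinal jn)) rel_def.
by apply: ltr_wpDl; rewrite ?ltr01 // mulr_ge0 ?rdate_ge0 ?ler0n.
Qed.

Lemma U_ltn a b : (a < b)%N -> (U a < U b)%N.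
Proof. by elim: b => // b IH; rewrite ltnS leq_eqVlt => /orP[/eqP->|/IH /ltn_trans->]. Qed.

Lemma U_leq a b : (a <= b)%N -> (U a <= U b)%N.
Proof. by rewrite leq_eqVlt => /orP[/eqP->|/U_ltn/ltnW]. Qed.

Lemma U_ltnE a b : (U a < U b)%N = (a < b)%N.
Proof. by apply/idP/idP; [rewrite !ltnNge; apply/contra/U_leq|apply: U_ltn]. Qed.

(** * From a feasible solution to decisions *)

Section Lower.
Variable sol : solution I.
Hypothesis feas : feasible sol.

Definition tau (q : {set 'I_s} * R) : R := q.2 * D%:R + 1.

(* The replenishment [q] is moved back to the layer [l]. *)
Definition inlayer l q := ((U l)%:R <= tau q) && ((l == n) || (tau q < (U l.+1)%:R)).

Definition selected l : nat -> bool :=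
  extend (fun i : 'I_s => has (fun q => inlayer l q && (i \in q.1)) (repl sol)) false.

Definition moved_decision l := undigits 2 s (fun i => selected l i).

Lemma moved_decision_lt l : (moved_decision l < 2 ^ s)%N.
Proof. by apply: undigits_lt => i _; case: selected. Qed.

Lemma digit_moved l i : (i < s)%N -> digit 2 (moved_decision l) i = selected l i.
Proof. by move=> h; rewrite digit_undigits // => k _; case: selected. Qed.

Notation ds := moved_decision.
Notation st t := (digit n.+1 (path_state n s rel res U P ds t)).
Notation done_by t j := (done_by n s rel res U P ds t j).

Lemma done_mono t t' j : (j < n)%N -> (t <= t')%N -> (t' <= n)%N -> done_by t j -> done_by t' j.
Proof.
move=> jn; elim: t' => [|t' IH]; first by rewrite leqn0 => /eqP->.
rewrite leq_eqVlt => /orP[/eqP->//|tt] tn dj.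
by rewrite (@doneS n s rel res U P ds U0 Ulast' res_lt) // IH // ltnW.
Qed.

(** Feasibility gives a replenishment of the resource between release and start. Moved back to its
    layer [l], it is still not before the release date, which is itself a layer; so the job is
    served at [l] unless it was done earlier. *)
Lemma serving_layer (j : 'I_n) : exists l, [/\ (0 < l <= n)%N,
  (U l)%:R <= start sol j * D%:R + 1, selected l (res j) & done_by l j].
Proof.
have [_ /(_ j)] := feas; rewrite /ready req_r sub1set in_bigcup_seq.
case/hasP => q qr /andP[/andP[q1 q2] iq].
have h1 : (rel j)%:R <= tau q.
  by rewrite rel_def /tau lerD2r ler_wpM2r // ltW.
have [m mn em] := rel_U (ltn_ord j).
have m0 : (0 < m)%N by rewrite -U_ltnE U0 -em rel_gt0.
have ex : exists l, (l <= n)%N && ((U l)%:R <= tau q) by exists m; rewrite mn -em h1.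
have [|l /andP[ln lq] lmax] := ex_maxnP ex (m := n); first by move=> i /andP[].
have ml : (m <= l)%N by apply: lmax; rewrite mn -em.
have il : inlayer l q.
  rewrite /inlayer lq /=; have [//|ne] := eqVneq l n.
  rewrite ltNge /=; apply/negP => h; have hl : (l < n)%N && ((U l.+1)%:R <= tau q).
    by rewrite h andbT ltn_neqAle ne.
  by have := lmax _ hl; rewrite ltnn.
have sl : selected l (res j).
  by rewrite res_r /selected extendE; apply/hasP; exists q; rewrite // il.
exists l; split=> //.
- by rewrite (leq_trans m0 ml).
- by apply: le_trans lq _; rewrite /tau lerD2r ler_wpM2r // ltW.
case: l {lmax lq il} ln ml sl => [|l] ln ml sl; first by move: m0; rewrite lt0n; case: m ml {mn em}.
rewrite (@doneS n s rel res U P ds U0 Ulast' res_lt) //.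
rewrite /served digit_moved ?res_lt // sl /= andbT em U_leq //=.
by rewrite done_byE em; case: leqP.
Qed.

(** Only forced service at layer [n] could mark an unselected resource. But [serving_layer] finishes
    the job at a layer where its resource is selected; were that layer before [n], the job would not
    be pending at [n]. *)
Lemma marked_selected t i : (t < n)%N ->
  marked n rel res U t.+1 (ds t.+1) (st t) n i -> selected t.+1 i.
Proof.
move=> tn /markedP[j [jn sj <-]].
have /and3P[_ _ /orP[]] := sj; first by rewrite digit_moved ?res_lt //; case: selected.
move=> /eqP et; have [l [/andP[l0 ln] _ sl dl]] := serving_layer (Ordinal jn).
have [<-//|ne] := eqVneq l t.+1.
have /negP[] := served_done tn sj.
by apply: (@done_mono l) dl => //; lia.
Qed.

Lemma inlayer_inj a b q : (a <= n)%N -> (b <= n)%N -> inlayer a q -> inlayer b q -> a = b.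
Proof.
wlog ab : a b / (a < b)%N => [hw|].
  move=> an bn ha hb; case: (ltngtP a b) => // h; first exact: (hw a b).
  by apply/esym; apply: (hw b a).
move=> an bn /andP[_ ha] /andP[hb _].
have na : a == n = false by lia.
rewrite na /= in ha; have := le_lt_trans hb ha.
by rewrite ltr_nat U_ltnE ltnS leqNgt ab.
Qed.

Definition qcost (q : {set 'I_s} * R) : R := K0%:R + \sum_(i in q.1) (K i)%:R.

Lemma qcost_ge0 q : 0 <= qcost q.
Proof. by rewrite addr_ge0 ?ler0n // sumr_ge0. Qed.

Lemma ler_mem_sum (A : eqType) (l : seq A) (F : A -> R) x :
  (forall y, 0 <= F y) -> x \in l -> F x <= \sum_(y <- l) F y.
Proof. by move=> F0 xl; rewrite (big_rem x) //= lerDl sumr_ge0. Qed.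

(** Several replenishments may be moved to one layer, where the marked resources are paid for once:
    [K0] is covered by one of them, each marked resource by one that contains it. *)
Lemma setcost_layer t : (t < n)%N ->
  (setcost n s rel res U K0 K t.+1 (ds t.+1) (st t))%:R
    <= \sum_(q <- repl sol | inlayer t.+1 q) qcost q.
Proof.
move=> tn; rewrite /setcost; case: posnP => [c0|c0].
  rewrite mul0n add0n big1 ?sumr_ge0 //; first by move=> q _; apply: qcost_ge0.
  move=> i /markedP[j [jn sj _]]; exfalso; move: c0.
  by rewrite /cnt (bigD1 (Ordinal jn)) //= sj.
have [j sj] : exists j : 'I_n, served n rel res U t.+1 (ds t.+1) (st t) j.
  apply/existsP; apply: contraLR c0 => /existsPn h.
  by rewrite -leqNgt /cnt big1 // => j _; rewrite (negbTE (h j)).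
have cover (i : 'I_s) : marked n rel res U t.+1 (ds t.+1) (st t) n i ->
    exists2 q, q \in [seq q <- repl sol | inlayer t.+1 q] & i \in q.1.
  move/(marked_selected tn); rewrite /selected extendE => /hasP[q qr /andP[h1 h2]].
  by exists q; rewrite ?mem_filter ?h1.
rewrite -[X in _ <= X]big_filter; set Qs := [seq q <- _ | _] in cover *.
rewrite mul1n natrD /qcost big_split /=; apply: lerD.
  have [|q qQ _] := cover (r j).
    by apply/markedP; exists j; rewrite res_r.
  by apply: (@ler_mem_sum _ Qs (fun=> K0%:R) q) => // y; apply: ler0n.
rewrite (eq_bigr (fun q : {set 'I_s} * R => \sum_(i < s) (i \in q.1)%:R * (K i)%:R)); last first.
  by move=> q _; rewrite big_mkcond; apply: eq_bigr => i _; case: ifP; rewrite ?mul1r ?mul0r.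
rewrite exchange_big /= natr_sum big_mkcond; apply: ler_sum => i _.
case: ifP => [/cover[q qQ iq]|_]; last by apply: sumr_ge0 => q _; rewrite mulr_ge0.
apply: (@le_trans _ _ ((i \in q.1)%:R * (K i)%:R)); first by rewrite iq mul1r.
by apply: (@ler_mem_sum _ Qs (fun q : {set 'I_s} * R => (i \in q.1)%:R * (K i)%:R) q) => // y; rewrite mulr_ge0.
Qed.

(** Each replenishment lies in at most one layer, so exchanging the sums counts its cost at most
    once. *)
Lemma setcost_lower :
  (\sum_(t < n) setcost n s rel res U K0 K t.+1 (ds t.+1) (st t))%N%:R
    <= repl_cost sol * D%:R.
Proof.
rewrite natr_sum; apply: le_trans (ler_sum _ (fun t _ => setcost_layer (ltn_ord t))) _.
have -> : repl_cost sol * D%:R = \sum_(q <- repl sol) qcost q.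
  rewrite /repl_cost mulr_suml; apply: eq_bigr => q _.
  rewrite mulrDl -K0_def mulr_suml /qcost; congr (_ + _); apply: eq_bigr => i _.
  by rewrite K_def.
rewrite (eq_bigr (fun t : 'I_n => \sum_(q <- repl sol) (inlayer t.+1 q)%:R * qcost q)); last first.
  by move=> t _; rewrite big_mkcond; apply: eq_bigr => q _; case: ifP; rewrite ?mul1r ?mul0r.
rewrite exchange_big /=; apply: ler_sum => q _.
have [/existsP[t ht]|/existsPn h] := boolP [exists t : 'I_n, inlayer t.+1 q].
  rewrite (bigD1 t) //= ht mul1r big1 ?addr0 // => t' ne.
  case: (boolP (inlayer t'.+1 q)) => h; last by rewrite mul0r.
  have [e] := inlayer_inj (ltn_ord t') (ltn_ord t) h ht.
  by move: ne; rewrite -val_eqE /= e eqxx.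
by rewrite big1 ?qcost_ge0 // => t _; rewrite (negbTE (h t)) mul0r.
Qed.

Lemma objective_lower : (0 < n -> 0 < P)%N ->
  (path_cost n s rel res U P K0 K ds n)%:R <= objective sol * D%:R + n%:R.
Proof.
move=> P0; rewrite /path_cost.
have -> : (\sum_(t < n) lcost n s rel res U P K0 K t.+1 (ds t.+1) (st t) =
  \sum_(t < n) jobcost n s rel res U P t.+1 (ds t.+1) (st t) n +
  \sum_(t < n) setcost n s rel res U K0 K t.+1 (ds t.+1) (st t))%N by rewrite -big_split.
rewrite natrD /objective mulrDl -addrA [X in _ <= _ + X]addrC addrA.
apply: lerD; last exact: setcost_lower.
pose sig (j : 'I_n) := start sol j * D%:R + 1.
(* The term [n] absorbs the shift by one in every [sig j]. *)
have -> : (\sum_j completion sol j) * D%:R + n%:R = \sum_j (sig j + P%:R).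
  rewrite mulr_suml (natr_ord_sum R n) -big_split /=.
  by apply: eq_bigr => j _; rewrite /completion /sig mulrDl -P_def; ring.
case: (posnP n) => [n0|n0].
  rewrite [X in X%:R <= _]big1 ?mulr0n; last by case=> t tn; exfalso; lia.
  by rewrite big1 //; case=> j jn; exfalso; lia.
apply: (@jobcost_lower n s rel res U P ds U0 Ulast' rel_gt0 rel_U res_lt).
- exact: P0.
- move=> j k jk; have [/(_ j k jk)+ _] := feas; rewrite /completion.
  by case=> h; [left|right]; rewrite /sig (P_def j) addrAC lerD2r -mulrDl ler_wpM2r ?(ltW DR) //;
    move: (P_def k); rewrite (P_def j) => /(mulIf (lt0r_neq0 DR)) e; rewrite ?e // -?e.
(* The serving layer is not after the start of [j], hence it precedes layer [t.+1]. *)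
- move=> t j tn lt; have [l [/andP[l0 ln] h _ dl]] := serving_layer j.
  apply: (@done_mono l) dl => //; last exact: ltnW.
  by have := le_lt_trans h lt; rewrite ltr_nat U_ltnE ltnS.
Qed.

End Lower.

(** * The solution read off the greedy path *)

Section Upper.
Variable G : nat -> nat -> nat.
Notation ds := (greedy n s rel res U P G).
Notation st t := (digit n.+1 (path_state n s rel res U P ds t)).
Notation layer_marks := (layer_marks n s rel res U P G).
Notation active_layers := (active_layers n s rel res U P G).
Notation active := (active n s rel res U P G).
Variable S : nat -> nat.
Hypothesis S_sched : sched n s rel res U P ds n S.

Definition mark_set t : {set 'I_s} := [set i : 'I_s | layer_marks t i]%SET.

(** Inactive layers are left out: they serve nobody, and an empty replenishment would still be
    charged [K_0]. *)
Definition greedy_repl : seq ({set 'I_s} * R) :=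
  [seq (mark_set t, (U t.+1).-1%:R / D%:R) | t <- active_layers n].

Lemma U_gt0 t : (0 < U t.+1)%N.
Proof. exact: leq_ltn_trans (Ulast t). Qed.

Lemma natr_pred k : (0 < k)%N -> k.-1%:R = k%:R - 1 :> R.
Proof. by case: k => // k _ /=; rewrite -natr1 addrK. Qed.

Lemma greedy_repl_sorted : sorted <%R (unzip2 greedy_repl).
Proof.
rewrite /greedy_repl /unzip2 -map_comp.
apply: (homo_sorted (e := ltn)); last by rewrite sorted_filter ?iota_ltn_sorted //; apply: ltn_trans.
move=> a b ab /=; rewrite ltr_pM2r ?invr_gt0 // ltr_nat.
have := U_gt0 a; have := U_gt0 b; have : (U a.+1 < U b.+1)%N by apply: U_ltn.
by lia.
Qed.

Definition greedy_solution : solution I :=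
  @Solution R s I (fun j => (S j).-1%:R / D%:R) greedy_repl greedy_repl_sorted.

Lemma S_gt0 j : (j < n)%N -> (0 < S j)%N.
Proof.
move=> jn; case: S_sched => _ _ _ /(_ j jn)[|t [_ _ _]].
  exact: (@done_n n s rel res U P ds U0 Ulast' rel_U res_lt).
exact: leq_trans (U_gt0 t).
Qed.

Lemma greedy_done j : (j < n)%N -> done_by n s rel res U P ds n j.
Proof. exact: (@done_n n s rel res U P ds U0 Ulast' rel_U res_lt). Qed.

Lemma greedy_feasible : feasible greedy_solution.
Proof.
case: S_sched => _ h2 _ h4; split.
  have aux (j k : 'I_n) : (S j + P <= S k)%N ->
      completion greedy_solution j <= start greedy_solution k.
    move=> h; rewrite /completion /= -(ler_pM2r DR) mulrDl -P_def.
    rewrite !mulfVK ?lt0r_neq0 // !natr_pred ?S_gt0 //.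
    by have := h; rewrite -(ler_nat R) natrD; lra.
  move=> j k jk.
  have [h|h] := h2 j k (ltn_ord j) (ltn_ord k) jk (greedy_done (ltn_ord j)) (greedy_done (ltn_ord k)).
    by left; apply: aux.
  by right; apply: aux.
move=> j; rewrite /ready req_r sub1set in_bigcup_seq.
have [t [tn mt h5 h6]] := h4 j (ltn_ord j) (greedy_done (ltn_ord j)).
apply/hasP; exists (mark_set t, (U t.+1).-1%:R / D%:R).
  apply/mapP; exists t => //; rewrite mem_filter mem_iota add0n tn andbT.
  move/markedP: mt => [j' [jn' sj' _]].
  by rewrite activeE /cnt (bigD1 (Ordinal jn')) //= sj'.
rewrite /= inE -res_r /layer_marks mt andbT.
rewrite ler_pdivlMr // ler_pM2r ?invr_gt0 // ler_nat natr_pred ?U_gt0 //.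
apply/andP; split; last by have := S_gt0 (ltn_ord j); lia.
have : (rel j)%:R <= (U t.+1)%:R :> R by rewrite ler_nat.
by rewrite rel_def; lra.
Qed.

Lemma setcost_inactive t : ~~ active t ->
  setcost n s rel res U K0 K t.+1 (ds t.+1) (st t) = 0%N.
Proof.
rewrite activeE -leqNgt leqn0 => /eqP c0; rewrite /setcost c0 mul0n add0n big1 //.
move=> i /markedP[j [jn sj _]]; exfalso; move: c0.
by rewrite /cnt (bigD1 (Ordinal jn)) //= sj.
Qed.

(** An equality, since the model charges exactly the marked resources of active layers and the
    schedule attains [jobcost]. *)
Lemma objective_greedy :
  objective greedy_solution * D%:R + n%:R = (path_cost n s rel res U P K0 K ds n)%:R.
Proof.
rewrite /path_cost.
have -> : (\sum_(t < n) lcost n s rel res U P K0 K t.+1 (ds t.+1) (st t) =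
  \sum_(t < n) jobcost n s rel res U P t.+1 (ds t.+1) (st t) n +
  \sum_(t < n) setcost n s rel res U K0 K t.+1 (ds t.+1) (st t))%N by rewrite -big_split.
rewrite natrD /objective mulrDl -addrA [X in _ + X = _]addrC addrA; congr (_ + _).
  case: S_sched => _ _ <- _.
  rewrite [X in _ = X%:R](eq_bigl xpredT); last by move=> j; rewrite greedy_done.
  rewrite natr_sum mulr_suml (natr_ord_sum R n) -big_split /=.
  apply: eq_bigr => j _; rewrite /completion /= mulrDl -P_def mulfVK ?lt0r_neq0 //.
  by rewrite natr_pred ?S_gt0 // natrD; ring.
rewrite /repl_cost /greedy_solution /= /greedy_repl big_map big_filter mulr_suml natr_sum.
rewrite -(big_mkord xpredT (fun t => (setcost n s rel res U K0 K t.+1 (ds t.+1) (st t))%:R)).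
rewrite /index_iota subn0 [LHS]big_mkcond; apply: eq_bigr => t _.
case: ifPn => [ac|/setcost_inactive-> //].
rewrite /setcost -[(0 < _)%N]/(active t) ac mul1n natrD mulrDl -K0_def; congr (_ + _).
rewrite mulr_suml natr_sum; apply: eq_big => i; first by rewrite inE.
by move=> _; rewrite K_def.
Qed.

End Upper.

End Optimality.

(** * The theorem *)

Definition solver (s : nat) : hcmd :=
  prepare s ;; fill_table s ;; forward s ;; output_solution s.

(** The parameter [s] enters the program only in constants, never as an array number, so the check
    computes for a variable [s]. *)
Lemma wf_solver s : wf (solver s).
Proof. by []. Qed.

Lemma input_untouched s : 0 \notin writes (solver s).
Proof. by []. Qed.

(** The summands account for the states, the decisions, the digits of a state, the output length and
    the input length, using [n <= y]. *)
Definition loop_bound (s y : nat) : nat :=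
  y.+1 ^ s.+2 + 2 ^ s + s.+2 + (2 * y + 2 + y * (s + 2)) + y.+1.

(** With [Z = 2 ^ (y + s).+1], the input numbers and the common denominator are at most [Z], and the
    table entries at most [Z ^ 9] by [layers_Z]. The first summand keeps loop counters in range. *)
Definition value_bound (s y : nat) : nat :=
  loop_bound s y + (2 ^ (y + s).+1) ^ 9.

Definition value_bits (s y : nat) : nat :=
  (loop_bound s y).+1 + 9 * (y + s).+2.

Lemma bitlen_add a b : bitlen (a + b) <= bitlen a + bitlen b.
Proof.
apply: bitlen_ltn => //; rewrite expnD.
by have := ltn_bitlen a; have := ltn_bitlen b; nia.
Qed.

Lemma bitlen_value_bound s y : bitlen (value_bound s y) <= value_bits s y.
Proof.
apply: leq_trans (bitlen_add _ _) _; apply: leq_add; first exact: bitlen_leS.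
apply: leq_trans (bitlen_exp _ _) _ => //; rewrite leq_mul2l /=.
by apply: bitlen_ltn => //; rewrite ltn_exp2l.
Qed.

Lemma polybounded_loop_bound s : polybounded (loop_bound s).
Proof.
have hS : polybounded succn.
  by apply: polybounded_le (polybounded_add polybounded_id (polybounded_const 1)) => y /=; rewrite addn1.
rewrite /loop_bound.
by do ?[exact: polybounded_const | exact: polybounded_id | exact: hS
      | exact: (polybounded_exp s.+2 hS) | apply: polybounded_mul | apply: polybounded_add].
Qed.

Lemma polybounded_value_bits s : polybounded (value_bits s).
Proof.
apply: (@polybounded_le _ (fun y => (loop_bound s y + 1) + 9 * (y + s.+2))).
  by move=> y; rewrite /value_bits addn1 !addnS.
by do ?[exact: polybounded_const | exact: polybounded_id | exact: polybounded_loop_bound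
      | apply: polybounded_mul | apply: polybounded_add].
Qed.

Lemma nth_flatten_blocks (A : Type) (f : A -> seq nat) k x0 (r : seq A) i c :
  (forall x, size (f x) = k) -> i < size r -> c < k ->
  nth 0 (flatten [seq f x | x <- r]) (i * k + c) = nth 0 (f (nth x0 r i)) c.
Proof.
move=> fk; elim: r i => // a r IH [|i] ir ck /=; rewrite nth_cat fk.
  by rewrite mul0n add0n ck.
have -> : (i.+1 * k + c < k) = false by lia.
have -> : i.+1 * k + c - k = i * k + c by lia.
exact: IH.
Qed.

Lemma nth_flatten_ord n (f : 'I_n -> seq nat) k (j : 'I_n) c :
  (forall x, size (f x) = k) -> c < k ->
  nth 0 (flatten [seq f x | x <- enum 'I_n]) (j * k + c) = nth 0 (f j) c.
Proof.
move=> fk ck; rewrite (nth_flatten_blocks j) ?nth_ord_enum //.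
by rewrite size_enum_ord.
Qed.

Lemma size_flatten_ord n (f : 'I_n -> seq nat) k : (forall x, size (f x) = k) ->
  size (flatten [seq f x | x <- enum 'I_n]) = n * k.
Proof.
move=> fk; rewrite size_flatten /shape -[in RHS](size_enum_ord n).
by elim: (enum 'I_n) => //= a r ->; rewrite fk mulSn.
Qed.

Lemma size_le_wsize w : size w <= wsize w.
Proof.
rewrite /wsize; elim: w => //= x w IH; rewrite big_cons.
by rewrite -add1n leq_add.
Qed.

Lemma mem_wsize x w : x \in w -> x < 2 ^ wsize w.
Proof.
move=> xw; apply: leq_trans (ltn_bitlen x) _; rewrite leq_exp2l //.
by rewrite /wsize (big_rem x) //= leq_addr.
Qed.

(** Lengths add up while numbers multiply; [maxn x 1] keeps null entries from annihilating the
    product. *)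
Lemma prod_wsize w : \prod_(x <- w) maxn x 1 <= 2 ^ wsize w.
Proof.
rewrite /wsize; elim: w => [|x w IH]; first by rewrite !big_nil.
rewrite !big_cons expnD leq_mul //.
by have := ltn_bitlen x; rewrite geq_max expn_gt0 andbT => /ltnW.
Qed.

(** * Magnitudes of the scaled data *)

Section Bounds.
Variables (n s P K0 Z : nat) (K rel : nat -> nat).
Hypotheses (Z2 : 2 <= Z) (nZ : n < Z) (sZ : s < Z) (PZ : P <= Z ^ 2) (K0Z : K0 <= Z ^ 2)
  (KZ : forall i, i < s -> K i <= Z ^ 2) (relZ : forall j, j < n -> rel j <= Z ^ 2 + 1).
Notation H := (horizon n rel).

Lemma leq_exp_Z a b : a <= b -> Z ^ a <= Z ^ b.
Proof. by move=> ab; rewrite leq_pexp2l // ltnW. Qed.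

Lemma horizon_Z : H <= Z ^ 3.
Proof.
clear sZ PZ K0Z KZ.
rewrite /horizon; have h : \sum_(j < n) rel j <= n * (Z ^ 2 + 1).
  apply: (@leq_trans (\sum_(j < n) (Z ^ 2 + 1))); first by apply: leq_sum => j _; apply: relZ.
  by rewrite big_const_ord iter_addn_0 mulnC.
apply: leq_trans (leq_add (leqnn 1) h) _.
by rewrite (expnS Z 2) -mulnn; nia.
Qed.

Lemma busy_Z : n * H + (n + n) * P <= Z ^ 5.
Proof.
clear sZ K0Z KZ.
apply: (@leq_trans (Z ^ 4 + Z ^ 4)).
  apply: leq_add.
    by rewrite (expnS Z 3) leq_mul ?horizon_Z // ltnW.
  rewrite (expnD Z 2 2) leq_mul // -mulnn; nia.
by rewrite (expnS Z 4) addnn -mul2n leq_mul2r Z2 orbT.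
Qed.

(** The horizon is at most [Z ^ 3], layers [Z ^ 4], completion times [Z ^ 5], their sum in a layer
    [Z ^ 6]; the setup costs and the factor [n.+1] then fit in [Z ^ 9]. *)
Lemma layers_Z : n.+1 * layer_bound n s P K0 K (n * H) <= Z ^ 9.
Proof.
rewrite (expnS Z 8) leq_mul // /layer_bound.
have h1 : n * (n * H + (n + n) * P) <= Z ^ 6.
  by rewrite (expnS Z 5) leq_mul ?busy_Z // ltnW.
have h2 : \sum_(i < s) K i <= Z ^ 3.
  apply: (@leq_trans (\sum_(j < s) (Z ^ 2))); first by apply: leq_sum => j _; apply: KZ.
  by rewrite big_const_ord iter_addn_0 mulnC (expnS Z 2) leq_mul // ltnW.
have h3 := @leq_exp_Z 2 6 isT; have h4 := @leq_exp_Z 3 6 isT.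
have h5 : 4 <= Z ^ 2 by rewrite -mulnn; nia.
by rewrite (expnD Z 2 6); nia.
Qed.

End Bounds.

Lemma scale_frac (R : realFieldType) (f : nat * nat) (x : R) (D : nat) :
  frac_of f x -> f.2 %| D -> ((f.1 * (D %/ f.2))%:R = x * D%:R)%R.
Proof.
move=> [f0 ->] dv; have f0' : (f.2%:R != 0 :> R)%R by rewrite pnatr_eq0.
rewrite natrM -{2}(divnK dv) natrM; field.
by [].
Qed.

(** * Correctness of the solver on a coded instance *)

Section Correctness.
Variables (R : realFieldType) (s : nat) (I : instance R s) (w : word).
Notation n := (njobs I).
Variables (fK0 : nat * nat) (fK : 'I_s -> nat * nat) (fp fr : 'I_n -> nat * nat).
Variables (r : 'I_n -> 'I_s) (p : R).
Hypotheses (K0_frac : frac_of fK0 (fixcost I)) (K_frac : forall i, frac_of (fK i) (rcost I i))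
  (p_frac : forall j, frac_of (fp j) (@ptime R s I j))
  (r_frac : forall j, frac_of (fr j) (@rdate R s I j))
  (p_eq : forall j, @ptime R s I j = p) (req_r : forall j, @req R s I j = [set r j]%SET).

Notation jobword j := (frac_word (fp j) ++ frac_word (fr j) ++ set_word (@req R s I j)).

Hypothesis w_def : w = n :: frac_word fK0
   ++ flatten [seq frac_word (fK i) | i <- enum 'I_s]
   ++ flatten [seq jobword j | j <- enum 'I_n].

Let kn := extend (fun i => (fK i).1) 0.
Let kd := extend (fun i => (fK i).2) 1.
Let pn := extend (fun j => (fp j).1) 0.
Let pd := extend (fun j => (fp j).2) 1.
Let rn := extend (fun j => (fr j).1) 0.
Let rd := extend (fun j => (fr j).2) 1.
Let res := extend (fun j => nat_of_ord (r j)) 0.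

Let D := denom n s fK0.2 kd pd rd.
Let K0 := scaled_K0 n s fK0.1 fK0.2 kd pd rd.
Let K := scaled_K n s fK0.2 kn kd pd rd.
Let rel := scaled_rel n s fK0.2 kd pd rn rd.
Let U := times n rel.
Let P := if n is 0 then 0 else pn 0 * (D %/ pd 0).

Lemma size_jobword j : size (jobword j) = 4 + s.
Proof. by rewrite /= /set_word size_map size_enum_ord. Qed.

Lemma size_word : size w = 3 + 2 * s + n * (4 + s).
Proof.
rewrite w_def -cat1s !size_cat (@size_flatten_ord s (fun i => frac_word (fK i)) 2) //.
rewrite (@size_flatten_ord n (fun j => jobword j) (4 + s) size_jobword).
by rewrite /=; lia.
Qed.

Lemma res_ltS j : j < n -> res j < s.
Proof. by move=> jn; rewrite /res extend_lt. Qed.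

Lemma kd_gt0 i : i < s -> 0 < kd i.
Proof. by move=> h; rewrite /kd extend_lt lt0n; case: (K_frac (Ordinal h)). Qed.

Lemma pd_gt0 j : j < n -> 0 < pd j.
Proof. by move=> h; rewrite /pd extend_lt lt0n; case: (p_frac (Ordinal h)). Qed.

Lemma rd_gt0 j : j < n -> 0 < rd j.
Proof. by move=> h; rewrite /rd extend_lt lt0n; case: (r_frac (Ordinal h)). Qed.

Lemma k0d_gt0 : 0 < fK0.2.
Proof. by rewrite lt0n; case: K0_frac. Qed.

Lemma D_gt0 : 0 < D.
Proof.
rewrite /D /denom !muln_gt0 k0d_gt0 !prodn_cond_gt0 //= => i _.
  by rewrite muln_gt0 pd_gt0 ?rd_gt0.
exact: kd_gt0.
Qed.

Lemma k0d_dvd : fK0.2 %| D.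
Proof. by rewrite /D /denom -mulnA dvdn_mulr. Qed.

Lemma kd_dvd (i : 'I_s) : (fK i).2 %| D.
Proof.
rewrite /D /denom dvdn_mulr // dvdn_mull // (bigD1 i) //= /kd extendE.
exact: dvdn_mulr.
Qed.

Lemma pd_dvd (j : 'I_n) : (fp j).2 %| D.
Proof.
rewrite /D /denom dvdn_mull // (bigD1 j) //= /pd extendE -mulnA.
exact: dvdn_mulr.
Qed.

Lemma rd_dvd (j : 'I_n) : (fr j).2 %| D.
Proof.
rewrite /D /denom dvdn_mull // (bigD1 j) //= /rd extendE -mulnA.
by rewrite dvdn_mull // dvdn_mulr.
Qed.

Lemma rel_scaled (j : 'I_n) : ((rel j)%:R = rdate j * D%:R + 1 :> R)%R.
Proof.
rewrite /rel /scaled_rel natrD -/D; congr (_ + _)%R.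
by rewrite /rn /rd !extendE (scale_frac (r_frac j) (rd_dvd j)).
Qed.

Lemma K0_scaled : (K0%:R = fixcost I * D%:R :> R)%R.
Proof. by rewrite /K0 /scaled_K0 -/D (scale_frac K0_frac k0d_dvd). Qed.

Lemma K_scaled (i : 'I_s) : ((K i)%:R = rcost I i * D%:R :> R)%R.
Proof. by rewrite /K /scaled_K /kn /kd !extendE -/D (scale_frac (K_frac i) (kd_dvd i)). Qed.

Lemma p_scaled (j : 'I_n) : ((pn j * (D %/ pd j))%:R = p * D%:R :> R)%R.
Proof. by rewrite /pn /pd !extendE -(p_eq j) (scale_frac (p_frac j) (pd_dvd j)). Qed.

(** Jobs may code the same processing time by different fractions; the scaled integers agree because
    their images in [R] do. *)
Lemma P_scaled j : j < n -> pn j * (D %/ pd j) = P.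
Proof.
move=> jn; have n0 : 0 < n by lia.
have -> : P = pn 0 * (D %/ pd 0) by rewrite /P; case: n n0.
apply/eqP; rewrite -(eqr_nat R).
by rewrite (p_scaled (Ordinal jn)) (p_scaled (Ordinal n0)).
Qed.

Lemma P_real (j : 'I_n) : (P%:R = @ptime R s I j * D%:R)%R.
Proof. by rewrite -(P_scaled (ltn_ord j)) p_scaled p_eq. Qed.

Lemma P_gt0 : 0 < n -> 0 < P.
Proof.
move=> n0; rewrite -(ltr_nat R) (P_real (Ordinal n0)).
by rewrite mulr_gt0 ?ptime_gt0 // ltr0n D_gt0.
Qed.

Lemma rel_pos j : j < n -> 0 < rel j.
Proof. by rewrite /rel /scaled_rel addn1. Qed.

Let y := wsize w.
Let Z := 2 ^ (y + s).+1.
Let B := value_bound s y.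
Let X := loop_bound s y.

Lemma n_le_y : n <= y.
Proof. by apply: leq_trans (size_le_wsize w); rewrite size_word; nia. Qed.

Lemma word_le_Z x : x \in w -> x <= Z.
Proof.
move/mem_wsize/ltnW => h; apply: leq_trans h _; rewrite leq_exp2l //.
by rewrite -/y; lia.
Qed.

(** The denominators sit at different positions of [w], so their product is part of the product over
    all entries. *)
Lemma D_le_Z : D <= Z.
Proof.
apply: (@leq_trans (\prod_(x <- w) maxn x 1)); last first.
  by apply: leq_trans (prod_wsize w) _; rewrite leq_exp2l // -/y; lia.
have m1 x : 0 < maxn x 1 by rewrite leq_max orbT.
have fw (f : nat * nat) : f.2 <= \prod_(x <- frac_word f) maxn x 1.
  rewrite /frac_word !big_cons big_nil muln1.
  by apply: leq_trans (leq_maxl _ 1) _; rewrite leq_pmull.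
have pos l : 0 < \prod_(x <- l) maxn x 1 by rewrite prodn_cond_gt0.
rewrite w_def big_cons; apply: leq_trans (leq_pmull _ (m1 _)).
rewrite !big_cat /D /denom -mulnA; apply: leq_mul; first exact: fw.
apply: leq_mul; rewrite big_flatten big_map big_enum.
  by apply: leq_prod => i _; rewrite /kd extendE; apply: fw.
apply: leq_prod => j _; rewrite /pd /rd !extendE !big_cat.
apply: leq_mul; first exact: fw.
by apply: leq_trans (fw _) (leq_pmulr _ (pos _)).
Qed.

Lemma frac_mem : [/\ fK0.1 \in w, forall i, (fK i).1 \in w,
  forall j, (fp j).1 \in w & forall j, (fr j).1 \in w].
Proof.
rewrite w_def; split.
- by rewrite !inE eqxx !orbT.
- move=> i; rewrite inE !mem_cat; apply/orP; right; apply/orP; right; apply/orP; left.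
  by apply/flatten_mapP; exists i; rewrite ?mem_enum ?inE ?eqxx.
- move=> j; rewrite inE !mem_cat; do 3 (apply/orP; right).
  by apply/flatten_mapP; exists j; rewrite ?mem_enum // !mem_cat !inE eqxx.
- move=> j; rewrite inE !mem_cat; do 3 (apply/orP; right).
  by apply/flatten_mapP; exists j; rewrite ?mem_enum // !mem_cat !inE eqxx ?orbT.
Qed.

Lemma scaled_le_Z a b : a <= Z -> a * (D %/ b) <= Z ^ 2.
Proof.
by move=> aZ; rewrite -mulnn leq_mul // (leq_trans (leq_div _ _)) // D_le_Z.
Qed.

Lemma P_le_Z : P <= Z ^ 2.
Proof.
case: (posnP n) => [n0|n0]; first by rewrite /P n0.
rewrite -(P_scaled n0) scaled_le_Z // /pn extend_lt.
by case: frac_mem => _ _ h _; apply: word_le_Z.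
Qed.

Lemma K0_le_Z : K0 <= Z ^ 2.
Proof. by apply: scaled_le_Z; case: frac_mem => h _ _ _; apply: word_le_Z. Qed.

Lemma K_le_Z i : i < s -> K i <= Z ^ 2.
Proof.
move=> h; apply: scaled_le_Z; rewrite /kn extend_lt.
by case: frac_mem => _ h' _ _; apply: word_le_Z.
Qed.

Lemma rel_le_Z j : j < n -> rel j <= Z ^ 2 + 1.
Proof.
move=> h; rewrite leq_add2r; apply: scaled_le_Z; rewrite /rn extend_lt.
by case: frac_mem => _ _ _ h'; apply: word_le_Z.
Qed.

Lemma Z_ge2 : 2 <= Z.
Proof. by rewrite -{1}(expn1 2) leq_exp2l. Qed.

Lemma n_lt_Z : n < Z.
Proof.
apply: leq_ltn_trans n_le_y _; apply: leq_trans (ltn_expl y (leqnn 2)) _.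
by rewrite leq_exp2l //; lia.
Qed.

Lemma s_lt_Z : s < Z.
Proof.
by apply: leq_trans (ltn_expl s (leqnn 2)) _; rewrite leq_exp2l //; lia.
Qed.

Lemma input_word_ok m : (forall i, i < size w -> m 0 i.+1 = nth 0 w i) ->
  input_ok n s fK0.1 fK0.2 kn kd pn pd rn rd res m.
Proof.
rewrite size_word => mw.
have getK (i : 'I_s) c : c < 2 -> m 0 (4 + (i * 2 + c)) = nth 0 (frac_word (fK i)) c.
  move=> c2; have il := ltn_ord i.
  rewrite add4n mw; last by nia.
  rewrite w_def /= nth_cat (size_flatten_ord (k := 2)) //.
  have -> : i * 2 + c < s * 2 by lia.
  by rewrite (nth_flatten_ord (k := 2)).
have getJ (j : 'I_n) c : c < 4 + s -> m 0 (4 + 2 * s + j * (4 + s) + c) = nth 0 (jobword j) c.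
  move=> c4; have jl := ltn_ord j.
  have -> : 4 + 2 * s + j * (4 + s) + c = (2 * s + (j * (4 + s) + c)).+4 by lia.
  rewrite mw; last by nia.
  rewrite w_def /= nth_cat (size_flatten_ord (k := 2)) //.
  have -> : (2 * s + (j * (4 + s) + c) < s * 2) = false by lia.
  have -> : 2 * s + (j * (4 + s) + c) - s * 2 = j * (4 + s) + c by lia.
  by rewrite (nth_flatten_ord (k := 4 + s)) // => x; apply: size_jobword.
split.
- by rewrite mw // w_def.
- by rewrite mw // w_def.
- by rewrite mw // w_def.
- move=> i h; rewrite /kn extend_lt; have := getK (Ordinal h) 0 isT.
  by rewrite addn0 mulnC.
- move=> i h; rewrite /kd extend_lt; have := getK (Ordinal h) 1 isT.
  by have -> : 4 + (Ordinal h * 2 + 1) = 5 + 2 * i by move=> /=; lia.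
- by move=> j h; rewrite /pn extend_lt; have := getJ (Ordinal h) 0 isT; rewrite addn0.
- by move=> j h; rewrite /pd extend_lt; have := getJ (Ordinal h) 1 isT.
- by move=> j h; rewrite /rn extend_lt; have := getJ (Ordinal h) 2 isT.
- by move=> j h; rewrite /rd extend_lt; have := getJ (Ordinal h) 3 isT.
- move=> j i h hi; rewrite -addnA.
  have /= -> := getJ (Ordinal h) (4 + i); last by rewrite ltn_add2l.
  rewrite /set_word (nth_map (Ordinal hi)) ?size_enum_ord // req_r in_set1.
  by rewrite (nth_ord_enum _ (Ordinal hi)) /res extend_lt.
Qed.

Lemma solver_correct m : (forall i, i < size w -> m 0 i.+1 = nth 0 w i) ->
  wp B X (solver s) (fun m' => exists o, [/\ size o <= X,
    forall i, i < size o -> m' oarr i.+1 = (nth 0 o i).+1, m' oarr (size o).+1 = 0 &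
    exists2 sol : solution I, encodes_solution sol o & optimal sol]) m.
Proof.
move=> mw; have iw := input_word_ok mw.
have ny := n_le_y.
have nX : n <= X by rewrite /X /loop_bound; lia.
have s2X : s.+2 <= X by rewrite /X /loop_bound; lia.
have NX : n.+1 ^ s.+2 <= X.
  have h : n.+1 ^ s.+2 <= y.+1 ^ s.+2 by rewrite leq_exp2r.
  by rewrite /X /loop_bound; lia.
have decX : 2 ^ s <= X by rewrite /X /loop_bound; lia.
(* The left-hand side is [(size w).+1]. *)
have wX : 4 + 2 * s + n * (4 + s) <= X.
  by have := size_le_wsize w; rewrite size_word -/y /X /loop_bound; lia.
have outX : 2 * n + 2 + n * (s + 2) <= X.
  have h : n * (s + 2) <= y * (s + 2) by rewrite leq_mul2r ny orbT.
  by rewrite /X /loop_bound; lia.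
have XB : X <= B by rewrite /B /value_bound leq_addr.
have ZB k : k <= 9 -> Z ^ k <= B.
  move=> k9; apply: leq_trans (leq_exp_Z Z_ge2 k9) _.
  by rewrite /B /value_bound leq_addl.
have B0 : 0 < B by apply: leq_trans (leq_trans s2X XB).
have DB : D < B.
  apply: leq_trans (ZB 2 isT); have := D_le_Z; have := Z_ge2; rewrite -mulnn; nia.
have HZ := horizon_Z Z_ge2 n_lt_Z rel_le_Z.
have FB : n * horizon n rel + (n + n) * P <= B.
  by apply: leq_trans (busy_Z Z_ge2 n_lt_Z P_le_Z rel_le_Z) (ZB 5 isT).
have CB : n.+1 * layer_bound n s P K0 K (n * horizon n rel) <= B.
  apply: leq_trans (ZB 9 isT).
  exact: (layers_Z Z_ge2 n_lt_Z s_lt_Z P_le_Z K0_le_Z K_le_Z rel_le_Z).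
have HB : n.+1 * horizon n rel <= B.
  by apply: leq_trans (ZB 4 isT); rewrite (expnS Z 3) leq_mul // n_lt_Z.
have UUm l : l <= n -> U l <= n * horizon n rel.
  by move=> ln; apply: leq_trans (times_le _ _ _) _; rewrite leq_mul2r ln orbT.
have Ul l : U l < U l.+1 by apply: times_lt.
have relU j : j < n -> exists2 l, l <= n & rel j = U l by move=> jn; exact: (@rel_times n rel rel_pos j jn).
rewrite /solver; apply: wp_seq.
apply: (@wp_prepare B X n s fK0.1 fK0.2 kn kd pn pd rn rd res P) => //.
- exact: k0d_gt0.
- exact: kd_gt0.
- exact: pd_gt0.
- exact: rd_gt0.
- exact: P_scaled.
- by move=> n0; rewrite /P n0.
- exact: res_ltS.
- exact: ltnW.
- by apply: leq_trans K0_le_Z (ZB 2 isT).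
- by move=> i h; apply: leq_trans (K_le_Z h) (ZB 2 isT).
- by apply: leq_trans P_le_Z (ZB 2 isT).
move=> m1 e1; rewrite -/D -/K0 -/K -/rel -/U in e1.
apply: wp_seq.
apply: (@wp_fill_table B X n s rel res U P K0 K D (n * horizon n rel)) => //.
  exact: res_ltS.
move=> m2 s2 [tok0 tok].
have e2 : env n s rel res U P K0 K D m2 by apply: (env_same s2).
pose T l x := m2 vT (l * n.+1 ^ s.+2 + x).
pose G l x := m2 vG (l * n.+1 ^ s.+2 + x).
apply: wp_seq.
apply: (@wp_forward B X n s rel res U P K0 K D (n * horizon n rel)
  B0 XB nX s2X NX decX UUm FB CB res_ltS G) => //.
- exact: rel_pos.
- by move=> l x hl hx; have [] := tok l x hl hx.
move=> m3 s3 sc3 q3 o3.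
have e3 : env n s rel res U P K0 K D m3 by apply: (env_same s3).
apply: (@wp_output_solution B X n s rel res U P K0 K D (n * horizon n rel)
  B0 XB nX s2X NX decX UUm FB CB res_ltS G) => //.
- exact: rel_pos.
move=> m4 o h4 z4; exists o; split=> //.
  rewrite /o size_solution_word; apply: leq_trans outX.
  have := size_active_layers n s rel res U P G n => h.
  have : size (active_layers n s rel res U P G n) * (s + 2) <= n * (s + 2) by rewrite leq_mul2r h orbT.
  by lia.
have res_r (j : 'I_n) : res j = r j by rewrite /res extendE.
have U0 : U 0 = 0 by [].
pose sol := greedy_solution I P rel res D_gt0 U0 Ul G (m3 vS).
exists sol.
  exists (fun j => ((m3 vS j).-1, D)),
    [seq ((U t.+1).-1, D) | t <- active_layers n s rel res U P G n].
  have D0 : D != 0 by rewrite -lt0n D_gt0.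
  split.
  - by move=> j; split.
  - by rewrite /sol /= /greedy_repl !size_map.
  - rewrite size_map => l hl; rewrite (nth_map 0) //.
    rewrite /sol /= /greedy_repl /unzip2 -map_comp (nth_map 0) //=.
  - rewrite /o /solution_word /sol /= /greedy_repl /unzip1 size_map.
    congr (_ ++ _ :: _).
      by rewrite -val_enum_ord -[X in flatten X = _]map_comp; congr flatten; apply: eq_map.
    rewrite -[X in zip _ X]map_comp zip_map -[X in _ = flatten X]map_comp.
    congr flatten; apply: eq_map => t /=.
    congr (_ :: _ :: _); rewrite /mkseq -val_enum_ord -[LHS]map_comp /set_word.
    by apply: eq_map => i /=; rewrite inE.
have fsol := greedy_feasible D_gt0 req_r res_r rel_scaled P_real U0 Ul relU sc3.
split=> // sol' fsol'.
have D0 : (0 < D%:R :> R)%R by rewrite ltr0n D_gt0.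
(* After scaling, the greedy objective is [T 1 0]; this is at most the path cost of the decisions
   moved from [sol'], itself at most the scaled objective of [sol']. *)
rewrite -(ler_pM2r D0) -(lerD2r n%:R)%R.
rewrite (objective_greedy D_gt0 res_r P_real K0_scaled K_scaled U0 Ul relU sc3).
apply: le_trans (objective_lower D_gt0 req_r res_r rel_scaled P_real K0_scaled K_scaled U0 Ul relU fsol' P_gt0).
rewrite ler_nat.
rewrite -(@bellman_greedy n s rel res U P K0 K T G).
- apply: bellman_le => //.
  + by move=> t x d tn xN dl; have [] := tok t.+1 x _ xN; last by move=> _ _ h _; apply: h.
  + exact: moved_decision_lt.
- done.
- by move=> t x tn xN; have [] := tok t.+1 x _ xN.
Qed.

End Correctness.

Theorem theorem6 (R : realFieldType) (s : nat) :
  poly_time_solvable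
    (fun I : instance R s => equal_ptimes I /\ single_resource I)
    (@encodes_instance R s) (@encodes_solution R s) (@optimal R s).
Proof.
(* The constants depend on [s] alone, as do the program and the polynomials bounding loop lengths
   and bit lengths. *)
have [c [k hck]] : polybounded (fun y => run_weight (loop_bound s y) (solver s) * value_bits s y).
  apply: polybounded_mul (polybounded_value_bits s).
  exact: polybounded_comp (polybounded_run_weight _) (polybounded_loop_bound s).
exists (Seq load (Seq (compile (solver s)) emit)), c, k.
move=> I w [[p p_eq] single] [fK0 [fK [fp [fr [hK0 hK hp hr ew]]]]].
have [r hreq] : exists r : 'I_(njobs I) -> 'I_s, forall j, @req R s I j = [set r j]%SET.
  apply: (@fin_all_exists _ (fun=> 'I_s) (fun j i => @req R s I j = [set i]%SET)) => j.
  by apply/cards1P; rewrite single.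
have XB : loop_bound s (wsize w) <= value_bound s (wsize w) by apply: leq_addr.
have [||||m [t [x1 x2 [sol x3 x4]]]] := @exec_program (solver s) (value_bound s (wsize w))
  (loop_bound s (wsize w)) w (fun o => exists2 sol : solution I, encodes_solution sol o & optimal sol)
  (wf_solver s) (input_untouched s) _ XB.
- by apply: leq_trans XB; rewrite /loop_bound; lia.
- by apply: leq_trans (size_le_wsize w) _; rewrite /loop_bound; lia.
- move=> x xw; apply: leq_trans (ltnW (mem_wsize xw)) (leq_trans _ (leq_addl _ _)).
  by rewrite -expnM leq_exp2l //; lia.
- exact: (solver_correct hK0 hK hp hr p_eq hreq ew).
exists m, t, sol; split=> //.
apply: leq_trans x2 (leq_trans _ (hck _)).
by rewrite leq_mul2l bitlen_value_bound orbT.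
Qed.
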